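(* Let $m$ be a positive integer and let $X^{(1)}, X^{(2)}, \ldots, X^{(m)}$ and $Y^{(1)}, Y^{(2)}, \ldots, Y^{(m)}$ be finite sets of nonnegative numbers less than $1$. For each $(s,i), (t,j) \in \{1, 2, \ldots, m\} \times \mathbb{Z}$, let $$K(s,i;t,j) = \frac{1}{4\pi^2} \oint \oint \frac{1}{w-z} \left( \frac{\prod_{k=t}^m F(Y^{(k)}; \{w^{-1}\}) \prod_{k=1}^s F(X^{(k)}; \{z\})}{\prod_{k=s}^m F(Y^{(k)}; \{z^{-1}\}) \prod_{k=1}^t F(X^{(k)}; \{w\})} \right) w^{j} z^{-i-1}\, dw\, dz,$$ where the contours are taken along the positively oriented circles $|z| = r_1$ and $|w| = r_2$, where $r_1$ and $r_2$ are any positive reals satisfying the following. If $s > t$, then $\max X^{(k)}, \max Y^{(k)} < r_1 < r_2 < \min((X^{(k)})^{-1}), \min((Y^{(k)})^{-1})$ for all integers $k \in [1,m]$; otherwise, $\max X^{(k)}, \max Y^{(k)} < r_2 < r_1 < \min((X^{(k)})^{-1}), \min((Y^{(k)})^{-1})$ for all integers $k \in [1,m]$. Then, for any finite subset $T = \{(a_1,b_1), (a_2,b_2), \ldots, (a_d,b_d)\} \subset \{1, 2, \ldots, m\} \times \mathbb{Z}$, $$\rho_{\mathbf{S}}(T) = \det \mathbf{K}_T,$$ where $\mathbf{K}_T$ is the $d \times d$ matrix whose $(r,c)$ entry is $K(a_r, b_r; a_c, b_c)$.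
   Context: $\mathbb{Y}$ is the set of all partitions, $\ell(\lambda)$ is the number of positive parts of a partition $\lambda$, and $s_\lambda$, $s_{\lambda/\mu}$ are Schur and skew-Schur polynomials. $F(X;Y) = \prod_{(x,y) \in X \times Y} (1-xy)^{-1}$. For a subset $S \subset \mathbb{C} \setminus \{0\}$, $S^{-1} = \{s^{-1}\}_{s \in S}$. For $\lambda = (\lambda^{(1)}, \ldots, \lambda^{(m)}) \in \mathbb{Y}^m$ and $\mu = (\mu^{(1)}, \ldots, \mu^{(m-1)}) \in \mathbb{Y}^{m-1}$ put $$\mathcal{W}_{X,Y}(\lambda,\mu) = s_{\lambda^{(1)}}(X^{(1)}) \left( \prod_{i=1}^{m-1} s_{\lambda^{(i+1)}/\mu^{(i)}}(X^{(i+1)})\, s_{\lambda^{(i)}/\mu^{(i)}}(Y^{(i)}) \right) s_{\lambda^{(m)}}(Y^{(m)}),$$ $Z_{X,Y} = \prod_{1 \le i \le j \le m} F(X^{(i)}; Y^{(j)})$, and $\mathbf{S}(\lambda,\mu) = \mathcal{W}_{X,Y}(\lambda,\mu)/Z_{X,Y}$. This is a probability measure on $\mathbb{Y}^m \times \mathbb{Y}^{m-1}$ (the Schur process); its projection to $\mathbb{Y}^m$ is $\mathbf{S}(\lambda) = \sum_{\mu \in \mathbb{Y}^{m-1}} \mathbf{S}(\lambda,\mu)$. For $\lambda \in \mathbb{Y}^m$, with $\lambda^{(i)} = (\lambda^{(i)}_1, \lambda^{(i)}_2, \ldots)$, let $\mathfrak{S}(\lambda)$ be the finite subset $\{(i,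 \lambda^{(i)}_j - j) : 1 \le i \le m,\ 1 \le j \le \ell(\lambda^{(i)})\} \subset \{1,\ldots,m\} \times \mathbb{Z}$. For finite $T \subset \{1,\ldots,m\} \times \mathbb{Z}$, the correlation function is $\rho_{\mathbf{S}}(T) = \sum_{\lambda \in \mathbb{Y}^m} \mathbf{1}_{T \subseteq \mathfrak{S}(\lambda)} \mathbf{S}(\lambda)$.
   Formalization: The point set S(λ) here consists of the points (i, λ^(i)_j − j) for all j ≥ 1, not only j ≤ ℓ(λ^(i)); with that cut-off the formula fails, e.g. for m = 1, X and Y empty, T = {(1,−1)}, where ρ = 0 but K = 1. Points with nonnegative second coordinate are the same. *)

(* Defs.v *)
(* MathComp / MathComp-Analysis, over an arbitrary R : realType. *)
From HB Require Import structures.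
From mathcomp Require Export all_boot all_order all_algebra.
From mathcomp Require Export finmap complex.
From mathcomp Require Export all_classical all_reals all_analysis.

Set Implicit Arguments.
Unset Strict Implicit.
Unset Printing Implicit Defensive.
Import Order.TTheory GRing.Theory Num.Theory numFieldNormedType.Exports.
Local Open Scope classical_set_scope.
Local Open Scope complex_scope.
Local Open Scope ring_scope.

(** * Partitions *)

(* A partition is the nonincreasing list of its positive parts, so [size la] is
   its length; the part of (0-based) index i is [nth 0 la i]. *)
Definition is_partition (s : seq nat) : bool :=
  sorted geq s && all (fun p => 0 < p)%N s.

Record intpart : Type := IntPart {
  parts :> seq nat;
  partsP : is_partition parts }.

HB.instance Definition _ := [isSub for parts].
HB.instance Definition _ := [Choice of intpart by <:].

Definition empty_part : intpart := @IntPart [::] isT.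

Definition part (la : intpart) (i : nat) : nat := nth 0%N la i.

Definition subpart (mu la : intpart) : bool :=
  [forall i : 'I_(size mu), part mu i <= part la i]%N.

(** * Skew Schur polynomials, as sums over semistandard tableaux *)

(* Cells (row, column) of the skew diagram la/mu. *)
Definition skew_cell (la mu : intpart) : Type :=
  {c : 'I_(size la) * 'I_(part la 0)
     | (part mu c.1 <= c.2 < part la c.1)%N}.

Section SkewSchur.
Variables la mu : intpart.

Definition cell_row (c : skew_cell la mu) : nat := (val c).1.
Definition cell_col (c : skew_cell la mu) : nat := (val c).2.

Definition semistandard (N : nat) (t : {ffun skew_cell la mu -> 'I_N}) : bool :=
  [forall c, forall c',
     ((cell_row c == cell_row c') && (cell_col c < cell_col c')%N ==>
        (t c <= t c')%N) &&
     ((cell_col c == cell_col c') && (cell_row c < cell_row c')%N ==>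
        (t c < t c')%N)].

(* s_{la/mu}(x_1, ..., x_N) for xs = [:: x_1; ...; x_N]; it vanishes unless mu
   is contained in la, which the set of cells alone does not detect. *)
Definition skew_schur (K : comNzRingType) (xs : seq K) : K :=
  if subpart mu la then
    \sum_(t : {ffun skew_cell la mu -> 'I_(size xs)} | semistandard t)
      \prod_(c : skew_cell la mu) xs`_(t c)
  else 0.

End SkewSchur.

Definition schur (la : intpart) (K : comNzRingType) (xs : seq K) : K :=
  skew_schur la empty_part xs.

(** * The Schur process *)

Definition Fprod (K : fieldType) (A B : seq K) : K :=
  \prod_(x <- A) \prod_(y <- B) (1 - x * y)^-1.

(* The number of specializations is m = n.+1; the index set {1, ..., m} is
   represented by 'I_n.+1, i.e. all superscripts are shifted down by one. *)
Section SchurProcess.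
Variables (R : realType) (n : nat) (X Y : 'I_n.+1 -> {fset R}).

Definition schur_weight (la : {ffun 'I_n.+1 -> intpart})
    (mu : {ffun 'I_n -> intpart}) : R :=
  schur (la ord0) (X ord0)
  * (\prod_(i < n)
       (skew_schur (la (lift ord0 i)) (mu i) (X (lift ord0 i))
        * skew_schur (la (widen_ord (leqnSn n) i)) (mu i)
            (Y (widen_ord (leqnSn n) i))))
  * schur (la ord_max) (Y ord_max).

Definition schur_Z : R :=
  \prod_(i < n.+1) \prod_(j < n.+1 | (i <= j)%N) Fprod (X i) (Y j).

Definition schur_joint (la : {ffun 'I_n.+1 -> intpart})
    (mu : {ffun 'I_n -> intpart}) : R :=
  schur_weight la mu / schur_Z.

Definition schur_process (la : {ffun 'I_n.+1 -> intpart}) : \bar R :=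
  (\esum_(mu in [set: {ffun 'I_n -> intpart}]) (schur_joint la mu)%:E)%R.

(* The points (i, la^(i)_j - j) for all j >= 1, with la^(i)_j = 0 when j exceeds
   the length of la^(i). The index j is not cut off at the length: the
   determinantal formula fails at negative positions for the truncated set (for
   n = 0 and X, Y empty the kernel equals 1 at (-1, -1)). Both sets have the same
   points with nonnegative second coordinate. *)
Definition point_config (la : {ffun 'I_n.+1 -> intpart}) :
    set ('I_n.+1 * int) :=
  [set p | exists2 j : nat, (1 <= j)%N
         & p.2 = (part (la p.1) j.-1)%:Z - j%:Z].

Definition correlation (T : set ('I_n.+1 * int)) : \bar R :=
  (\esum_(la in [set la | T `<=` point_config la]) schur_process la)%R.

End SchurProcess.

(** * The correlation kernel *)

Section Kernel.
Variable R : realType.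

Definition circle_pt (r theta : R) : R[i] :=
  (r * cos theta) +i* (r * sin theta).

(* The integral of f along the positively oriented circle of radius r centred
   at 0, parametrized by z = r e^(i theta), dz = i z dtheta. *)
Definition circle_integral (r : R) (f : R[i] -> R[i]) : R[i] :=
  let g theta := f (circle_pt r theta) * ('i%C * circle_pt r theta) in
  (\int[lebesgue_measure]_(theta in `[0, 2 * pi]) complex.Re (g theta))
  +i* (\int[lebesgue_measure]_(theta in `[0, 2 * pi]) complex.Im (g theta)).

Variables (n : nat) (X Y : 'I_n.+1 -> {fset R}).

(* F(A; {z}) for a finite set A of real numbers and a complex number z. *)
Definition F1 (A : {fset R}) (z : R[i]) : R[i] :=
  Fprod [seq a%:C | a <- A] [:: z].

Definition kernel_integrand (s : 'I_n.+1) (i : int) (t : 'I_n.+1) (j : int)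
    (z w : R[i]) : R[i] :=
  (w - z)^-1
  * (((\prod_(k < n.+1 | (t <= k)%N) F1 (Y k) w^-1)
      * (\prod_(k < n.+1 | (k <= s)%N) F1 (X k) z))
     / ((\prod_(k < n.+1 | (s <= k)%N) F1 (Y k) z^-1)
        * (\prod_(k < n.+1 | (k <= t)%N) F1 (X k) w)))
  * w ^ j * z ^ (- i - 1).

Definition schur_kernel (r1 r2 : R) (s : 'I_n.+1) (i : int)
    (t : 'I_n.+1) (j : int) : R[i] :=
  ((4 * pi ^+ 2)^-1)%:C
  * circle_integral r1 (fun z =>
      circle_integral r2 (fun w => kernel_integrand s i t j z w)).

(* max S < rin < rout < min S^-1 for every S among the X^(k), Y^(k). Only
   nonzero elements have an inverse, so 0 imposes no upper bound (in MathComp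
   0^-1 = 0, hence the guard), and an empty S imposes no constraint. *)
Definition nested_radii (rin rout : R) : Prop :=
  [/\ 0 < rin, rin < rout &
    forall (k : 'I_n.+1) (x : R), (x \in X k) || (x \in Y k) ->
      x < rin /\ (x != 0 -> rout < x^-1)].

Definition admissible_radii (s t : 'I_n.+1) (r1 r2 : R) : Prop :=
  if (t < s)%N then nested_radii r1 r2 else nested_radii r2 r1.

End Kernel.

(* Main.v *)
Require Import Defs.
From mathcomp Require Import fingroup perm ring lra zify.

(** Read the Schur process as a word: the variables of X^(1) are letters
    [Up x], then comes an observation [Obs], then the variables of Y^(1) as
    letters [Down y], then those of X^(2), and so on. By the branching rule
    [schur_branching] a skew Schur polynomial is a sum over chains of partitions
    in which each variable adds one horizontal strip, weighted by a power of
    that variable. So the weights of the process are summed by a walk on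
    partitions driven by the word, from the empty partition to the empty
    partition ([path_sum], [chain_sum]).

    A partition with at most N parts is a set of N distinct sites on the half
    line, and a function H from sites to row vectors of length N gives it the
    determinant [minor H] of the rows at its sites. Summing over all horizontal
    strips turns the minors of H into the minors of another function: the rows
    run over disjoint windows, so multilinearity moves the sums into the
    determinant, and row operations complete the windows to half lines
    ([sum_up], [sum_down]). This plays the role of the free fermion operators,
    without the infinite wedge space; N has only to be large compared with the
    number of letters [Up] and the depth of the prescribed points. The steps
    with x and y commute up to a rank-one defect at site 0, which contributes
    the factor 1 / (1 - x y) ([minor_up_down]). A letter [Down] that has been
    moved to the left end acts on the empty partition and disappears, so these
    factors multiply to the normalization Z ([path_sum_Zword]).

    To find the correlations, let the observation multiply a configuration by
    the product of 1 + u_r over the prescribed points r that it contains. This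
    multiplies the rows of H by 1 + u_r at the prescribed sites, a perturbation
    of rank d. Suppose that a kernel K, as a function of one of its points,
    satisfies the same recurrences along the word as H, jumps by a Kronecker
    delta at the observation of its other point, and vanishes at the occupied
    sites before the word and at the empty sites after it. Then the total weight
    is Z * det (1 + u K) ([det_cols_obs]).

    The contour integrals have these properties. Multiplying the integrand by
    one more factor 1 - x z or 1 - y / z, or dividing by it, is a two-term
    linear relation between coefficients ([ker_family]), and together with the
    geometric growth of the integrals such relations have at most one solution
    with given values in the absence of variables ([family_eq0]). Without
    variables the integral is evaluated directly ([ker_base]). This gives the
    independence of the radii, the reality of the kernel, its vanishing at both
    ends and the jump, without the residue theorem ([ker_indep], [ker_real],
    [ker_start], [ker_end], [ker_jump]).

    Both sides of the resulting identity are affine in each u_r. Taking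
    differences at u_r = 1 and u_r = 0 replaces each factor 1 + u_r by an
    indicator and each row of 1 + u K by a row of K ([extract_indicators]);
    this is the determinantal formula. *)

Set Implicit Arguments.
Unset Strict Implicit.
Unset Printing Implicit Defensive.
Import Order.TTheory GRing.Theory Num.Theory numFieldNormedType.Exports.
Local Open Scope classical_set_scope.
Local Open Scope complex_scope.
Local Open Scope ring_scope.

(** * Sums over infinite index sets *)

Section Esum.
Variable R : realType.
Implicit Types (T : choiceType).
Local Open Scope ereal_scope.

Lemma esum_exchange (T1 T2 : choiceType) (I : set T1) (J : set T2)
    (a : T1 -> T2 -> \bar R) :
  (forall i j, I i -> J j -> 0 <= a i j) ->
  \esum_(i in I) \esum_(j in J) a i j = \esum_(j in J) \esum_(i in I) a i j.
Proof.
move=> a0; rewrite !esum_esum//; last by move=> i j Ji Ij; exact: a0.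
rewrite (reindex_esum (J `*`` fun=> I) _ (fun x => (x.2, x.1)))//; split => //=.
- by move=> [j i] [].
- by move=> [i j] [i' j'] _ _ [-> ->].
- by move=> [i j] [Ii Jj]; exists (j, i).
Qed.

Lemma esum_single (T : choiceType) (D : set T) (i0 : T) (a : T -> \bar R) :
  D i0 -> 0 <= a i0 -> (forall i, D i -> i <> i0 -> a i = 0) ->
  \esum_(i in D) a i = a i0.
Proof.
move=> Di0 a0 az; rewrite -(esum_set1 (t := i0) a0) [LHS]esum_mkcond [RHS]esum_mkcond.
apply: eq_esum => i _; case: (eqVneq i i0) => [->|/eqP ne]; first by rewrite !mem_set.
rewrite [in RHS]memNset; last by move=> h; apply: ne.
by case: ifPn => // /set_mem Di; rewrite az.
Qed.

Lemma esumZl (T : choiceType) (D : set T) (c : R) (a : T -> \bar R) :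
  (0 <= c)%R -> (forall i, D i -> 0 <= a i) ->
  \esum_(i in D) (c%:E * a i) = c%:E * \esum_(i in D) a i.
Proof.
have le (e : R) (b : T -> \bar R) : (0 <= e)%R -> (forall i, 0 <= b i) ->
    \esum_(i in D) (e%:E * b i) <= e%:E * \esum_(i in D) b i.
  move=> e0 b0; apply: ge_ereal_sup => _ [F FD <-].
  rewrite -ge0_mule_fsumr//.
  by apply: lee_wpmul2l; [rewrite lee_fin|apply: esum_ge; exists F].
rewrite le_eqVlt => /predU1P[<- _|c0 a0].
  by rewrite mul0e esum1// => i _; rewrite mul0e.
pose b i := if i \in D then a i else 0.
have b0 i : 0 <= b i by rewrite /b; case: ifPn => // /set_mem; exact: a0.
have -> : \esum_(i in D) a i = \esum_(i in D) b i.
  by apply: eq_esum => i Di; rewrite /b mem_set.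
have -> : \esum_(i in D) (c%:E * a i) = \esum_(i in D) (c%:E * b i).
  by apply: eq_esum => i Di; rewrite /b mem_set.
apply/eqP; rewrite eq_le; apply/andP; split; first by apply: le; rewrite ?ltW.
rewrite -lee_pdivlMl//.
have := le (c^-1)%R (fun i => c%:E * b i).
under eq_esum do rewrite muleA -EFinM mulVf ?gt_eqF// mul1e.
by apply; [rewrite invr_ge0 ltW|move=> i; rewrite mule_ge0// lee_fin ltW].
Qed.

Lemma esum_partition (I : finType) (T : choiceType) (P : pred I) (D : set T)
    (g : I -> T) (f : I -> \bar R) :
  (forall i, P i -> 0 <= f i) -> (forall i, P i -> D (g i)) ->
  \sum_(i | P i) f i = \esum_(x in D) \sum_(i | P i && (g i == x)) f i.
Proof.
move=> f0 gD.
under eq_esum do rewrite big_mkcondr/=.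
rewrite esum_sum; last by move=> x i _ Pi; case: ifP => // _; exact: f0.
apply: eq_bigr => i Pi; rewrite (@esum_single _ _ (g i)) ?eqxx//; [exact: gD|exact: f0|].
by move=> x _ /eqP; rewrite eq_sym => /negPf ->.
Qed.

Lemma esum_set_bij_fin (I : finType) (T : choiceType) (P : pred I) (D : set T)
    (g : I -> T) (f : T -> \bar R) :
  (forall x, D x -> 0 <= f x) -> set_bij [set i | P i] D g ->
  \esum_(x in D) f x = \sum_(i | P i) f (g i).
Proof.
move=> f0 bg; have gD i : P i -> D (g i) by case: bg => gD _ _ /(gD i).
rewrite (esum_partition (P := P) (D := D) (g := g)) //; last by move=> i /gD; exact: f0.
apply: eq_esum => x Dx; case: bg => _ gI /(_ x Dx) [i Pi gi].
rewrite (big_pred1 i) ?gi// => j; apply/andP/eqP => [[Pj /eqP gj]|->].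
  by apply: gI; [exact: mem_set|exact: mem_set|rewrite gj gi].
by rewrite gi eqxx.
Qed.

End Esum.

(** * Partitions and horizontal strips *)

Section Partitions.
Implicit Types la mu nu : intpart.

Lemma part_noninc la i j : (i <= j)%N -> (part la j <= part la i)%N.
Proof.
move=> ij; rewrite /part; have [jl|lj] := ltnP j (size la); last by rewrite nth_default.
case/andP: (partsP la) => so _.
have tr : transitive geq by move=> a b c ab bc; exact: leq_trans bc ab.
by have := sorted_leq_nth tr (fun x => leqnn x) 0%N so; apply; rewrite ?inE//; exact: leq_ltn_trans jl.
Qed.

Lemma part_default la i : (size la <= i)%N -> part la i = 0%N.
Proof. exact: nth_default. Qed.

Lemma part_gt0 la i : (0 < part la i)%N = (i < size la)%N.
Proof.
have [il|li] := ltnP i (size la); last by rewrite part_default.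
by case/andP: (partsP la) => _ /all_nthP; apply.
Qed.

Lemma intpart_ext la mu : (forall i, part la i = part mu i) -> la = mu.
Proof.
move=> h; apply: val_inj => /=.
have sz : size la = size mu.
  have szP (nu ka : intpart) : (forall i, part nu i = part ka i) -> (size nu <= size ka)%N.
    by move=> e; rewrite leqNgt -part_gt0 e part_default.
  by apply/eqP; rewrite eqn_leq !szP.
by apply: (eq_from_nth (x0 := 0%N)) => // i _; exact: h.
Qed.

Lemma size_part_leq la N : part la N = 0%N -> (size la <= N)%N.
Proof. by move=> h; rewrite leqNgt -part_gt0 h. Qed.

(** Row lengths as a function of the row index; zeros are dropped, so [f] may
    vanish before [N]. *)
Definition mkpart (N : nat) (f : nat -> nat) : intpart :=
  insubd empty_part [seq p <- mkseq f N | (0 < p)%N].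

(** In a nonincreasing sequence the zeros come last, so dropping them does not
    shift the other entries. *)
Lemma nth_filter_pos (s : seq nat) i :
  sorted geq s -> nth 0%N [seq p <- s | (0 < p)%N] i = nth 0%N s i.
Proof.
elim: s i => [|x s IH] i //= xs; case: ifPn => [_|].
  by case: i => //= i; rewrite IH// (path_sorted xs).
rewrite -eqn0Ngt => /eqP x0.
have s0 : all (pred1 0%N) s.
  have tr : transitive geq by move=> a b c ab bc; exact: leq_trans bc ab.
  have := order_path_min tr xs; apply: sub_all => y /=.
  by rewrite x0 leqn0.
have -> : [seq p <- s | (0 < p)%N] = [::].
  by apply/eqP; rewrite -size_eq0 size_filter -leqn0 leqNgt -has_count; apply/hasPn => y /(allP s0)/eqP ->.
rewrite nth_nil; case: i => [|i]; rewrite /= ?x0//.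
have [il|li] := ltnP i (size s); last by rewrite nth_default.
by have /eqP -> := allP s0 _ (mem_nth 0%N il).
Qed.

Lemma part_mkpart N (f : nat -> nat) i :
  (forall j, (j.+1 < N)%N -> (f j.+1 <= f j)%N) ->
  part (mkpart N f) i = if (i < N)%N then f i else 0%N.
Proof.
move=> fd.
have so : sorted geq (mkseq f N).
  apply/(sortedP 0%N) => j; rewrite size_mkseq => jN /=.
  by rewrite !nth_mkseq ?fd// ltnW.
have P : is_partition [seq p <- mkseq f N | (0 < p)%N].
  rewrite /is_partition filter_all andbT sorted_filter// => a b c ab bc.
  exact: leq_trans bc ab.
rewrite /part /mkpart val_insubd P nth_filter_pos//.
have [iN|Ni] := ltnP i N; first by rewrite nth_mkseq.
by rewrite nth_default// size_mkseq.
Qed.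

Lemma size_mkpart N (f : nat -> nat) : (size (mkpart N f) <= N)%N.
Proof.
rewrite /mkpart /insubd; case: insubP => //= u _ ->.
by rewrite size_filter (leq_trans (count_size _ _))// size_mkseq.
Qed.

(** [la/mu] is a horizontal strip: the rows interlace. *)
Definition hstrip mu la : Prop :=
  forall i, (part mu i <= part la i)%N /\ (part la i.+1 <= part mu i)%N.

Lemma hstrip_size mu la : hstrip mu la ->
  (size mu <= size la)%N /\ (size la <= (size mu).+1)%N.
Proof.
move=> h; split; apply: size_part_leq; apply/eqP; rewrite -leqn0.
  by rewrite (leq_trans (proj1 (h _)))// part_default.
by rewrite (leq_trans (proj2 (h _)))// part_default.
Qed.

Lemma hstripNil la : hstrip la empty_part -> la = empty_part.
Proof.
move=> /hstrip_size[+ _] /=; rewrite leqn0 size_eq0 => /eqP h.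
exact: val_inj.
Qed.

Lemma hstrip00 : hstrip empty_part empty_part.
Proof. by move=> i; rewrite /part !nth_nil. Qed.

Lemma subpartP mu la : reflect (forall i, (part mu i <= part la i)%N) (subpart mu la).
Proof.
apply: (iffP forallP) => h i; last exact: h.
have [im|mi] := ltnP i (size mu); first exact: (h (Ordinal im)).
by rewrite part_default.
Qed.

Lemma sumn_part la N : (size la <= N)%N -> sumn la = (\sum_(i < N) part la i)%N.
Proof.
move=> sN; rewrite sumnE (big_nth 0%N) big_mkord.
rewrite (big_ord_widen N (fun i => part la i) sN) [RHS](bigID (fun i : 'I_N => (i < size la)%N))/=.
rewrite [X in (_ + X)%N]big1 ?addn0// => i; rewrite -leqNgt => h; exact: part_default.
Qed.

End Partitions.

(** * The branching rule of skew Schur polynomials *)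

Section Branching.
Variables (la : intpart).
Implicit Types (mu nu : intpart).

Lemma cell_bounds mu (c : skew_cell la mu) :
  (part mu (cell_row c) <= cell_col c)%N /\ (cell_col c < part la (cell_row c))%N.
Proof. by have /andP := valP c. Qed.

Lemma cell_at mu r k : (part mu r <= k)%N -> (k < part la r)%N ->
  exists c : skew_cell la mu, cell_row c = r /\ cell_col c = k.
Proof.
move=> mk kl.
have rl : (r < size la)%N by rewrite -part_gt0 (leq_ltn_trans _ kl).
have k0 : (k < part la 0)%N by rewrite (leq_trans kl)// part_noninc.
pose p : 'I_(size la) * 'I_(part la 0) := (Ordinal rl, Ordinal k0).
have h : (part mu p.1 <= p.2 < part la p.1)%N by rewrite mk kl.
by exists (exist _ p h).
Qed.

Lemma cell_inj mu (c c' : skew_cell la mu) :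
  cell_row c = cell_row c' -> cell_col c = cell_col c' -> c = c'.
Proof.
move=> hr hc; apply: val_inj; rewrite [LHS]surjective_pairing [RHS]surjective_pairing.
by congr pair; apply: val_inj.
Qed.

Lemma big_cells (R : comNzRingType) mu (F : 'I_(size la) * 'I_(part la 0) -> R) :
  \prod_(c : skew_cell la mu) F (val c) =
  \prod_(p : 'I_(size la) * 'I_(part la 0) | (part mu p.1 <= p.2 < part la p.1)%N) F p.
Proof.
by rewrite (big_sub [pred p : 'I_(size la) * 'I_(part la 0) | (part mu p.1 <= p.2 < part la p.1)%N]).
Qed.

Definition cell_cast mu nu (c : skew_cell la mu) : option (skew_cell la nu) :=
  insub (val c).

Lemma cell_castP mu nu (c : skew_cell la mu) :
  match cell_cast nu c with
  | Some c' => [/\ (part nu (cell_row c) <= cell_col c)%N,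
                  cell_row c' = cell_row c & cell_col c' = cell_col c]
  | None => (cell_col c < part nu (cell_row c))%N
  end.
Proof.
rewrite /cell_cast; case: insubP => [c' h e|].
  by rewrite /cell_row /cell_col e; case/andP: h => h _; split.
by rewrite negb_and -ltnNge -leqNgt => /orP[//|]; rewrite leqNgt (proj2 (cell_bounds c)).
Qed.

Section OneStep.
Variables (mu : intpart) (n : nat).

(** The cells with entry 0 of a tableau of shape [la/mu] form a horizontal strip
    [nu/mu], and the others a tableau of shape [la/nu] with entries raised by
    one. This is the inverse map; [zero_shape] recovers [nu]. *)
Definition glue nu (t : {ffun skew_cell la nu -> 'I_n}) :
    {ffun skew_cell la mu -> 'I_n.+1} :=
  [ffun c => if cell_cast nu c is Some c' then lift ord0 (t c') else ord0].

Definition in_zero (t : {ffun skew_cell la mu -> 'I_n.+1}) (r k : nat) : bool :=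
  (k < part mu r)%N ||
  [exists c, [&& cell_row c == r, cell_col c == k & t c == ord0]].

Definition zero_shape (t : {ffun skew_cell la mu -> 'I_n.+1}) : intpart :=
  mkpart (size la) (fun r => \max_(k < part la 0 | in_zero t r k) k.+1)%N.

Hypothesis mula : subpart mu la.

(** Rows weakly increase, so the zeros of a row are at its left end. *)
Lemma in_zero_down t r k k' : semistandard t -> (k' <= k)%N ->
  in_zero t r k -> in_zero t r k'.
Proof.
move=> /forallP ss kk /orP[kr|/existsP[c /and3P[/eqP cr /eqP ck /eqP t0]]].
  by rewrite /in_zero (leq_ltn_trans kk).
rewrite /in_zero; case: ltnP => //= muk.
have [_ cl] := cell_bounds c; rewrite cr ck in cl.
have [c' [cr' ck']] := cell_at muk (leq_ltn_trans kk cl).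
apply/existsP; exists c'; rewrite cr' ck' !eqxx/=.
move: kk; rewrite leq_eqVlt => /predU1P[kk|kk].
  by rewrite (@cell_inj mu c' c) ?t0 ?cr' ?ck' ?cr ?ck ?kk.
have /forallP/(_ c)/andP[/implyP + _] := ss c'.
by rewrite cr cr' ck ck' eqxx kk t0 leqn0 => /(_ isT).
Qed.

(** Columns strictly increase, so nothing but [mu] lies above a zero. This is
    the second half of the strip condition. *)
Lemma in_zero_col t r k : semistandard t -> in_zero t r.+1 k -> (k < part mu r)%N.
Proof.
move=> /forallP ss /orP[h|/existsP[c /and3P[/eqP cr /eqP ck /eqP t0]]].
  by rewrite (leq_trans h)// part_noninc.
rewrite ltnNge; apply/negP => muk.
have [_ cl] := cell_bounds c; rewrite cr ck in cl.
have [c' [cr' ck']] := cell_at muk (leq_trans cl (part_noninc la (leqnSn r))).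
have /forallP/(_ c)/andP[_ /implyP] := ss c'.
by rewrite cr cr' ck ck' eqxx ltnSn t0 ltn0 => /(_ isT).
Qed.

Lemma zero_max t r k : semistandard t -> (k < part la 0)%N ->
  (k < \max_(k < part la 0 | in_zero t r k) k.+1)%N = in_zero t r k.
Proof.
move=> ss kl; apply/idP/idP => [|h]; last first.
  exact: (bigop.bigmax_sup (Ordinal kl)).
apply: contraTT => h; rewrite -leqNgt; apply/bigmax_leqP => i hi.
by rewrite ltnNge; apply: contra h => /in_zero_down/(_ hi); apply.
Qed.

Lemma zero_max_le t r : semistandard t ->
  (\max_(k < part la 0 | in_zero t r.+1 k) k.+1 <= part mu r)%N.
Proof. by move=> ss; apply/bigmax_leqP => k /in_zero_col; apply. Qed.

Lemma zero_max_ge t r : semistandard t -> (r < size la)%N ->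
  (part mu r <= \max_(k < part la 0 | in_zero t r k) k.+1)%N.
Proof.
move=> ss rl; case E : (part mu r) => [|k] //.
rewrite zero_max ?/in_zero ?E ?ltnSn//.
by rewrite -E (leq_trans (subpartP _ _ mula _))// part_noninc.
Qed.

Lemma part_zero_shape t r : semistandard t -> part (zero_shape t) r =
  if (r < size la)%N then (\max_(k < part la 0 | in_zero t r k) k.+1)%N else 0%N.
Proof.
move=> ss; apply: part_mkpart => j jl.
by rewrite (leq_trans (zero_max_le _ ss))// zero_max_ge// ltnW.
Qed.

Lemma hstrip_zero_shape t : semistandard t -> hstrip mu (zero_shape t).
Proof.
move=> ss r; rewrite !part_zero_shape//; split; last by case: ifP => // _; exact: zero_max_le.
case: ltnP => [|lr]; first exact: zero_max_ge.
by rewrite (leq_trans (subpartP _ _ mula _))// part_default.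
Qed.

Lemma zero_shape_sub t : semistandard t -> subpart (zero_shape t) la.
Proof.
move=> ss; apply/subpartP => r; rewrite part_zero_shape//; case: ltnP => // rl.
apply/bigmax_leqP => k /orP[h|/existsP[c /and3P[/eqP <- /eqP <- _]]].
  by rewrite (leq_trans h)//; exact: subpartP.
exact: (proj2 (cell_bounds c)).
Qed.

Lemma zero_shapeE t (c : skew_cell la mu) : semistandard t ->
  (cell_col c < part (zero_shape t) (cell_row c))%N = (t c == ord0).
Proof.
move=> ss; rewrite part_zero_shape// ltn_ord zero_max//; last exact: ltn_ord.
rewrite /in_zero ltnNge (proj1 (cell_bounds c))/=; apply/existsP/idP => [[c']|h].
  by move=> /and3P[/eqP cr /eqP ck]; rewrite (@cell_inj mu c' c).
by exists c; rewrite !eqxx.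
Qed.

Lemma glue_semistandard nu (t : {ffun skew_cell la nu -> 'I_n}) :
  hstrip mu nu -> semistandard t -> semistandard (glue t).
Proof.
move=> hs /forallP ss; apply/forallP => c; apply/forallP => c'; rewrite !ffunE.
have := cell_castP nu c; have := cell_castP nu c'.
case: (cell_cast nu c) => [d|]; case: (cell_cast nu c') => [d'|] /=.
- move=> [_ r' k'] [_ r k]; have /forallP/(_ d') := ss d.
  by rewrite r r' k k' /bump !add1n !ltnS.
- move=> lt [ge _ _]; rewrite leqn0 ltn0; apply/andP; split; apply/implyP => /andP[/eqP rr cc].
    by rewrite -rr ltnNge (leq_trans ge (ltnW cc)) in lt.
  have [hc _] := cell_bounds c.
  move: lt; rewrite -rr ltnNge => /negP[]; apply: leq_trans hc.
  rewrite (leq_trans _ (proj2 (hs _)))//; exact: part_noninc.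
- by move=> [_ _ _] lt; rewrite /bump !implybT.
- move=> lt' lt; rewrite leqnn ltnn implybT/=; apply/implyP => /andP[/eqP rr cc].
  have [hc _] := cell_bounds c.
  move: lt'; rewrite -rr ltnNge => /negP[]; apply: leq_trans hc.
  rewrite (leq_trans _ (proj2 (hs _)))//; exact: part_noninc.
Qed.

Lemma glue_eq0 nu (t : {ffun skew_cell la nu -> 'I_n}) c :
  (glue t c == ord0) = (cell_col c < part nu (cell_row c))%N.
Proof.
rewrite ffunE; have := cell_castP nu c; case: (cell_cast nu c) => [d|] /=.
  by move=> [h _ _]; rewrite ltnNge h.
by move=> ->; rewrite eqxx.
Qed.

Lemma zero_shape_glue nu (t : {ffun skew_cell la nu -> 'I_n}) :
  hstrip mu nu -> subpart nu la -> semistandard t -> zero_shape (glue t) = nu.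
Proof.
move=> hs nula ss; have sg := glue_semistandard hs ss.
apply: intpart_ext => r; rewrite part_zero_shape//; case: ltnP => [rl|lr]; last first.
  by apply/esym/eqP; rewrite -leqn0 (leq_trans (subpartP _ _ nula _))// part_default.
have iz k : (k < part la r)%N -> in_zero (glue t) r k = (k < part nu r)%N.
  move=> kl; rewrite /in_zero; case: ltnP => /= [h|muk].
    by rewrite (leq_trans h)//; case: (hs r).
  have [c [cr ck]] := cell_at muk kl.
  rewrite -cr -ck -(glue_eq0 t); apply/existsP/idP => [[c']|h]; last by exists c; rewrite !eqxx.
  by move=> /and3P[/eqP e1 /eqP e2]; rewrite (@cell_inj mu c' c).
apply/eqP; rewrite eqn_leq; apply/andP; split.
  apply/bigmax_leqP => k; case: (ltnP k (part la r)) => [kl|lk]; first by rewrite iz.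
  move=> /orP[h|/existsP[c /and3P[/eqP cr /eqP ck _]]].
    by rewrite (leq_trans h)//; case: (hs r).
  by have := proj2 (cell_bounds c); rewrite cr ck ltnNge lk.
case E : (part nu r) => [|k] //.
have kl : (k < part la r)%N by rewrite -E; exact: subpartP.
have k0 : (k < part la 0)%N by rewrite (leq_trans kl)// part_noninc.
by apply: (bigop.bigmax_sup (Ordinal k0)); rewrite //= iz// E.
Qed.

Lemma glue_inj nu : subpart mu nu ->
  injective (@glue nu).
Proof.
move=> munu t t' /ffunP h; apply/ffunP => c.
have [c1 c2] := cell_bounds c.
have [d [dr dc]] := cell_at (leq_trans (subpartP _ _ munu _) c1) c2.
have := h d; rewrite !ffunE; have := cell_castP nu d.
case: (cell_cast nu d) => [c'|]; last by rewrite dr dc ltnNge c1.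
move=> [_ er ec]; have -> : c' = c by apply: (@cell_inj nu); rewrite ?er ?ec.
exact: lift_inj.
Qed.

Lemma glue_surj nu t : semistandard t -> zero_shape t = nu ->
  exists2 t' : {ffun skew_cell la nu -> 'I_n}, semistandard t' & glue t' = t.
Proof.
move=> ss znu; have hs : hstrip mu nu by rewrite -znu; exact: hstrip_zero_shape.
have ex (c : skew_cell la nu) : exists v : 'I_n,
    forall d : skew_cell la mu, cell_row d = cell_row c -> cell_col d = cell_col c ->
      t d = lift ord0 v.
  have [c1 c2] := cell_bounds c.
  have [d [dr dc]] := cell_at (leq_trans (proj1 (hs _)) c1) c2.
  have : t d != ord0 by rewrite -zero_shapeE// znu dr dc ltnNge c1.
  rewrite eq_sym => /unlift_some[v tv _]; exists v => d' er ec; rewrite -tv; congr (t _).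
  by apply: (@cell_inj mu); rewrite ?dr ?dc.
have [f fP] := fin_all_exists ex.
have gt : glue [ffun c => f c] = t.
  apply/ffunP => c; rewrite !ffunE; have := cell_castP nu c.
  case: (cell_cast nu c) => [c'|]; first by move=> [_ er ec]; rewrite ffunE -(fP c' c).
  by rewrite -znu zero_shapeE// => /eqP.
exists [ffun c => f c] => //.
apply/forallP => c; apply/forallP => c'.
have [c1 c2] := cell_bounds c; have [c1' c2'] := cell_bounds c'.
have [d [dr dc]] := cell_at (leq_trans (proj1 (hs _)) c1) c2.
have [d' [dr' dc']] := cell_at (leq_trans (proj1 (hs _)) c1') c2'.
move/forallP: ss => /(_ d)/forallP/(_ d').
by rewrite dr dc dr' dc' !ffunE (fP c d)// (fP c' d').
Qed.

End OneStep.

Lemma skew_schur_cons (R : comNzRingType) mu nu (x : R) (xs : seq R) :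
  hstrip mu nu -> subpart nu la ->
  \sum_(t : {ffun skew_cell la mu -> 'I_(size (x :: xs))} |
        semistandard t && (zero_shape t == nu))
     \prod_(c : skew_cell la mu) (x :: xs)`_(t c)
  = x ^+ (sumn nu - sumn mu) * skew_schur la nu xs.
Proof.
move=> hs nula; rewrite /skew_schur nula mulr_sumr.
have munu : subpart mu nu by apply/subpartP => i; case: (hs i).
have mula : subpart mu la.
  by apply/subpartP => i; rewrite (leq_trans (subpartP _ _ munu _))//; exact: subpartP.
have inj := @glue_inj mu (size xs) _ munu.
transitivity (\sum_(t in @glue mu (size xs) nu @: [pred t | semistandard t])
    \prod_(c : skew_cell la mu) (x :: xs)`_(t c)).
  apply: eq_bigl => t; apply/andP/imsetP => [[ss /eqP zs]|[t' + ->]].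
    by have [t' ss' <-] := glue_surj mula ss zs; exists t'; rewrite ?inE.
  rewrite inE => ss'; split; first exact: glue_semistandard.
  by apply/eqP; exact: zero_shape_glue.
rewrite big_imset /=; last by move=> t t' _ _; exact: inj.
apply: eq_big => [t|t _]; first by rewrite inE.
pose F (p : 'I_(size la) * 'I_(part la 0)) :=
  if (insub p : option (skew_cell la nu)) is Some c then xs`_(t c) else x.
transitivity (\prod_(c : skew_cell la mu) F (val c)).
  apply: eq_bigr => c _; rewrite ffunE /F /cell_cast; case: insub => //= d.
rewrite big_cells (bigID (fun p : 'I_(size la) * 'I_(part la 0) => (p.2 < part nu p.1)%N))/=.
congr (_ * _).
  transitivity (\prod_(p : 'I_(size la) * 'I_(part la 0) |
      (part mu p.1 <= p.2 < part nu p.1)%N) x).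
    apply: eq_big => p.
      apply/andP/andP => [[/andP[-> _] ->]|[h1 h2]] //; split=> //.
      by rewrite h1 (leq_trans h2)//; exact: subpartP.
    move=> /andP[_ h]; rewrite /F insubF//; apply/negbTE.
    by rewrite negb_and -ltnNge h.
  rewrite -(pair_big_dep predT (fun (i : 'I_(size la)) (j : 'I_(part la 0)) => (part mu i <= j < part nu i)%N) (fun _ _ => x))/=.
  rewrite (sumn_part (N := size la) (la := nu)); last first.
    by apply: size_part_leq; apply/eqP; rewrite -leqn0 (leq_trans (subpartP _ _ nula _))// part_default.
  rewrite (sumn_part (N := size la) (la := mu)); last first.
    by apply: size_part_leq; apply/eqP; rewrite -leqn0 (leq_trans (subpartP _ _ mula _))// part_default.
  rewrite -sumnB; last by move=> i _; case: (hs i).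
  rewrite -prodrXr; apply: eq_bigr => i _.
  rewrite -(big_mkord (fun j => part mu i <= j < part nu i)%N (fun=> x)).
  rewrite -prodr_const_nat [RHS](big_nat_widenl _ 0)// [RHS](big_nat_widen _ _ (part la 0)).
    by apply: eq_bigl => j.
  by rewrite (leq_trans (subpartP _ _ nula _))// part_noninc.
transitivity (\prod_(p : 'I_(size la) * 'I_(part la 0) |
      (part nu p.1 <= p.2 < part la p.1)%N) F p).
  apply: eq_bigl => p; rewrite -leqNgt andbC.
  by case: (leqP (part nu p.1)) => //= h; rewrite (leq_trans (proj1 (hs p.1)) h).
by rewrite -big_cells; apply: eq_bigr => c _; rewrite /F valK.
Qed.

(** Tableaux are sorted by the shape filled by [mu] and the entries 0. *)
Lemma schur_branching (R : realType) mu (x : R) (xs : seq R) :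
  0 <= x -> (forall y, y \in xs -> 0 <= y) ->
  (skew_schur la mu (x :: xs))%:E =
  (\esum_(nu in [set nu | hstrip mu nu])
     (x ^+ (sumn nu - sumn mu) * skew_schur la nu xs)%:E)%E.
Proof.
move=> x0 xs0; case mula : (subpart mu la); last first.
  rewrite {1}/skew_schur mula esum1// => nu hs; rewrite /skew_schur ifF ?mulr0//.
  apply: contraFF mula => nula; apply/subpartP => i.
  by rewrite (leq_trans (proj1 (hs i)))//; exact: subpartP.
rewrite {1}/skew_schur mula -sumEFin.
rewrite (@esum_partition _ _ _ _ [set nu | hstrip mu nu] (@zero_shape mu (size xs))).
- apply: eq_esum => nu hs; rewrite sumEFin; congr EFin.
  case nula : (subpart nu la); first exact: skew_schur_cons.
  rewrite {1}/skew_schur nula mulr0 big_pred0// => t; apply/negbTE/andP => -[ss /eqP zs].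
  by have := zero_shape_sub mula ss; rewrite zs nula.
- move=> t _; rewrite lee_fin; apply: prodr_ge0 => c _.
  case: (t c) => -[|k] kl //=; apply: xs0; exact: mem_nth.
- by move=> t ss; exact: hstrip_zero_shape.
Qed.

Lemma skew_schur_nil (K : comNzRingType) mu : skew_schur la mu ([::] : seq K) = (la == mu)%:R.
Proof.
rewrite /skew_schur; case: eqVneq => [<-|ne].
  have -> : subpart la la by apply/subpartP.
  have no (c : skew_cell la la) : False.
    by have [h1 h2] := cell_bounds c; rewrite leqNgt h2 in h1.
  rewrite (big_pred1 [ffun c => False_rect _ (no c)]) => [|t]/=.
    by rewrite big1// => c; case: (no c).
  by apply/forallP/eqP => [_|_ c]; [apply/ffunP => c|]; case: (no c).
case: ifP => // mula; rewrite big_pred0// => t; exfalso.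
have [i hi] : exists i, (part mu i < part la i)%N.
  apply/not_existsP => h; move/eqP: ne; apply; apply: intpart_ext => i.
  by apply/eqP; rewrite eqn_leq (subpartP _ _ mula) andbT leqNgt; apply/negP/h.
have [c _] := cell_at (leqnn _) hi; by case: (t c).
Qed.

Lemma skew_schur_ge0 (R : realType) mu (xs : seq R) :
  (forall y, y \in xs -> 0 <= y) -> 0 <= skew_schur la mu xs.
Proof.
move=> xs0; rewrite /skew_schur; case: ifP => // _; apply: sumr_ge0 => t _.
by apply: prodr_ge0 => c _; apply: xs0; apply: mem_nth.
Qed.

End Branching.

(** * Minors indexed by partitions *)

Section Minors.
Variable (R : realType).
Variable N : nat.
Implicit Types (H : nat -> 'rV[R]_N) (la mu nu : intpart).

Lemma det_rowsum (J : finType) (Q : 'I_N -> pred J) (V : 'I_N -> J -> 'rV[R]_N) :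
  \det (\matrix_(i < N) \sum_(k | Q i k) V i k) =
  \sum_(f in family Q) \det (\matrix_(i < N) V i (f i)).
Proof.
rewrite /determinant exchange_big/=; apply: eq_bigr => s _; rewrite -mulr_sumr; congr (_ * _).
transitivity (\prod_i \sum_(k | Q i k) V i k 0 (s i)).
  by apply: eq_bigr => i _; rewrite mxE summxE.
rewrite bigA_distr_big_dep; apply: eq_bigr => f _; apply: eq_bigr => i _.
by rewrite mxE.
Qed.

Lemma det_rowscale (c : 'I_N -> R) (V : 'I_N -> 'rV[R]_N) :
  \det (\matrix_(i < N) (c i *: V i)) = (\prod_i c i) * \det (\matrix_(i < N) V i).
Proof.
rewrite /determinant mulr_sumr; apply: eq_bigr => s _; rewrite mulrCA; congr (_ * _).
by rewrite -big_split/=; apply: eq_bigr => i _; rewrite !mxE.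
Qed.

(** The partition [la] with at most [N] parts is the configuration of the [N]
    sites [la_i + N - i] (with [i] from 1 to [N]); site [k] stands for the
    integer [k - N]. *)
Definition site la (i : nat) : nat := (part la i + (N - i.+1))%N.

Definition minor H la : R := \det (\matrix_(i < N) H (site la i)).

(** The default value 0 is never read: only the first [N] rows are kept. *)
Definition box_part (M : nat) (f : {ffun 'I_N -> 'I_M}) : intpart :=
  mkpart N (fun i => if insub i is Some i' then val (f i') else 0%N).

Definition box (lo hi : nat -> nat) : set intpart :=
  [set nu : intpart | (size nu <= N)%N /\ forall i, (i < N)%N -> (lo i <= part nu i <= hi i)%N].

(** The intervals do not overlap, so the parts range over them independently,
    and the sum goes inside the determinant by multilinearity in the rows. *)
Lemma sum_minor_box H (lo hi : nat -> nat) (g : nat -> nat -> R) :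
  (forall i, (i.+1 < N)%N -> (hi i.+1 <= lo i)%N) ->
  (forall nu, box lo hi nu ->
     0 <= (\prod_(i < N) g i (part nu i)) * minor H nu) ->
  (\esum_(nu in box lo hi) ((\prod_(i < N) g i (part nu i)) * minor H nu)%:E)%E =
  (\det (\matrix_(i < N) \sum_(lo i <= k < (hi i).+1) g i k *: H (k + (N - i.+1))%N))%:E.
Proof.
move=> hilo pos.
pose M := (\max_(i < N) hi i).+1.
pose Q (i : 'I_N) (k : 'I_M) := (lo i <= k <= hi i)%N.
have dec (f : {ffun 'I_N -> 'I_M}) : f \in family Q -> forall j, (j.+1 < N)%N ->
    ((if insub j.+1 is Some i' then val (f i') else 0%N) <=
     (if insub j is Some i' then val (f i') else 0%N))%N.
  move=> /familyP fQ j jN; rewrite (insubT (fun k => k < N)%N jN) (insubT (fun k => k < N)%N (ltnW jN)).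
  have := fQ (Ordinal jN); have := fQ (Ordinal (ltnW jN)).
  rewrite /Q !unfold_in /= => /andP[h1 _] /andP[_ h2].
  by rewrite (leq_trans h2)// (leq_trans (hilo _ jN)).
have partf (f : {ffun 'I_N -> 'I_M}) (i : 'I_N) : f \in family Q -> part (box_part f) i = f i.
  by move=> fQ; rewrite /box_part part_mkpart ?ltn_ord ?valK//; exact: dec.
rewrite (@esum_set_bij_fin _ _ _ (mem (family Q)) _ (@box_part M))//; last first.
  split.
  - move=> f /= fQ; split; first exact: size_mkpart.
    move=> i iN; rewrite (partf f (Ordinal iN))//; move/familyP: fQ => /(_ (Ordinal iN)).
    by rewrite /Q unfold_in.
  - move=> f f' /set_mem/= fQ /set_mem/= fQ' e; apply/ffunP => i; apply: val_inj => /=.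
    by rewrite -!partf// e.
  - move=> nu [sz bd].
    have lt (i : 'I_N) : (part nu i < M)%N.
      rewrite ltnS; have /andP[_ h] := bd i (ltn_ord i).
      by rewrite (leq_trans h)// (bigop.bigmax_sup i).
    have fQ : [ffun i => Ordinal (lt i)] \in family Q.
      by apply/familyP => i; rewrite ffunE /Q unfold_in; exact: bd.
    exists [ffun i => Ordinal (lt i)] => //; apply: intpart_ext => i.
    have [iN|Ni] := ltnP i N; first by rewrite (partf _ (Ordinal iN))// ffunE.
    rewrite /box_part part_mkpart; last exact: dec.
    by rewrite ltnNge Ni/= part_default// (leq_trans sz).
rewrite sumEFin; congr EFin.
transitivity (\det (\matrix_(i < N) \sum_(k : 'I_M | Q i k) g i k *: H (k + (N - i.+1))%N)).
  rewrite (det_rowsum Q (fun i k => g i k *: H (k + (N - i.+1))%N)).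
  apply: eq_bigr => f fQ; rewrite det_rowscale; congr (_ * _).
    by apply: eq_bigr => i _; rewrite partf.
  rewrite /minor; congr (\det _); apply/matrixP => i j.
  by rewrite !mxE /site partf.
congr (\det _); apply/row_matrixP => i; rewrite !rowK.
rewrite (big_nat_widenl _ 0)// (big_nat_widen _ _ M)// ?big_mkord.
  by apply: eq_bigl => k; rewrite /Q ltnS.
by rewrite ltnS (bigop.bigmax_sup i).
Qed.

End Minors.

(** * Raising and lowering operators *)

Section Operators.
Variable (R : realType).
Variable N : nat.
Implicit Types (G H : nat -> 'rV[R]_N) (x y : R).

Definition down y H (k : nat) : 'rV[R]_N := \sum_(l < k.+1) y ^+ (k - l) *: H l.

(** Inverse of [H |-> (fun k => H k - x *: H k.+1)] on slowly growing [H]. *)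
Definition up x H (k : nat) : 'rV[R]_N :=
  \row_c limn (fun L => \sum_(0 <= l < L) x ^+ l * H (k + l)%N 0 c).

(** The growth condition under which the recurrence of [up x] has at most one
    solution. *)
Definition tame x H := forall k c, (fun L => x ^+ L * H (k + L)%N 0 c) @ \oo --> 0.

Definition bounded H := exists C : R, forall k c, `|H k 0 c| <= C.

Lemma downS y H k : down y H k.+1 = H k.+1 + y *: down y H k.
Proof.
rewrite /down big_ord_recr/= subnn expr0 scale1r addrC; congr (_ + _).
rewrite scaler_sumr; apply: eq_bigr => l _.
by rewrite scalerA -exprS subSn// -ltnS.
Qed.

Lemma down0 y H : down y H 0 = H 0%N.
Proof. by rewrite /down big_ord1 subnn expr0 scale1r. Qed.

Lemma down_uniq y G H : G 0%N = H 0%N -> (forall k, G k.+1 = H k.+1 + y *: G k) ->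
  down y H =1 G.
Proof.
by move=> G0 GS; elim=> [|k IH]; rewrite ?down0// downS IH GS.
Qed.

Lemma up_telescope x G H k c L : (forall k, G k = H k + x *: G k.+1) ->
  \sum_(0 <= l < L) x ^+ l * H (k + l)%N 0 c = G k 0 c - x ^+ L * G (k + L)%N 0 c.
Proof.
move=> GH; elim: L => [|L IH]; first by rewrite big_nil expr0 mul1r addn0 subrr.
rewrite big_nat_recr//= IH exprS addnS.
have /rowP/(_ c) := GH (k + L)%N; rewrite !mxE => ->; ring.
Qed.

Lemma up_cvg x G H k c : tame x G -> (forall k, G k = H k + x *: G k.+1) ->
  (fun L => \sum_(0 <= l < L) x ^+ l * H (k + l)%N 0 c) @ \oo --> G k 0 c.
Proof.
move=> tG GH; under eq_fun do rewrite (up_telescope _ _ _ GH).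
have : (fun L => G k 0 c - x ^+ L * G (k + L)%N 0 c) @ \oo --> G k 0 c - 0.
  by apply: cvgB; [exact: cvg_cst|exact: tG].
by rewrite subr0.
Qed.

Lemma up_uniq x G H : tame x G -> (forall k, G k = H k + x *: G k.+1) ->
  up x H =1 G.
Proof.
move=> tG GH k; apply/rowP => c; rewrite mxE.
by apply/cvg_lim => //; exact: up_cvg.
Qed.

Lemma bounded_tame x H : 0 <= x < 1 -> bounded H -> tame x H.
Proof.
move=> /andP[x0 x1] [C hC] k c; apply: norm_cvg0.
have C0 : 0 <= C by apply: le_trans (hC 0%N c).
apply: (@squeeze_cvgr _ _ _ _ (cst 0) (geometric C x)).
- near=> L; rewrite normr_ge0/= normrM normrX (ger0_norm x0) mulrC ler_wpM2r ?exprn_ge0//.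
- exact: cvg_cst.
- by apply: cvg_geometric; rewrite ger0_norm.
Unshelve. all: by end_near. Qed.

Lemma up_is_cvg x H k c : 0 <= x < 1 -> bounded H ->
  cvgn (fun L => \sum_(0 <= l < L) x ^+ l * H (k + l)%N 0 c).
Proof.
move=> /andP[x0 x1] [C hC]; have C0 : 0 <= C by apply: le_trans (hC 0%N c).
apply: (@normed_cvg _ R^o); apply: (@series_le_cvg _ _ (geometric C x)).
- by move=> l; exact: normr_ge0.
- by move=> l; rewrite /geometric/= mulr_ge0// exprn_ge0.
- by move=> l; rewrite /geometric/= normrM normrX (ger0_norm x0) mulrC ler_wpM2r// exprn_ge0.
- by apply: is_cvg_geometric_series; rewrite ger0_norm.
Qed.

Lemma upE x H k : 0 <= x < 1 -> bounded H -> up x H k = H k + x *: up x H k.+1.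
Proof.
move=> x01 bH; apply/rowP => c; rewrite !mxE.
apply/cvg_lim => //; rewrite -cvg_shiftS/=.
have e L : \sum_(0 <= l < L.+1) x ^+ l * H (k + l)%N 0 c =
    H k 0 c + x * \sum_(0 <= l < L) x ^+ l * H (k.+1 + l)%N 0 c.
  rewrite big_nat_recl//= expr0 mul1r addn0 mulr_sumr; congr (_ + _).
  by apply: eq_bigr => l _; rewrite exprS addnS addSn mulrA.
under eq_fun do rewrite e.
apply: cvgD; first exact: cvg_cst.
by apply: cvgMr; exact: up_is_cvg.
Qed.

Lemma up_bounded x H : 0 <= x < 1 -> bounded H -> bounded (up x H).
Proof.
move=> x01; have /andP[x0 x1] := x01; move=> bH; have [C hC] := bH.
exists (C / (1 - x)) => k c; have C0 : 0 <= C by apply: le_trans (hC 0%N c).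
rewrite mxE; have cv := up_is_cvg (k := k) (c := c) x01 bH.
rewrite -lim_norm//; apply: limr_le; first exact: is_cvg_norm.
near=> L; apply: (le_trans (ler_norm_sum _ _ _)).
apply: (@le_trans _ _ (series (geometric C x) L)).
  apply: ler_sum => l _; rewrite normrM normrX (ger0_norm x0) mulrC ler_wpM2r// exprn_ge0//.
rewrite geometric_seriesE ?lt_eqF//= ler_pM2r ?invr_gt0 ?subr_gt0//.
by rewrite ler_piMr// gerBl exprn_ge0.
Unshelve. all: by end_near. Qed.

Lemma down_bounded y H : 0 <= y < 1 -> bounded H -> bounded (down y H).
Proof.
move=> /andP[y0 y1] [C hC]; exists (C / (1 - y)) => k c.
have C0 : 0 <= C by apply: le_trans (hC 0%N c).
have y1' : 0 < 1 - y by rewrite subr_gt0.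
elim: k => [|k IH].
  by rewrite down0 (le_trans (hC _ _))// ler_pdivlMr// ler_piMr// gerBl.
rewrite downS !mxE (le_trans (ler_normD _ _))//.
have -> : C / (1 - y) = C + y * (C / (1 - y)) by field; rewrite gt_eqF.
by rewrite lerD// normrM ger0_norm// ler_wpM2l.
Qed.

(** Extend [H] by 0 to negative sites; then both operators are series in the
    shift, and they commute. But the extension of [up x H] is
    [x ^+ m *: up x H 0] at site [- m], and [down], which stops at site 0,
    misses these terms. They add up to the geometric series on the right. *)
Lemma up_down x y H k : 0 <= x < 1 -> 0 <= y < 1 -> bounded H ->
  up x (down y H) k = down y (up x H) k + (x * y / (1 - x * y) * y ^+ k) *: up x H 0%N.
Proof.
move=> x01 y01 bH; have /andP[x0 x1] := x01; have /andP[y0 y1] := y01.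
have xy1 : x * y < 1 by rewrite mulr_ilt1.
have xy0 : 1 - x * y != 0 by rewrite subr_eq0 gt_eqF.
set u := x * y / (1 - x * y); set w := up x H 0%N.
have bU := up_bounded x01 bH; have bE := down_bounded y01 bU.
have bG : bounded (fun k => down y (up x H) k + (u * y ^+ k) *: w).
  have [C hC] := bE; have [D hD] := bU; exists (C + `|u| * D) => j c.
  rewrite !mxE (le_trans (ler_normD _ _))// lerD// normrM normrM.
  have D0 : 0 <= D by apply: le_trans (hD 0%N c).
  rewrite (ger0_norm (exprn_ge0 _ y0)) -mulrA ler_wpM2l//.
  rewrite -[X in _ <= X]mul1r; apply: ler_pM => //.
  - exact: exprn_ge0.
  - by rewrite exprn_ile1// ltW.
  - by have := hD 0%N c; rewrite mxE.
apply: (@up_uniq x (fun k => down y (up x H) k + (u * y ^+ k) *: w)).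
  exact: bounded_tame.
move=> {}k.
suff rec (U : nat -> 'rV[R]_N) : (forall k, U k = H k + x *: U k.+1) -> forall k,
    down y U k - x *: down y U k.+1 = down y H k - (x * y ^+ k.+1) *: U 0%N.
  have := rec _ (fun k => upE k x01 bH) k; rewrite -/w; clear bG; clearbody w.
  move/(canRL (subrK _)) => ->; apply/rowP => c; rewrite !mxE /u !exprS.
  by field.
move=> HU; elim=> [|j IH].
  rewrite !downS !down0; apply/rowP => c; have /rowP/(_ c) := HU 0%N.
  by rewrite !mxE expr1 => ->; ring.
transitivity (U j.+1 - x *: U j.+2 + y *: (down y U j - x *: down y U j.+1)).
  rewrite [down y U j.+2]downS [X in X - _ = _]downS.
  by apply/rowP => c; rewrite !mxE; ring.
rewrite IH [down y H j.+1]downS {1}(HU j.+1).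
by apply/rowP => c; rewrite !mxE !exprS; ring.
Qed.

End Operators.

(** * Summation over horizontal strips *)

(** The truncations [DL] exhaust [D] by level, so a sum over [D] can be computed
    as an ordinary limit of real numbers. *)
Lemma esum_limit (R : realType) (T : choiceType) (D : set T) (DL : nat -> set T)
    (level : T -> nat) (a : T -> \bar R) (v : R^nat) (l : R) :
  (forall L, DL L `<=` D) ->
  (forall x L, D x -> (level x <= L)%N -> DL L x) ->
  (forall x, D x -> (0 <= a x)%E) ->
  (forall L, (\esum_(x in DL L) a x)%E = (v L)%:E) ->
  v @ \oo --> l -> (\esum_(x in D) a x)%E = l%:E.
Proof.
move=> DLD lev a0 av vl.
have le_sum L : (\esum_(x in DL L) a x <= \esum_(x in D) a x)%E.
  apply: ge_ereal_sup => _ [F [finF FD] <-]; apply: esum_ge; exists F => //.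
  by split=> //; exact: subset_trans (DLD L).
have mono L L' : (L <= L')%N -> forall F, finite_set F -> F `<=` D ->
    (forall x, F x -> (level x <= L)%N) -> (\sum_(x \in F) a x <= (v L')%:E)%E.
  move=> LL' F finF FD lv; rewrite -av; apply: esum_ge; exists F => //.
  by split=> // x Fx; apply: lev; [exact: FD|exact: leq_trans (lv _ Fx) LL'].
apply/eqP; rewrite eq_le; apply/andP; split.
  apply: ge_ereal_sup => _ [F [finF FD] <-].
  pose L := (\max_(x <- fset_set F) level x)%N.
  have lv x : F x -> (level x <= L)%N.
    by move=> Fx; apply: (@leq_bigmax_seq _ _ predT level x) => //; rewrite in_fset_set// mem_set.
  have h L' : (L <= L')%N -> (\sum_(x \in F) a x <= (v L')%:E)%E by move=> LL'; exact: (mono L).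
  have fin : (\sum_(x \in F) a x)%E \is a fin_num.
    rewrite ge0_fin_numE; first by rewrite (le_lt_trans (h L (leqnn L)))// ltry.
    by apply: fsume_ge0 => x /FD; exact: a0.
  rewrite -(fineK fin) lee_fin; apply: (cvgr_to_ge vl); exists L => // L' /= LL'.
  by rewrite -lee_fin fineK// h.
case E : (\esum_(x in D) a x)%E => [r| |].
- rewrite lee_fin; apply: (cvgr_to_le vl); near=> L.
  by rewrite -lee_fin -av -E.
- by rewrite leey.
- by have := esum_ge0 a0; rewrite E.
Unshelve. all: by end_near. Qed.

Section Steps.
Variable (R : realType).
Variable N : nat.
Implicit Types (G H : nat -> 'rV[R]_N) (la mu nu : intpart) (x y : R).

(** The change of rows is multiplication by a unitriangular matrix. *)
Lemma det_add_later_rows (A B : 'I_N -> 'rV[R]_N) (c : 'I_N -> 'I_N -> R) :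
  (forall i, A i = B i + \sum_(j < N | (i < j)%N) c i j *: B j) ->
  \det (\matrix_(i < N) A i) = \det (\matrix_(i < N) B i).
Proof.
move=> AB.
pose T : 'M[R]_N := \matrix_(i, j) (if j == i then 1 else if (i < j)%N then c i j else 0).
have -> : \matrix_(i < N) A i = T *m \matrix_(i < N) B i.
  apply/row_matrixP => i; rewrite rowK AB; apply/rowP => k; rewrite !mxE summxE.
  rewrite [RHS](bigD1 i)//= !mxE eqxx mul1r; congr (_ + _).
  rewrite big_mkcond [RHS]big_mkcond/=; apply: eq_bigr => j _.
  by rewrite !mxE; case: eqVneq => [->|ne] /=; rewrite ?ltnn//; case: ifP; rewrite ?mul0r.
rewrite det_mulmx -det_tr det_trig; last first.
  apply/is_trig_mxP => i j ij; rewrite !mxE ifF; last by apply/negbTE; rewrite neq_ltn ij.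
  by rewrite ltnNge (ltnW ij).
by rewrite big1 ?mul1r// => i _; rewrite !mxE eqxx.
Qed.

Lemma det_add_earlier_rows (A B : 'I_N -> 'rV[R]_N) (c : 'I_N -> 'I_N -> R) :
  (forall i, A i = B i + \sum_(j < N | (j < i)%N) c i j *: B j) ->
  \det (\matrix_(i < N) A i) = \det (\matrix_(i < N) B i).
Proof.
move=> AB.
pose T : 'M[R]_N := \matrix_(i, j) (if j == i then 1 else if (j < i)%N then c i j else 0).
have -> : \matrix_(i < N) A i = T *m \matrix_(i < N) B i.
  apply/row_matrixP => i; rewrite rowK AB; apply/rowP => k; rewrite !mxE summxE.
  rewrite [RHS](bigD1 i)//= !mxE eqxx mul1r; congr (_ + _).
  rewrite big_mkcond [RHS]big_mkcond/=; apply: eq_bigr => j _.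
  by rewrite !mxE; case: eqVneq => [->|ne] /=; rewrite ?ltnn//; case: ifP; rewrite ?mul0r.
rewrite det_mulmx det_trig; last first.
  apply/is_trig_mxP => i j ij; rewrite !mxE ifF; last by apply/negbTE; rewrite neq_ltn ij orbT.
  by rewrite ltnNge (ltnW ij).
by rewrite big1 ?mul1r// => i _; rewrite !mxE eqxx.
Qed.

Lemma weight_prod mu la x (sz : (size la <= N)%N) : hstrip mu la ->
  x ^+ (sumn la - sumn mu) = \prod_(i < N) x ^+ (part la i - part mu i).
Proof.
move=> h; rewrite (sumn_part sz) (sumn_part (leq_trans (proj1 (hstrip_size h)) sz)).
by rewrite -sumnB ?prodrXr// => i _; case: (h i).
Qed.

Lemma down_window y H a b : (a <= b)%N ->
  down y H b = \sum_(a <= k < b.+1) y ^+ (b - k) *: H k +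
               (if a is a'.+1 then y ^+ (b - a') *: down y H a' else 0).
Proof.
move=> ab; rewrite /down -(big_mkord predT (fun l => y ^+ (b - l) *: H l)).
rewrite (big_cat_nat _ (n := a))//= ?(leqW ab)// addrC; congr (_ + _).
case: a ab => [|a] ab; first by rewrite big_nil.
rewrite big_mkord scaler_sumr; apply: eq_bigr => l _.
by rewrite scalerA -exprD; congr (_ ^+ _ *: _); move: (ltn_ord l) ab; lia.
Qed.

Lemma up_window x H a b : 0 <= x < 1 -> bounded H -> (a <= b)%N ->
  up x H a = \sum_(a <= k < b) x ^+ (k - a) *: H k + x ^+ (b - a) *: up x H b.
Proof.
move=> x01 bH /subnK <-; elim: (b - a)%N => [|d IH].
  by rewrite add0n subnn big_geq// add0r expr0 scale1r.
rewrite IH addSn big_nat_recr ?leq_addl//= -addrA; congr (_ + _).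
by rewrite (upE _ x01 bH) scalerDr scalerA -exprSr subSn ?leq_addl.
Qed.

(** Row [i] of the sum runs over the window from [part la i.+1] to [part la i].
    It differs from row [i] of [down y H], which starts from site 0, by a
    multiple of row [i.+1] of [down y H]. *)
Lemma sum_down y H la : 0 <= y -> (size la <= N)%N ->
  (forall mu, hstrip mu la -> 0 <= minor H mu) ->
  (\esum_(mu in [set mu | hstrip mu la]) (y ^+ (sumn la - sumn mu) * minor H mu)%:E)%E
  = (minor (down y H) la)%:E.
Proof.
move=> y0 sz pos.
have boxE : [set mu | hstrip mu la] = box N (fun i => part la i.+1) (part la).
  apply/seteqP; split=> mu /= h.
    split; first by rewrite (leq_trans (proj1 (hstrip_size h))).
    by move=> i _; apply/andP; case: (h i).
  move=> i; case: h => [smu h]; have [iN|Ni] := ltnP i N; first by have /andP[] := h i iN.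
  have sla := leq_trans sz Ni; have smu' := leq_trans smu Ni.
  by rewrite !part_default// ltnW.
rewrite boxE.
have hb mu : box N (fun i => part la i.+1) (part la) mu -> hstrip mu la.
  by rewrite -boxE.
under eq_esum => mu hmu do rewrite (weight_prod _ sz (hb _ hmu)).
rewrite (@sum_minor_box _ _ _ _ _ (fun i k => y ^+ (part la i - k)))//; last first.
  move=> mu /hb/pos h.
  by rewrite mulr_ge0// prodr_ge0// => i _; rewrite exprn_ge0.
congr EFin; apply/esym.
pose D (i : 'I_N) : 'rV[R]_N := down y H (site N la i).
rewrite /minor -[\matrix_(i < N) _]/(\matrix_(i < N) D i); apply/esym.
apply: (@det_add_later_rows _ _ (fun i j =>
  if (j == i.+1 :> nat) then - y ^+ (site N la i - site N la j) else 0)) => i.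
have sh : \sum_(part la i.+1 <= k < (part la i).+1) y ^+ (part la i - k) *: H (k + (N - i.+1))%N
   = \sum_(part la i.+1 + (N - i.+1) <= k < (site N la i).+1) y ^+ (site N la i - k) *: H k.
  rewrite /site -addSn big_addn addnK; apply: eq_bigr => k _.
  by rewrite subnDr.
rewrite sh {sh} /D (@down_window y H (part la i.+1 + (N - i.+1))%N (site N la i)); last first.
  by rewrite leq_add2r part_noninc.
rewrite -addrA -[LHS]addr0; congr (_ + _).
have [iN|Ni] := ltnP i.+1 N.
  rewrite (bigD1 (Ordinal iN))/= ?ltnSn// eqxx big1 ?addr0; last first.
    by move=> j /andP[_ ji]; rewrite ifN ?scale0r.
  have -> : (part la i.+1 + (N - i.+1) = (site N la i.+1).+1)%N.
    by rewrite /site -addnS subnSK.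
  by rewrite scaleNr subrr.
have -> : (N - i.+1 = 0)%N by apply/eqP; rewrite subn_eq0.
rewrite (@part_default la i.+1) ?(leq_trans sz)//= add0r big1// => j ij.
by rewrite ifF ?scale0r//; apply/negbTE; rewrite neq_ltn (leq_trans (ltn_ord j))// orbF.
Qed.

End Steps.

(** Sylvester's identity: both sides are the determinant of one block matrix. *)
Lemma det_1addC (F : comNzRingType) m n (A : 'M[F]_(m, n)) (B : 'M[F]_(n, m)) :
  \det (1%:M + A *m B) = \det (1%:M + B *m A).
Proof.
pose P := block_mx 1%:M (- A) B 1%:M : 'M[F]_(m + n).
have e1 : P *m block_mx 1%:M A 0 1%:M = block_mx 1%:M 0 B (1%:M + B *m A).
  by rewrite mulmx_block !mul1mx !mulmx1 !mulmx0 !addr0 subrr [in RHS]addrC.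
have e2 : P *m block_mx 1%:M 0 (- B) 1%:M = block_mx (1%:M + A *m B) (- A) 0 1%:M.
  by rewrite mulmx_block !mul1mx !mulmx1 !mulmx0 !add0r mulNmx mulmxN opprK subrr.
have := congr1 determinant e1; have := congr1 determinant e2.
by rewrite !det_mulmx !det_ublock !det_lblock !det1 !mulr1 !mul1r => -> ->.
Qed.

Lemma cvg_sum_seq (R : realType) (I : Type) (r : seq I) (f : I -> R^nat) (l : I -> R) :
  (forall i, f i @ \oo --> l i) ->
  (fun n => \sum_(i <- r) f i n) @ \oo --> \sum_(i <- r) l i.
Proof.
move=> fl; elim: r => [|i r IH].
  by rewrite big_nil; under eq_fun do rewrite big_nil; exact: cvg_cst.
by rewrite big_cons; under eq_fun do rewrite big_cons; apply: cvgD.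
Qed.

Lemma det_cvg_row (R : realType) N (i0 : 'I_N) (A : nat -> 'I_N -> 'rV[R]_N)
    (B : 'I_N -> 'rV[R]_N) :
  (forall L i, i != i0 -> A L i = B i) ->
  (forall c, (fun L => A L i0 0 c) @ \oo --> B i0 0 c) ->
  (fun L => \det (\matrix_(i < N) A L i)) @ \oo --> \det (\matrix_(i < N) B i).
Proof.
move=> AB cv; rewrite (expand_det_row _ i0).
under eq_fun do rewrite (expand_det_row _ i0).
apply: cvg_sum_seq => j; rewrite mxE.
have e L : cofactor (\matrix_(i < N) A L i) i0 j = cofactor (\matrix_(i < N) B i) i0 j.
  rewrite /cofactor; congr (_ * \det _); apply/matrixP => i k; rewrite !mxE AB//.
  by rewrite eq_sym neq_lift.
under eq_fun do rewrite e mxE.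
by apply: cvgM; [exact: cv|exact: cvg_cst].
Qed.

Section Steps.
Variable (R : realType).
Variable N : nat.
Implicit Types (G H : nat -> 'rV[R]_N) (la mu nu : intpart) (x y : R).

(** As for [sum_down], but now row [i] is completed by row [i.-1], and row 0 is
    unbounded: it is first cut at length [L] and then passed to the limit.
    Adding a strip may create one more part, whence [size mu < N]. *)
Lemma sum_up x H mu : 0 <= x < 1 -> bounded H -> (size mu < N)%N ->
  (forall la, hstrip mu la -> 0 <= minor H la) ->
  (\esum_(la in [set la | hstrip mu la]) (x ^+ (sumn la - sumn mu) * minor H la)%:E)%E
  = (minor (up x H) mu)%:E.
Proof.
move=> x01 bH sz pos; have x0 : 0 <= x by case/andP: x01.
have N0 : (0 < N)%N by exact: leq_ltn_trans sz.
pose hi L i := if i is i'.+1 then part mu i' else (part mu 0 + L)%N.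
pose A L (i : 'I_N) := \sum_(part mu i <= k < (hi L i).+1)
  x ^+ (k - part mu i) *: H (k + (N - i.+1))%N.
have hb L la : box N (part mu) (hi L) la -> hstrip mu la.
  move=> [sla h] i; split.
    have [iN|Ni] := ltnP i N; first by case/andP: (h i iN).
    by rewrite part_default// (leq_trans (ltnW sz)).
  have [iN|Ni] := ltnP i.+1 N; first by case/andP: (h _ iN).
  by rewrite part_default// (leq_trans sla).
have ssz la : hstrip mu la -> (size la <= N)%N.
  by move=> h; rewrite (leq_trans (proj2 (hstrip_size h))).
apply: (@esum_limit _ _ _ (fun L => box N (part mu) (hi L)) (fun la => part la 0) _
          (fun L => \det (\matrix_(i < N) A L i))).
- by move=> L la; exact: hb.
- move=> la L h lev; split; first exact: ssz.
  move=> [|i] iN; rewrite (proj1 (h _))/=; last by case: (h i).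
  exact: leq_trans lev (leq_addl _ _).
- by move=> la h; rewrite lee_fin mulr_ge0 ?exprn_ge0// pos.
- move=> L.
  under eq_esum => la hla do rewrite (weight_prod _ (ssz _ (hb _ _ hla)) (hb _ _ hla)).
  rewrite (@sum_minor_box _ _ _ _ _ (fun i k => x ^+ (k - part mu i)))//.
  move=> la /hb/pos h.
  by rewrite mulr_ge0// prodr_ge0// => i _; rewrite exprn_ge0.
pose i0 := Ordinal N0.
pose B (i : 'I_N) := if i == i0 then up x H (site N mu 0) else A 0%N i.
have -> : minor (up x H) mu = \det (\matrix_(i < N) B i).
  apply/esym; rewrite /minor.
  apply: (@det_add_earlier_rows _ _ _ _ (fun i j =>
     if (i == j.+1 :> nat) then - x ^+ (site N mu j - site N mu i) else 0)) => i.
  case: (eqVneq i i0) => [->|ne]; first by rewrite /B eqxx big1 ?addr0.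
  rewrite /B (negPf ne); case: i ne => [[|i] iN] ne; first by case/eqP: ne; exact: val_inj.
  rewrite (bigD1 (Ordinal (ltnW iN)))/= ?ltnSn// eqxx big1 ?addr0; last first.
    by move=> j /andP[_ ji]; rewrite eqSS ifN ?scale0r// eq_sym.
  have sE : ((part mu i).+1 + (N - i.+2) = site N mu i)%N.
    by rewrite /site addSnnS subnSK.
  have le : (site N mu i.+1 <= site N mu i)%N.
    by rewrite -sE leq_add2r (leq_trans (part_noninc mu (leqnSn i))).
  rewrite (up_window x01 bH le) scaleNr addrK /A /= -[in RHS]sE /site big_addn addnK.
  by apply: eq_bigr => k _; rewrite subnDr.
apply: (@det_cvg_row _ _ i0).
  by move=> L [[|i] iN] ne; [case/eqP: ne; exact: val_inj|rewrite /B (negPf ne)].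
move=> c; rewrite /B eqxx.
have -> : (fun L => A L i0 0 c) =
    (fun L => \sum_(0 <= l < L.+1) x ^+ l * H (site N mu 0 + l)%N 0 c).
  apply/funext => L; rewrite /A /hi summxE /= -addnS -{1}[part mu 0]add0n big_addn addKn.
  apply: eq_bigr => l _; rewrite mxE addnK /site; congr (_ * H _ _ _); lia.
have := @up_cvg _ _ _ (up x H) _ (site N mu 0) c
  (bounded_tame x01 (up_bounded x01 bH)) (fun k => upE k x01 bH).
by rewrite -cvg_shiftS.
Qed.

(** Since [size mu < N], the last row sits at site 0, where it equals
    [up x H 0]. So the defect in [up_down] adds a multiple of the last row to
    every row, and only its own multiple counts. *)
Lemma minor_up_down x y H mu : 0 <= x < 1 -> 0 <= y < 1 -> bounded H -> (size mu < N)%N ->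
  minor (up x (down y H)) mu = (1 - x * y)^-1 * minor (down y (up x H)) mu.
Proof.
move=> x01 y01 bH sz; have /andP[x0 x1] := x01; have /andP[y0 y1] := y01.
have xy1 : x * y < 1 by rewrite mulr_ilt1.
have xy0 : 1 - x * y != 0 by rewrite subr_eq0 gt_eqF.
have lN : (N.-1 < N)%N by rewrite prednK// (leq_ltn_trans _ sz).
set u := x * y / (1 - x * y).
pose C : 'cV[R]_N := \col_i (u * y ^+ site N mu i).
pose r : 'rV[R]_N := delta_mx 0 (Ordinal lN).
have N0 : (0 < N)%N by exact: leq_ltn_trans sz.
have sl : site N mu N.-1 = 0%N.
  by rewrite /site prednK// subnn part_default// -ltnS prednK.
rewrite /minor.
have -> : \matrix_(i < N) up x (down y H) (site N mu i) =
    (1%:M + C *m r) *m \matrix_(i < N) down y (up x H) (site N mu i).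
  rewrite mulmxDl mul1mx -mulmxA -rowE rowK sl.
  apply/row_matrixP => i; rewrite rowK up_down// linearD/= rowK; congr (_ + _).
  by rewrite row_mul down0; apply/rowP => c; rewrite !mxE big_ord1 !mxE.
rewrite det_mulmx det_1addC; congr (_ * _).
rewrite -rowE [1%:M + _]mx11_scalar det_scalar1 !mxE/= sl expr0 mulr1 /u.
by field.
Qed.

End Steps.

(** * Walks driven by a word *)

(** [Up x] adds a horizontal strip, weighted by [x] to the power of its size;
    [Down y] removes one; [Obs s] is the time at which the observation labelled
    [s] is made. *)
Inductive letter (R : Type) : Type := Up of R | Down of R | Obs of nat.
Arguments Obs {R}.

Section Words.
Variable (R : realType).
Implicit Types (la mu nu : intpart) (x y : R) (w : seq (letter R)).

(** The range in which the geometric series of the letters converge. *)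
Definition good (a : letter R) : bool :=
  match a with Up x => 0 <= x < 1 | Down y => 0 <= y < 1 | Obs _ => true end.

Definition ups w : seq R := pmap (fun a => if a is Up x then Some x else None) w.
Definition downs w : seq R := pmap (fun a => if a is Down y then Some y else None) w.

(** Total weight of the walks that start at [mu], follow [w] and end at the
    empty partition; [o] is the weight of the observations. *)
Fixpoint path_sum (o : nat -> intpart -> R) w mu : \bar R :=
  match w with
  | [::] => (mu == empty_part)%:R%:E
  | Up x :: w' => (\esum_(la in [set la | hstrip mu la])
                     (x ^+ (sumn la - sumn mu))%:E * path_sum o w' la)%E
  | Down y :: w' => (\esum_(nu in [set nu | hstrip nu mu])
                     (y ^+ (sumn mu - sumn nu))%:E * path_sum o w' nu)%E
  | Obs s :: w' => ((o s mu)%:E * path_sum o w' mu)%E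
  end.

(** For the empty word, the rows form the basis that makes the minor the
    indicator of the empty partition, whose sites are [0, ..., N - 1]. *)
Fixpoint cols N (v : nat -> nat -> R) w : nat -> 'rV[R]_N :=
  match w with
  | [::] => fun k => \row_c (k == N - c.+1)%N%:R
  | Up x :: w' => up x (cols N v w')
  | Down y :: w' => down y (cols N v w')
  | Obs s :: w' => fun k => v s k *: cols N v w' k
  end.

Lemma path_sum_ge0 o w mu : (forall s la, 0 <= o s la) -> all good w ->
  (0 <= path_sum o w mu)%E.
Proof.
move=> o0; elim: w mu => [|[x|y|s] w IH] mu /=.
- by rewrite lee_fin ler0n.
- move=> /andP[/andP[x0 _] gw]; apply: esum_ge0 => la _.
  by rewrite mule_ge0 ?IH// lee_fin exprn_ge0.
- move=> /andP[/andP[x0 _] gw]; apply: esum_ge0 => la _.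
  by rewrite mule_ge0 ?IH// lee_fin exprn_ge0.
- by move=> gw; rewrite mule_ge0 ?IH// lee_fin.
Qed.

Lemma cols_bounded N v w : (forall s, exists C, forall k, `|v s k| <= C) ->
  all good w -> bounded (cols N v w).
Proof.
move=> bv; elim: w => [|[x|y|s] w IH] /=.
- by exists 1 => k c; rewrite mxE; case: eqP => _; rewrite ?normr1 ?normr0.
- by move=> /andP[x01 /IH]; exact: up_bounded.
- by move=> /andP[x01 /IH]; exact: down_bounded.
- move=> /IH[C hC]; have [D hD] := bv s; exists (D * C) => k c.
  by rewrite mxE normrM ler_pM.
Qed.

Lemma minor_end N v mu : (size mu <= N)%N ->
  minor (cols N v [::]) mu = (mu == empty_part)%:R.
Proof.
move=> sz; case: eqVneq => [->|ne]; rewrite /minor.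
  rewrite -[RHS](det1 _ N); congr (\det _); apply/matrixP => i j; rewrite !mxE.
  rewrite /site /part nth_nil add0n; congr (nat_of_bool _)%:R; apply/eqP/eqP => [e|->]//.
  by apply: val_inj => /=; move: (ltn_ord i) (ltn_ord j) e; lia.
have m0 : (0 < part mu 0)%N.
  rewrite part_gt0 lt0n; apply: contra ne; rewrite size_eq0 => /eqP e.
  by apply/eqP; exact: val_inj.
have N0 : (0 < N)%N by rewrite (leq_trans _ sz)// -part_gt0.
rewrite (expand_det_row _ (Ordinal N0)) big1// => j _; rewrite !mxE /site /=.
case: eqP => [e|_]; last by rewrite mul0r.
by exfalso; move: m0 N0 (ltn_ord j) e; lia.
Qed.

(** Each letter acts on minors through its action on the row function: for
    strips by [sum_up] and [sum_down], for an observation because its weight is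
    a product over the occupied sites, so that it scales the rows. The bound on
    [N] leaves room for the part that each [Up] may create. *)
Lemma path_sum_minor N (o : nat -> intpart -> R) (v : nat -> nat -> R) w mu :
  (forall s la, 0 <= o s la) -> (forall s, exists C, forall k, `|v s k| <= C) ->
  (forall s la, (size la <= N)%N -> o s la = \prod_(i < N) v s (site N la i)) ->
  all good w -> (size mu + size (ups w) <= N)%N ->
  path_sum o w mu = (minor (cols N v w) mu)%:E.
Proof.
move=> o0 bv ov; elim: w mu => [|[x|y|s] w IH] mu.
- by move=> _; rewrite addn0 => sz; rewrite minor_end.
- move=> /= /andP[x01 gw]; rewrite addnS => sz.
  have IH' la : hstrip mu la -> path_sum o w la = (minor (cols N v w) la)%:E.
    by move=> /hstrip_size[_ h]; apply: IH => //; rewrite (leq_trans _ sz)// -addSn leq_add2r.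
  under eq_esum => la hla do rewrite (IH' _ hla) -EFinM.
  apply: sum_up => //; first exact: cols_bounded.
    by rewrite (leq_trans _ sz)// ltnS leq_addr.
  by move=> la hla; rewrite -lee_fin -IH'//; exact: path_sum_ge0.
- move=> /= /andP[/andP[y0 _] gw] sz.
  have IH' nu : hstrip nu mu -> path_sum o w nu = (minor (cols N v w) nu)%:E.
    by move=> /hstrip_size[h _]; apply: IH => //; rewrite (leq_trans _ sz)// leq_add2r.
  under eq_esum => la hla do rewrite (IH' _ hla) -EFinM.
  apply: sum_down => //; first exact: leq_trans (leq_addr _ _) sz.
  by move=> nu hnu; rewrite -lee_fin -IH'//; exact: path_sum_ge0.
- move=> /= gw sz; rewrite IH// -EFinM /minor det_rowscale ov//.
  exact: leq_trans (leq_addr _ _) sz.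
Qed.

Lemma path_sum_scale o p w1 w2 (c : R) : (forall s la, 0 <= o s la) ->
  0 <= c -> all good p -> all good w2 ->
  (forall mu, path_sum o w1 mu = (c%:E * path_sum o w2 mu)%E) ->
  forall mu, path_sum o (p ++ w1) mu = (c%:E * path_sum o (p ++ w2) mu)%E.
Proof.
move=> o0 c0 + gw e; elim: p => [|[x|y|s] p IH] //=.
- move=> /andP[/andP[x0 _] gp] mu; rewrite -esumZl//; last first.
    by move=> la _; rewrite mule_ge0 ?lee_fin ?exprn_ge0// path_sum_ge0// all_cat gp.
  by apply: eq_esum => la _; rewrite IH// muleCA.
- move=> /andP[/andP[x0 _] gp] mu; rewrite -esumZl//; last first.
    by move=> la _; rewrite mule_ge0 ?lee_fin ?exprn_ge0// path_sum_ge0// all_cat gp.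
  by apply: eq_esum => la _; rewrite IH// muleCA.
- by move=> gp mu; rewrite IH// muleCA.
Qed.

(** * The partition function of a word *)

Let one : nat -> intpart -> R := fun _ _ => 1.

Lemma one_ge0 s la : 0 <= one s la. Proof. exact: ler01. Qed.

Lemma path_sum_swap x y w mu : 0 <= x < 1 -> 0 <= y < 1 -> all good w ->
  path_sum one (Up x :: Down y :: w) mu =
  ((1 - x * y)^-1%:E * path_sum one (Down y :: Up x :: w) mu)%E.
Proof.
move=> x01 y01 gw; pose N := (size mu + (size (ups w)).+1)%N.
have ov s la : (size la <= N)%N -> one s la = \prod_(i < N) (fun _ _ => 1) s (site N la i).
  by move=> _; rewrite big1.
have bv (s : nat) : exists C : R, forall k : nat, `|(fun _ _ => 1) s k| <= C.
  by exists 1 => k; rewrite normr1.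
rewrite (path_sum_minor (N := N) one_ge0 bv ov) ?(path_sum_minor (N := N) one_ge0 bv ov) //=.
- rewrite -EFinM minor_up_down//; first exact: cols_bounded.
  by rewrite /N addnS ltnS leq_addr.
- by rewrite y01 x01.
- by rewrite x01 y01.
Qed.

(** Nothing can be removed from the empty partition. *)
Lemma path_sum_Downs0 o y w : (forall s la, 0 <= o s la) -> all good w ->
  path_sum o (Down y :: w) empty_part = path_sum o w empty_part.
Proof.
move=> o0 gw /=; rewrite (@esum_single _ _ _ empty_part).
- by rewrite subnn expr0 mul1e.
- exact: hstrip00.
- by rewrite subnn expr0 mul1e; exact: path_sum_ge0.
- by move=> nu /hstripNil ->.
Qed.

Lemma path_sum_Ups (xs : seq R) : all good (map (@Up R) xs) ->
  forall mu, path_sum one (map (@Up R) xs) mu = (mu == empty_part)%:R%:E.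
Proof.
elim: xs => [|x xs IH] //= /andP[x01 gx] mu.
under eq_esum do rewrite IH//.
case: eqVneq => [->|ne].
  rewrite (@esum_single _ _ _ empty_part).
  - by rewrite eqxx mule1 subnn.
  - exact: hstrip00.
  - by rewrite eqxx mule1 subnn lee_fin ler01.
  - by move=> la _ /eqP/negPf ->; rewrite mule0.
rewrite esum1// => la hs; case: eqVneq => [e|_]; last by rewrite mule0.
by move/eqP: ne; case; apply: hstripNil; rewrite -e.
Qed.

(** The product of [(1 - x * y)^-1] over the letters [Up x] that stand before a
    letter [Down y]; [xs] collects the [Up] letters already read. *)
Fixpoint Zword (xs : seq R) w : R :=
  match w with
  | [::] => 1
  | Up x :: w' => Zword (rcons xs x) w'
  | Down y :: w' => (\prod_(x <- xs) (1 - x * y)^-1) * Zword xs w'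
  | Obs _ :: w' => Zword xs w'
  end.

Lemma inv_ge0 x y : 0 <= x < 1 -> 0 <= y < 1 -> 0 <= (1 - x * y)^-1.
Proof.
move=> /andP[x0 x1] /andP[y0 y1].
by rewrite invr_ge0 subr_ge0 mulr_ile1// ltW.
Qed.

Lemma path_sum_moveDown xs y w mu : all good (map (@Up R) xs) -> 0 <= y < 1 -> all good w ->
  path_sum one (map (@Up R) xs ++ Down y :: w) mu =
  ((\prod_(x <- xs) (1 - x * y)^-1)%:E * path_sum one (Down y :: map (@Up R) xs ++ w) mu)%E.
Proof.
move=> + y01 gw; elim: xs mu => [|x xs IH] mu; first by rewrite big_nil mul1e.
move=> gxx; have /andP[x01 gx] : (0 <= x < 1) && all good (map (@Up R) xs) := gxx.
have pos : 0 <= \prod_(x <- xs) (1 - x * y)^-1.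
  rewrite big_seq; apply: prodr_ge0 => z zx; apply: inv_ge0 => //.
  by move: gx; rewrite all_map => /allP/(_ z zx).
have gxw : all good (map (@Up R) xs ++ w) by rewrite all_cat gx gw.
rewrite big_cons mulrC EFinM.
rewrite map_cons !cat_cons -(cat1s (Up x) (map (@Up R) xs ++ Down y :: w)).
rewrite (path_sum_scale (p := [:: Up x]) (w2 := Down y :: map (@Up R) xs ++ w) one_ge0 pos)//.
- by rewrite [[:: Up x] ++ _]/= path_sum_swap// muleA.
- by rewrite /= x01.
- by rewrite /= y01.
- by move=> nu; exact: IH.
Qed.

Lemma path_sum_Zword xs w : all good (map (@Up R) xs) -> all good w ->
  path_sum one (map (@Up R) xs ++ w) empty_part = (Zword xs w)%:E.
Proof.
elim: w xs => [|[x|y|s] w IH] xs gx.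
- by move=> _; rewrite cats0 path_sum_Ups// eqxx.
- move=> /andP[x01 gw]; rewrite -cat_rcons -map_rcons IH//.
  by rewrite map_rcons all_rcons gx andbT.
- move=> /andP[y01 gw]; rewrite path_sum_moveDown// (path_sum_Downs0 _ one_ge0) ?all_cat ?gx//.
  by rewrite IH// EFinM.
- move=> /= gw; rewrite (path_sum_scale (w2 := w) one_ge0 ler01)//.
  by rewrite mul1e IH.
Qed.

Lemma Zword_gt0 xs w : all good (map (@Up R) xs) -> all good w -> 0 < Zword xs w.
Proof.
elim: w xs => [|[x|y|s] w IH] xs gx //=.
- by move=> /andP[x01 gw]; rewrite IH// map_rcons all_rcons gx andbT.
- move=> /andP[/andP[y0 y1] gw]; rewrite mulr_gt0 ?IH// big_seq prodr_gt0// => x xx.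
  move: gx; rewrite all_map => /allP/(_ x xx)/= /andP[x0 x1].
  by rewrite invr_gt0 subr_gt0 mulr_ilt1.
- exact: IH.
Qed.

End Words.

(** * Observations as perturbations of finite rank *)

(** Such an [M] is strictly triangular after sorting by [a]. In the Leibniz
    formula, a permutation with a nonzero term never decreases [a]; the sum of
    [a] being preserved, it stays within the levels of [a], where [M] vanishes,
    so it is the identity. *)
Lemma det_1add_increasing (F : comNzRingType) d (a : 'I_d -> nat) (M : 'M[F]_d) :
  (forall r c, M r c != 0 -> (a r < a c)%N) -> \det (1%:M + M) = 1.
Proof.
move=> aM.
have M0 r c : (a c <= a r)%N -> M r c = 0.
  by move=> h; apply/eqP; apply: contraTT h => /aM; rewrite ltnNge.
rewrite /determinant (bigD1 1%g)//= odd_perm1 expr0 mul1r big1 => [|i _]; last first.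
  by rewrite perm1 !mxE eqxx M0// addr0.
rewrite big1 ?addr0// => s s1.
suff [i hi] : exists i, (1%:M + M) i (s i) = 0 by rewrite (bigD1 i)//= hi mul0r mulr0.
apply/not_existsP => nz.
have le i : (a i <= a (s i))%N.
  rewrite leqNgt; apply/negP => lt; apply: (nz i).
  rewrite !mxE (M0 _ _ (ltnW lt)) addr0; case: eqVneq => // e.
  by move: lt; rewrite -e ltnn.
have := leqif_sum (P := predT) (fun i _ => leqif_eq (le i)).
rewrite [X in (_ <= X ?= iff _)%N](_ : _ = (\sum_i a i)%N); last first.
  by rewrite [RHS](reindex_inj (@perm_inj _ s)).
move=> [_]; rewrite eqxx => /esym/forallP eqa.
move/eqP: s1; apply; apply/permP => i; rewrite perm1.
apply/eqP; apply: contraT => ne; case: (nz i).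
by rewrite !mxE eq_sym (negPf ne) add0r M0// (eqP (eqa i)).
Qed.

Section Resolvent.
Variable (R : realType).

Lemma tame_mulmx m n (x : R) (H : nat -> 'rV[R]_m) (A : 'M[R]_(m, n)) :
  tame x H -> tame x (fun k => H k *m A).
Proof.
move=> tH k c.
have -> : (fun L => x ^+ L * (H (k + L)%N *m A) 0 c) =
    (fun L => \sum_j (x ^+ L * H (k + L)%N 0 j) * A j c).
  by apply/funext => L; rewrite mxE mulr_sumr; apply: eq_bigr => j _; rewrite mulrA.
rewrite (_ : nbhs (0 : R) = nbhs (\sum_(j <- index_enum 'I_m) 0 * A j c)); last first.
  by rewrite big1// => j _; rewrite mul0r.
apply: cvg_sum_seq => j.
by apply: cvgM; [exact: tH|exact: cvg_cst].
Qed.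

Lemma tameB n (x : R) (G H : nat -> 'rV[R]_n) :
  tame x G -> tame x H -> tame x (fun k => G k - H k).
Proof.
move=> tG tH k c.
have -> : (fun L => x ^+ L * (G (k + L)%N - H (k + L)%N) 0 c) =
    (fun L => x ^+ L * G (k + L)%N 0 c - x ^+ L * H (k + L)%N 0 c).
  by apply/funext => L; rewrite !mxE mulrBr.
by rewrite -(subr0 (0 : R)); apply: cvgB.
Qed.

(** Uniqueness for the recurrence of [up x], in homogeneous form. *)
Lemma tame_fixed0 n (x : R) (G : nat -> 'rV[R]_n) :
  tame x G -> (forall k, G k = x *: G k.+1) -> forall k, G k = 0.
Proof.
move=> tG GE k.
have t0 : tame x (fun _ => 0 : 'rV[R]_n).
  by move=> j c; under eq_fun do rewrite mxE mulr0; exact: cvg_cst.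
have e1 := @up_uniq _ _ x G (fun=> 0) tG (fun k => etrans (GE k) (esym (add0r _))).
have e2 := @up_uniq _ _ x (fun=> 0) (fun=> 0) t0 (fun k => esym (etrans (add0r _) (scaler0 _ _))).
by rewrite -e1 e2.
Qed.

Lemma addZmxE m n (A B : 'M[R]_(m, n)) y i j :
  (A + y *: B) i j = A i j + y * B i j.
Proof. by rewrite !mxE. Qed.

Definition is_obs (s : nat) (l : letter R) : bool := if l is Obs s' then s' == s else false.

Fixpoint after (s : nat) (w : seq (letter R)) : seq (letter R) :=
  if w is l :: w' then if is_obs s l then w' else after s w' else [::].

Lemma after_suffix s w : exists pre, w = pre ++ after s w.
Proof.
elim: w => [|l w [pre e]] /=; first by exists [::].
case: ifP => _; first by exists [:: l].
by exists (l :: pre); rewrite {1}e.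
Qed.

Variables (N d : nat) (w : seq (letter R)).
Variables (a : 'I_d -> nat) (b : 'I_d -> nat) (u : 'I_d -> R).
Variable kap : seq (letter R) -> nat -> 'rV[R]_d.

Definition obs_weight (s k : nat) : R := 1 + \sum_(r | (a r == s) && (b r == k)) u r.
Let one (s k : nat) : R := 1.

(** Across a letter of strip type, the relation between a row function before
    and after it; across an observation, a jump in the columns of the points
    observed there. *)
Definition kernel_step (l : letter R) (K K' : nat -> 'rV[R]_d) : Prop :=
  match l with
  | Up x => tame x K /\ forall k, K k = K' k + x *: K k.+1
  | Down y => K 0%N = K' 0%N /\ forall k, K k.+1 = K' k.+1 + y *: K k
  | Obs s => forall k, K k = K' k - \sum_(c | (a c == s) && (b c == k)) delta_mx 0 c
  end.

Hypothesis wgood : all (@good R) w.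
Hypothesis after_obs : forall pre s suf, w = pre ++ Obs s :: suf -> after s w = suf.
Hypothesis obs_order : forall r c, has (is_obs (a c)) (after (a r) w) -> (a r < a c)%N.
Hypothesis kap_step : forall pre l suf, w = pre ++ l :: suf ->
  kernel_step l (kap (l :: suf)) (kap suf).
(* The walk ends at the empty partition, whose sites are those below [N]. *)
Hypothesis kap_end : forall k, (N <= k)%N -> kap [::] k = 0.
Hypothesis kap_start : forall k, (k < N)%N -> kap w k = 0.

(* [Hu] and [H1] are the row functions with and without observation weights;
   the rows of [S] are the sources that the weights add at the observed sites. *)
Let Hu suf := cols N obs_weight suf.
Let H1 suf := cols N one suf.
Let S : 'M[R]_(d, N) := \matrix_r (u r *: Hu (after (a r) w) (b r)).
Let q : 'M[R]_(N, d) := \matrix_(c' < N) kap [::] (N - c'.+1).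

Let H1_tame x suf : 0 <= x < 1 -> all (@good R) suf -> tame x (H1 suf).
Proof.
move=> x01 gs; apply: bounded_tame => //; apply: cols_bounded => // s.
by exists 1 => k; rewrite normr1.
Qed.

Let H1_bounded suf : all (@good R) suf -> bounded (H1 suf).
Proof.
move=> gs; apply: cols_bounded => // s.
by exists 1 => k; rewrite normr1.
Qed.

Let end_q k : H1 [::] k *m q = kap [::] k.
Proof.
have [kN|Nk] := ltnP k N; last first.
  rewrite kap_end//; apply/rowP => c; rewrite !mxE big1// => j _; rewrite !mxE.
  case: eqP => [e|_]; last by rewrite mul0r.
  by exfalso; move: Nk e (ltn_ord j); lia.
have kN' : (N - k.+1 < N)%N by move: kN; lia.
apply/rowP => c; rewrite !mxE (bigD1 (Ordinal kN'))//= big1 ?addr0 => [|j ne].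
  by rewrite !mxE/= (_ : (N - (N - k.+1).+1 = k)%N) ?eqxx ?mul1r//; move: kN; lia.
rewrite !mxE; case: eqP => [e|_]; last by rewrite mul0r.
case/eqP: ne; apply: val_inj => /=; move: kN e (ltn_ord j); lia.
Qed.

(* Both sides follow the same recurrences along the word: the jump of [kap] at
   an observation accounts for the source that the weight adds there. *)
Let dressed suf : (exists pre, w = pre ++ suf) -> forall k,
  Hu suf k = H1 suf k *m (1%:M + q *m S) - kap suf k *m S.
Proof.
elim: suf => [|l suf IH] [pre wE].
  by move=> k; rewrite mulmxDr mulmx1 mulmxA end_q addrK.
have IHs : forall k, Hu suf k = H1 suf k *m (1%:M + q *m S) - kap suf k *m S.
  by apply: IH; exists (rcons pre l); rewrite cat_rcons.
have gl : all (@good R) (l :: suf) by move: wgood; rewrite wE all_cat => /andP[].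
have /andP[gl1 gs] := gl.
have := kap_step wE; case: l {IH} wE gl gl1 => [x|y|s] wE gl gl1 /=.
- move=> [tK KE].
  apply: (@up_uniq _ _ x (fun k => H1 (Up x :: suf) k *m (1%:M + q *m S) - kap (Up x :: suf) k *m S) (Hu suf)).
    by apply: tameB; apply: tame_mulmx => //; exact: H1_tame.
  move=> k; rewrite IHs {1}/H1 /= upE//; last exact: H1_bounded.
  rewrite {1}KE !mulmxDl -!scalemxAl scalerBr /H1 /=.
  by rewrite opprD addrACA.
- move=> [K0 KE].
  apply: (@down_uniq _ _ y (fun k => H1 (Down y :: suf) k *m (1%:M + q *m S) - kap (Down y :: suf) k *m S) (Hu suf)).
    by rewrite IHs {1}/H1 /= down0 K0.
  move=> k; rewrite IHs {1}/H1 /= downS.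
  rewrite {1}KE !mulmxDl -!scalemxAl scalerBr /H1 /=.
  by rewrite opprD addrACA.
- move=> KE k; have -> : Hu (Obs s :: suf) k = obs_weight s k *: Hu suf k by [].
  rewrite IHs KE mulmxBl [obs_weight s k]/obs_weight scalerDl scale1r.
  have -> : H1 (Obs s :: suf) k = H1 suf k by rewrite /H1 /= scale1r.
  rewrite opprB addrA addrAC; congr (_ + _).
  rewrite mulmx_suml scaler_suml; apply: eq_bigr => c /andP[/eqP ac /eqP bc].
  by rewrite -rowE rowK -IHs ac bc (after_obs wE).
Qed.

(* Once the observation of [c] has passed, column [c] of [kap] has no jump left,
   so it follows the recurrences of [H1], and at the end the two agree by the
   choice of [q]. *)
Let bare suf c : (exists pre, w = pre ++ suf) -> ~~ has (is_obs (a c)) suf -> forall k,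
  (H1 suf k *m q) 0 c = kap suf k 0 c.
Proof.
elim: suf => [|l suf IH] [pre wE] hs; first by move=> k; rewrite end_q.
have [hl hs'] : ~~ is_obs (a c) l /\ ~~ has (is_obs (a c)) suf by move: hs => /= /norP.
have IHs : forall k, (H1 suf k *m q) 0 c = kap suf k 0 c.
  by apply: IH => //; exists (rcons pre l); rewrite cat_rcons.
have gl : all (@good R) (l :: suf) by move: wgood; rewrite wE all_cat => /andP[].
have /andP[gl1 gs] := gl.
have := kap_step wE; case: l {IH} wE gl gl1 hl hs => [x|y|s] wE gl gl1 hl hs /=.
- move=> [tK KE] k; apply/eqP; rewrite -subr_eq0; apply/eqP.
  pose G k : 'rV[R]_1 := (H1 (Up x :: suf) k *m q) *m delta_mx c 0 - kap (Up x :: suf) k *m delta_mx c 0.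
  have GE j : G j 0 0 = (H1 (Up x :: suf) j *m q) 0 c - kap (Up x :: suf) j 0 c.
    by rewrite /G -!colE !mxE.
  have tG : tame x G.
    by apply: tameB; apply: tame_mulmx => //; apply: tame_mulmx; exact: H1_tame.
  have := tame_fixed0 tG _ k; rewrite -GE => ->; rewrite ?mxE// => j.
  apply/rowP => i; rewrite ord1 [RHS]mxE !GE {1}/H1 /= upE//; last exact: H1_bounded.
  rewrite mulmxDl -scalemxAl addZmxE [X in X + _ - _](IHs j) KE addZmxE /H1 /=; ring.
- move=> [K0 KE]; elim=> [|k IHk].
    by rewrite K0 -IHs /H1 /= down0.
  rewrite KE {1}/H1 /= downS mulmxDl -scalemxAl !addZmxE.
  by rewrite [X in X + _](IHs k.+1) [X in _ + _ * X]IHk.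
- move=> KE k; rewrite KE /H1 /= scale1r [LHS]IHs !mxE summxE big1 ?subr0// => c' /andP[/eqP ac' _].
  rewrite mxE /=; case: eqVneq => // e; move: hl; rewrite /= -ac' e eqxx//.
Qed.

(** At the start [kap] vanishes on the occupied sites, so [dressed] multiplies
    the minor by [det (1 + q S) = det (1 + S q)]. Evaluating [dressed] at the
    observed sites, with [Psi] the rows of [H1] there and [Kr] those of [kap],
    gives a linear equation for [S], which amounts to
    [(1 + U Kr - U Psi q) (1 + S q) = 1 + U Kr]. By [bare] the first factor
    differs from 1 only at pairs of points in increasing order of time, so that
    its determinant is 1. *)
Theorem det_cols_obs :
  minor (cols N obs_weight w) empty_part = minor (cols N one w) empty_part *
    \det (1%:M + \matrix_(r, c) (u r * kap (after (a r) w) (b r) 0 c)).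
Proof.
have -> : minor (cols N obs_weight w) empty_part =
    minor (cols N one w) empty_part * \det (1%:M + q *m S).
  rewrite /minor -det_mulmx; congr (\det _); apply/row_matrixP => i.
  rewrite rowK row_mul rowK [LHS](dressed _) ?kap_start ?mul0mx ?subr0//; last by exists [::].
  by rewrite /site /part nth_nil add0n; move: (ltn_ord i); lia.
congr (_ * _); rewrite det_1addC.
pose Psi : 'M[R]_(d, N) := \matrix_r H1 (after (a r) w) (b r).
pose Kr : 'M[R]_d := \matrix_r kap (after (a r) w) (b r).
pose U : 'M[R]_d := diag_mx (\row_r u r).
have SE : S = U *m (Psi *m (1%:M + q *m S) - Kr *m S).
  apply/row_matrixP => r; rewrite rowK row_mul row_diag_mx mxE -scalemxAl -rowE; congr (_ *: _).
  rewrite dressed; last exact: after_suffix.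
  by apply/rowP => j; rewrite linearB/= !row_mul !rowK.
have -> : 1%:M + \matrix_(r, c) (u r * kap (after (a r) w) (b r) 0 c) = 1%:M + U *m Kr.
  by congr (_ + _); apply/matrixP => r c; rewrite mul_diag_mx !mxE.
have e : (1%:M + (U *m Kr - U *m (Psi *m q))) *m (1%:M + S *m q) = 1%:M + U *m Kr.
  have SqE : S *m q = U *m (Psi *m q) *m (1%:M + S *m q) - U *m Kr *m (S *m q).
    have h : (1%:M + q *m S) *m q = q *m (1%:M + S *m q).
      by rewrite mulmxDl mulmxDr mul1mx mulmx1 mulmxA.
    by rewrite {1}SE -mulmxA mulmxBl -!mulmxA h mulmxBr.
  rewrite mulmxDl mul1mx mulmxBl (mulmxDr (U *m Kr)) mulmx1.
  set A := U *m (Psi *m q) *m _ in SqE *; set B := U *m Kr *m (S *m q) in SqE *.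
  by rewrite SqE -addrA; congr (_ + _); rewrite addrC addrA subrK addrK.
rewrite -e det_mulmx (@det_1add_increasing _ _ a (U *m Kr - U *m (Psi *m q))) ?mul1r// => r c.
case hs : (has (is_obs (a c)) (after (a r) w)); first by move=> _; exact: obs_order.
rewrite -mulmxBr mul_diag_mx !mxE; case/eqP; apply/eqP; rewrite mulf_eq0; apply/orP; right.
rewrite subr_eq0; apply/eqP; rewrite -(@bare (after (a r) w) c) ?hs//; last exact: after_suffix.
by rewrite /Psi !mxE; apply: eq_bigr => j _; rewrite !mxE.
Qed.

End Resolvent.

(** * Integrals over a circle *)

Import ComplexField.Normc.

Section CircleIntegral.
Variable R : realType.
Implicit Types (g : R -> R) (h k : R -> R[i]) (f : R[i] -> R[i]) (r t c : R) (z w : R[i]).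
Local Notation mu := (@lebesgue_measure R).
Local Notation Re := complex.Re.
Local Notation Im := complex.Im.

Lemma cReD z w : Re (z + w) = Re z + Re w. Proof. by case: z w => [? ?] [? ?]. Qed.
Lemma cImD z w : Im (z + w) = Im z + Im w. Proof. by case: z w => [? ?] [? ?]. Qed.
Lemma cReM z w : Re (z * w) = Re z * Re w - Im z * Im w.
Proof. by case: z w => [? ?] [? ?]. Qed.
Lemma cImM z w : Im (z * w) = Re z * Im w + Im z * Re w.
Proof. by case: z w => [? ?] [? ?]. Qed.
Lemma cReV z : Re z^-1 = Re z / (Re z ^+ 2 + Im z ^+ 2).
Proof. by case: z. Qed.
Lemma cImV z : Im z^-1 = - (Im z / (Re z ^+ 2 + Im z ^+ 2)).
Proof. by case: z. Qed.
Lemma complex_eq z w : Re z = Re w -> Im z = Im w -> z = w.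
Proof. by case: z w => [? ?] [? ?] /= -> ->. Qed.

Lemma normc_sqrt z : normc z = Num.sqrt (Re z ^+ 2 + Im z ^+ 2). Proof. by case: z. Qed.
Lemma normc_ge0 z : 0 <= normc z. Proof. by rewrite normc_sqrt sqrtr_ge0. Qed.
Lemma Re_le_normc z : `|Re z| <= normc z.
Proof. by rewrite normc_sqrt -sqrtr_sqr ler_wsqrtr// lerDl sqr_ge0. Qed.
Lemma Im_le_normc z : `|Im z| <= normc z.
Proof. by rewrite normc_sqrt -sqrtr_sqr ler_wsqrtr// lerDr sqr_ge0. Qed.
Lemma normc_le z : normc z <= `|Re z| + `|Im z|.
Proof.
have -> : `|Re z| + `|Im z| = Num.sqrt ((`|Re z| + `|Im z|) ^+ 2).
  by rewrite sqrtr_sqr [RHS]ger0_norm ?addr_ge0.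
rewrite normc_sqrt ler_wsqrtr// sqrrD !real_normK ?num_real// -addrA lerD2l lerDr.
by rewrite mulrn_wge0// mulr_ge0.
Qed.

Lemma continuous_integrable g : continuous g -> mu.-integrable `[0, 2 * pi] (EFin \o g).
Proof.
move=> cg; apply: continuous_compact_integrable; first exact: segment_compact.
exact: continuous_subspaceT.
Qed.

(** Continuity of a complex-valued function of the angle, by components, in the
    form that the integrals of real functions require. *)
Definition ccont h := continuous (fun t => Re (h t)) /\ continuous (fun t => Im (h t)).

Definition cint h : R[i] :=
  (\int[mu]_(t in `[0, 2 * pi]) Re (h t)) +i* (\int[mu]_(t in `[0, 2 * pi]) Im (h t)).

Lemma ccont_cst z : ccont (fun=> z).
Proof. by split => x; exact: cvg_cst. Qed.

Lemma ccontD h k : ccont h -> ccont k -> ccont (fun t => h t + k t).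
Proof.
move=> [h1 h2] [k1 k2]; split => t.
  by under eq_fun do rewrite cReD; rewrite ?cReD; apply: cvgD; [exact: h1|exact: k1].
by under eq_fun do rewrite cImD; rewrite ?cImD; apply: cvgD; [exact: h2|exact: k2].
Qed.

Lemma ccontM h k : ccont h -> ccont k -> ccont (fun t => h t * k t).
Proof.
move=> [h1 h2] [k1 k2]; split => t.
  under eq_fun do rewrite cReM; rewrite ?cReM; apply: cvgB; apply: cvgM.
  - exact: h1. - exact: k1. - exact: h2. - exact: k2.
under eq_fun do rewrite cImM; rewrite ?cImM; apply: cvgD; apply: cvgM.
- exact: h1. - exact: k2. - exact: h2. - exact: k1.
Qed.

Lemma ccontN h : ccont h -> ccont (fun t => - h t).
Proof.
move=> ch; have := ccontM (ccont_cst (-1)) ch.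
by under eq_fun do rewrite mulN1r.
Qed.

Lemma sqr_neq0 z : z != 0 -> Re z ^+ 2 + Im z ^+ 2 != 0.
Proof.
case: z => a b /=; apply: contra; rewrite paddr_eq0 ?sqr_ge0// !sqrf_eq0.
by move=> /andP[/eqP -> /eqP ->].
Qed.

Lemma ccontV h : (forall t, h t != 0) -> ccont h -> ccont (fun t => (h t)^-1).
Proof.
move=> h0 [h1 h2].
have sq : continuous (fun t => Re (h t) ^+ 2 + Im (h t) ^+ 2).
  by move=> t; apply: cvgD; apply: cvgM; (exact: h1 || exact: h2).
have sqV : continuous (fun t => (Re (h t) ^+ 2 + Im (h t) ^+ 2)^-1).
  by move=> t; apply: cvgV; [exact: sqr_neq0|exact: sq].
split => t.
  under eq_fun do rewrite cReV; rewrite ?cReV; apply: cvgM; [exact: h1|exact: sqV].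
under eq_fun do rewrite cImV; rewrite ?cImV; apply: cvgN; apply: cvgM; [exact: h2|exact: sqV].
Qed.

(** For the continuity of an integral in its parameter, which enters the
    integrand through a Lipschitz bound. *)
Lemma ccont_lip h k c : ccont k ->
  (forall t t', normc (h t - h t') <= c * normc (k t - k t')) -> ccont h.
Proof.
move=> [k1 k2] lip.
have c0 t t' : 0 <= c * normc (k t - k t') by rewrite (le_trans _ (lip t t'))// normc_ge0.
have main (p : R[i] -> R) : (forall z w, `|p z - p w| <= normc (z - w)) ->
    continuous (fun t => p (h t)).
  move=> pn t; apply/cvgrPdist_le => e e0.
  have c1 : 0 < `|c| + 1 by rewrite ltr_wpDl.
  have e2 : 0 < e / (`|c| + 1) / 2 by rewrite !divr_gt0.
  have /cvgrPdist_le/(_ _ e2) n1 := k1 t; have /cvgrPdist_le/(_ _ e2) n2 := k2 t.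
  near=> t'.
  rewrite (le_trans (pn _ _))// (le_trans (lip _ _))//.
  rewrite (@le_trans _ _ ((`|c| + 1) * normc (k t - k t')))//.
    by rewrite ler_wpM2r ?normc_ge0// (le_trans (ler_norm _))// lerDl.
  rewrite -ler_pdivlMl// mulrC (le_trans (normc_le _))//.
  rewrite [X in _ <= X](splitr (e / (`|c| + 1))) lerD//.
    have : `|Re (k t) - Re (k t')| <= e / (`|c| + 1) / 2 by near: t'.
    by case: (k t) (k t') => [? ?] [? ?].
  have : `|Im (k t) - Im (k t')| <= e / (`|c| + 1) / 2 by near: t'.
  by case: (k t) (k t') => [? ?] [? ?].
split; apply: main => z w.
  by rewrite (le_trans _ (Re_le_normc _))//; case: z w => [? ?] [? ?].
by rewrite (le_trans _ (Im_le_normc _))//; case: z w => [? ?] [? ?].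
Unshelve. all: by end_near. Qed.

Lemma eq_cint h k : h =1 k -> cint h = cint k.
Proof. by move=> /funext ->. Qed.

Lemma cintD h k : ccont h -> ccont k -> cint (fun t => h t + k t) = cint h + cint k.
Proof.
move=> [h1 h2] [k1 k2]; apply: complex_eq => /=.
  by under eq_Rintegral do rewrite cReD; rewrite RintegralD//; exact: continuous_integrable.
by under eq_Rintegral do rewrite cImD; rewrite RintegralD//; exact: continuous_integrable.
Qed.

Lemma cintZ z h : ccont h -> cint (fun t => z * h t) = z * cint h.
Proof.
move=> [h1 h2]; have i1 := continuous_integrable h1; have i2 := continuous_integrable h2.
have cM c g : continuous g -> mu.-integrable `[0, 2 * pi] (EFin \o (fun t => c * g t)).
  by move=> cg; apply: continuous_integrable => t; apply: cvgM; [exact: cvg_cst|exact: cg].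
case: z => a b; apply: complex_eq => /=.
  under eq_Rintegral do rewrite cReM/=.
  by rewrite RintegralB ?RintegralZl//; exact: cM.
under eq_Rintegral do rewrite cImM/=.
by rewrite RintegralD ?RintegralZl//; exact: cM.
Qed.

Lemma Rint_bound g c : continuous g -> (forall t, `|g t| <= c) ->
  `|\int[mu]_(t in `[0, 2 * pi]) g t| <= c * (2 * pi).
Proof.
move=> cg gc.
have ig := continuous_integrable cg.
apply: (le_trans (le_normr_Rintegral _ ig)) => //.
have -> : c * (2 * pi) = \int[mu]_(t in `[0, 2 * pi]) c.
  rewrite Rintegral_cst//= lebesgue_measure_itv/= lte_fin mulr_gt0 ?pi_gt0//=.
  by rewrite subr0.
apply: le_Rintegral => //.
- by apply: (@continuous_integrable (fun t => `|g t|)) => t; apply: cvg_norm; exact: cg.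
- by apply: (@continuous_integrable (fun=> c)) => t; exact: cvg_cst.
Qed.

Lemma cint_bound h c : ccont h -> (forall t, normc (h t) <= c) ->
  normc (cint h) <= 4 * pi * c.
Proof.
move=> [h1 h2] hc; rewrite (le_trans (normc_le _))//=.
have b1 := Rint_bound h1 (fun t => le_trans (Re_le_normc _) (hc t)).
have b2 := Rint_bound h2 (fun t => le_trans (Im_le_normc _) (hc t)).
by rewrite (le_trans (lerD b1 b2))// le_eqVlt; apply/orP; left; apply/eqP; ring.
Qed.

(** * Monomials on a circle *)

Lemma circle_pt_ccont r : ccont (circle_pt r).
Proof.
by split => t /=; (apply: cvgM; first exact: cvg_cst); [exact: continuous_cos|exact: continuous_sin].
Qed.

Lemma normc_circle_pt r t : 0 <= r -> normc (circle_pt r t) = r.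
Proof.
move=> r0; rewrite normc_sqrt /= !exprMn -mulrDr cos2Dsin2 mulr1 sqrtr_sqr ger0_norm//.
Qed.

Lemma circle_pt_neq0 r t : 0 < r -> circle_pt r t != 0.
Proof.
move=> r0; apply/negP => /eqP e; have := normc_circle_pt t (ltW r0).
by rewrite e normc0 => e0; move: r0; rewrite -e0 ltxx.
Qed.

Lemma normc_exprz z (m : int) : normc (z ^ m) = normc z ^ m.
Proof.
have nat_case (n : nat) : normc (z ^+ n) = normc z ^+ n.
  by elim: n => [|n IH]; rewrite ?expr0 ?normc1// !exprS normcM IH.
by case: m => n; rewrite ?NegzE -?exprnN ?normcV -?exprnP nat_case.
Qed.

Lemma circle_pt_expn r t (n : nat) :
  circle_pt r t ^+ n = circle_pt (r ^+ n) (n%:R * t).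
Proof.
elim: n => [|n IH].
  by rewrite !expr0 mul0r /circle_pt cos0 sin0 mulr1 mulr0.
rewrite exprS IH exprS /circle_pt -[n.+1]addn1 natrD mulrDl mul1r cosD sinD.
by apply: complex_eq => /=; ring.
Qed.

Lemma circle_ptV r t : 0 < r -> (circle_pt r t)^-1 = circle_pt r^-1 (- t).
Proof.
move=> r0; have rn : r != 0 by rewrite gt_eqF.
apply: complex_eq; rewrite /= ?cosN ?sinN !exprMn -mulrDr cos2Dsin2 mulr1; by field.
Qed.

Lemma circle_pt_exprz r t (m : int) : 0 < r ->
  circle_pt r t ^ m = circle_pt (r ^ m) (m%:~R * t).
Proof.
move=> r0; case: m => n; first by rewrite -!exprnP circle_pt_expn.
rewrite NegzE -!exprnN circle_pt_expn circle_ptV ?exprn_gt0// mulrNz mulNr.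
by rewrite -[n.+1%:~R]/(n.+1%:R).
Qed.

Lemma int_cos_sin (m : int) : m != 0 ->
  \int[mu]_(t in `[0, 2 * pi]) cos (m%:~R * t) = 0 /\
  \int[mu]_(t in `[0, 2 * pi]) sin (m%:~R * t) = 0.
Proof.
move=> m0; have mr : (m%:~R : R) != 0 by rewrite intr_eq0.
have pos : 0 < 2 * pi :> R by rewrite mulr_gt0 ?pi_gt0.
have cl : continuous (fun t : R => m%:~R * t).
  by move=> t; apply: cvgM; [exact: cvg_cst|exact: cvg_id].
have cs : continuous (fun t : R => sin (m%:~R * t)).
  by move=> t; apply: continuous_comp; [exact: cl|exact: continuous_sin].
have cc : continuous (fun t : R => cos (m%:~R * t)).
  by move=> t; apply: continuous_comp; [exact: cl|exact: continuous_cos].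
have per : cos (m%:~R * (2 * pi)) = 1 :> R /\ sin (m%:~R * (2 * pi)) = 0 :> R.
  have nat_case (n : nat) : cos (n%:R * (2 * pi)) = 1 :> R /\ sin (n%:R * (2 * pi)) = 0 :> R.
    have -> : n%:R * (2 * pi) = 0 + (pi *+ 2) *+ n :> R by rewrite add0r -mulrnA mulnC mulrnA -mulr_natl; ring.
    by rewrite (periodicn (@cosD2pi R)) (periodicn (@sinD2pi R)) cos0 sin0.
  case: m {m0 mr cl cs cc} => n; first exact: nat_case.
  rewrite NegzE mulrNz mulNr cosN sinN; have [-> e] := nat_case n.+1.
  by split => //; rewrite [sin _]e oppr0.
have FTC (F f : R -> R) : continuous f -> continuous F -> (forall t, is_derive t 1 F (f t)) ->
    F (2 * pi) = F 0 -> \int[mu]_(t in `[0, 2 * pi]) f t = 0.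
  move=> cf cF dF FF; rewrite /Rintegral (@continuous_FTC2 _ f F)//=.
  - by rewrite FF subrr.
  - exact: continuous_subspaceT.
  - split; first by move=> t _; exact: ex_derive.
      exact/cvg_at_right_filter/cF.
    exact/cvg_at_left_filter/cF.
  - by move=> t _; rewrite derive1E; apply: derive_val.
split.
- apply: (FTC (fun t => m%:~R^-1 * sin (m%:~R * t))) => //.
  + by move=> t; apply: cvgM; [exact: cvg_cst|exact: cs].
  + move=> t; apply: is_derive_eq; rewrite /GRing.scale/=; by field.
  + by rewrite (proj2 per) !mulr0 sin0 mulr0.
- apply: (FTC (fun t => - (m%:~R^-1 * cos (m%:~R * t)))) => //.
  + by move=> t; apply: cvgN; apply: cvgM; [exact: cvg_cst|exact: cc].
  + move=> t; apply: is_derive_eq; rewrite /GRing.scale/=; by field.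
  + by rewrite (proj1 per) !mulr0 cos0.
Qed.

Lemma cint_exprz r (m : int) : 0 < r ->
  cint (fun t => circle_pt r t ^ m) = if m == 0 then (2 * pi)%:C else 0.
Proof.
move=> r0; case: eqVneq => [->|m0].
  under eq_cint do rewrite expr0z.
  rewrite /cint /= !Rintegral_cst//= lebesgue_measure_itv/= lte_fin mulr_gt0 ?pi_gt0//=.
  by rewrite subr0 mul1r mul0r.
have [ic is_] := int_cos_sin m0.
under eq_cint do rewrite circle_pt_exprz//.
have cl : continuous (fun t : R => m%:~R * t).
  by move=> t; apply: cvgM; [exact: cvg_cst|exact: cvg_id].
apply: complex_eq => /=; rewrite RintegralZl ?ic ?is_ ?mulr0//.
- apply: (@continuous_integrable (fun t => cos (m%:~R * t))) => t.
  by apply: continuous_comp; [exact: cl|exact: continuous_cos].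
- apply: (@continuous_integrable (fun t => sin (m%:~R * t))) => t.
  by apply: continuous_comp; [exact: cl|exact: continuous_sin].
Qed.

End CircleIntegral.

(** * Cauchy double integrals *)

Section DoubleIntegral.
Variable R : realType.
Implicit Types (f g : R[i] -> R[i]) (r t : R) (c z w : R[i]).

Definition ok_on r f := ccont (fun t => f (circle_pt r t)).
Definition bnd_on r f (C : R) := forall t, normc (f (circle_pt r t)) <= C.

Lemma ok_circle r f : ok_on r f -> ccont (fun t => f (circle_pt r t) * ('i%C * circle_pt r t)).
Proof.
by move=> cf; apply: ccontM => //; apply: ccontM; [exact: ccont_cst|exact: circle_pt_ccont].
Qed.

Lemma ok_onM r f g : ok_on r f -> ok_on r g -> ok_on r (fun z => f z * g z).
Proof. exact: ccontM. Qed.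

Lemma ok_onB r f g : ok_on r f -> ok_on r g -> ok_on r (fun z => f z - g z).
Proof. by move=> cf cg; apply: ccontD => //; exact: ccontN. Qed.

Lemma ok_on_cst r c : ok_on r (fun=> c).
Proof. exact: ccont_cst. Qed.

Lemma ok_on_id r : ok_on r id.
Proof. exact: circle_pt_ccont. Qed.

Lemma ok_onV r f : (forall t, f (circle_pt r t) != 0) -> ok_on r f -> ok_on r (fun z => (f z)^-1).
Proof. exact: ccontV. Qed.

Lemma ok_on_exprz r (m : int) : 0 < r -> ok_on r (fun z => z ^ m).
Proof.
move=> r0; have nat_case (n : nat) : ok_on r (fun z => z ^+ n).
  elim: n => [|n IH]; first by under [X in ok_on r X]eq_fun do rewrite expr0; exact: ok_on_cst.
  under [X in ok_on r X]eq_fun do rewrite exprS.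
  by apply: (@ok_onM r id) => //; exact: ok_on_id.
case: m => n; first exact: nat_case.
apply: (@ok_onV r (fun z => z ^+ n.+1)); last exact: nat_case.
by move=> t; rewrite expf_neq0// circle_pt_neq0.
Qed.

Lemma circle_integralE r f :
  circle_integral r f = cint (fun t => f (circle_pt r t) * ('i%C * circle_pt r t)).
Proof. by []. Qed.

Lemma eq_circle_integral r f g : (forall t, f (circle_pt r t) = g (circle_pt r t)) ->
  circle_integral r f = circle_integral r g.
Proof. by move=> e; rewrite !circle_integralE; apply: eq_cint => t; rewrite e. Qed.

Lemma circle_integralZ r c f : ok_on r f ->
  circle_integral r (fun z => c * f z) = c * circle_integral r f.
Proof.
move=> cf; rewrite !circle_integralE -cintZ; last exact: ok_circle.
by apply: eq_cint => t; rewrite -mulrA.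
Qed.

Lemma circle_integralB r f g : ok_on r f -> ok_on r g ->
  circle_integral r (fun z => f z - g z) = circle_integral r f - circle_integral r g.
Proof.
move=> cf cg; rewrite !circle_integralE.
transitivity (cint (fun t => f (circle_pt r t) * ('i%C * circle_pt r t) +
    (-1) * (g (circle_pt r t) * ('i%C * circle_pt r t)))).
  by apply: eq_cint => t; rewrite mulrBl mulN1r.
have cg' := ok_circle cg; rewrite cintD; last 2 first.
- exact: ok_circle.
- by apply: ccontM => //; exact: ccont_cst.
by rewrite cintZ// mulN1r.
Qed.

Lemma normci : normc ('i%C : R[i]) = 1.
Proof. by rewrite /= expr0n/= add0r expr1n sqrtr1. Qed.

Lemma circle_integral_bound r f (C : R) : 0 <= r -> ok_on r f -> bnd_on r f C ->
  normc (circle_integral r f) <= 4 * pi * (C * r).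
Proof.
move=> r0 cf bf; rewrite circle_integralE; apply: cint_bound; first exact: ok_circle.
move=> t; rewrite !normcM normc_circle_pt// normci mul1r.
by rewrite ler_wpM2r.
Qed.

Lemma circle_integral_exprz r (m : int) : 0 < r ->
  circle_integral r (fun z => z ^ m) = if m == -1 then 'i%C * (2 * pi)%:C else 0.
Proof.
move=> r0; rewrite circle_integralE.
transitivity (cint (fun t => 'i%C * circle_pt r t ^ (m + 1))).
  apply: eq_cint => t; rewrite exprzDr ?unitfE ?circle_pt_neq0// expr1z.
  by rewrite mulrCA.
rewrite cintZ; last exact: (@ok_on_exprz r (m + 1) r0).
by rewrite cint_exprz// addr_eq0; case: eqP; rewrite ?mulr0.
Qed.

Lemma normc_triangle z w : normc (z + w) <= normc z + normc w.
Proof. exact: (@le_normcD R z w). Qed.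

Lemma normc_subC z w : normc (z - w) = normc (w - z).
Proof. by rewrite -opprB; exact: (@normcN R (w - z)). Qed.

Section Kernel.
Variables (r1 r2 : R).
Hypotheses (r1_gt0 : 0 < r1) (r2_gt0 : 0 < r2) (r12 : r1 != r2).

Lemma dist_gt0 : 0 < `|r2 - r1|.
Proof. by rewrite normr_gt0 subr_eq0 eq_sym. Qed.

Lemma dist_le t z : normc z = r1 -> `|r2 - r1| <= normc (circle_pt r2 t - z).
Proof.
move=> nz; have -> : r2 - r1 = normc (circle_pt r2 t) - normc z.
  by rewrite nz normc_circle_pt// ltW.
have := normc_triangle (circle_pt r2 t - z) z; rewrite subrK => h1.
have h2 : normc z <= normc (circle_pt r2 t - z) + normc (circle_pt r2 t).
  by rewrite normc_subC; have := normc_triangle (z - circle_pt r2 t) (circle_pt r2 t); rewrite subrK.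
by rewrite ler_norml; apply/andP; split; lra.
Qed.

Lemma den_neq0 t z : normc z = r1 -> circle_pt r2 t - z != 0.
Proof.
move=> nz; apply/eqP => e; have := dist_le t nz.
by rewrite e normc0 leNgt dist_gt0.
Qed.

Lemma denV_ok z : normc z = r1 -> ok_on r2 (fun w => (w - z)^-1).
Proof.
move=> nz; apply: (@ok_onV r2 (fun w => w - z)); first by move=> t; exact: den_neq0.
by apply: (@ok_onB r2 id); [exact: ok_on_id|exact: ok_on_cst].
Qed.

Lemma denV_bound t z : normc z = r1 -> normc (circle_pt r2 t - z)^-1 <= `|r2 - r1|^-1.
Proof.
move=> nz; rewrite normcV lef_pV2 ?dist_le ?posrE ?dist_gt0//.
exact: lt_le_trans dist_gt0 (dist_le t nz).
Qed.

(** The inner integral, a Cauchy transform on the [w]-circle. *)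
Definition hin g z := circle_integral r2 (fun w => (w - z)^-1 * g w).

Lemma hin_bound g (C : R) z : ok_on r2 g -> bnd_on r2 g C -> normc z = r1 ->
  normc (hin g z) <= 4 * pi * (`|r2 - r1|^-1 * C * r2).
Proof.
move=> cg bg nz; apply: circle_integral_bound; first exact: ltW.
  by apply: ok_onM => //; exact: denV_ok.
by move=> t; rewrite normcM; apply: ler_pM; rewrite ?normc_ge0 ?denV_bound//; exact: bg.
Qed.

(** The resolvent identity
    [(w - z)^-1 - (w - z')^-1 = (z - z') (w - z)^-1 (w - z')^-1] gives a
    Lipschitz bound. *)
Lemma hin_ok g (C : R) : ok_on r2 g -> bnd_on r2 g C -> ok_on r1 (hin g).
Proof.
move=> cg bg; have np t := normc_circle_pt t (ltW r1_gt0).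
apply: (@ccont_lip _ _ (circle_pt r1) (4 * pi * (`|r2 - r1|^-1 * `|r2 - r1|^-1 * C * r2))).
  exact: circle_pt_ccont.
move=> t t'; set z := circle_pt r1 t; set z' := circle_pt r1 t'.
have nz : normc z = r1 by exact: np.
have nz' : normc z' = r1 by exact: np.
have -> : hin g z - hin g z' =
    (z - z') * circle_integral r2 (fun w => (w - z)^-1 * (w - z')^-1 * g w).
  rewrite /hin -circle_integralB; do ?by apply: ok_onM => //; exact: denV_ok.
  rewrite -circle_integralZ; last first.
    by apply: ok_onM => //; apply: ok_onM; exact: denV_ok.
  apply: eq_circle_integral => s; have d0 := den_neq0 s nz; have d0' := den_neq0 s nz'.
  by field; rewrite d0 d0'.
rewrite normcM mulrC ler_wpM2r ?normc_ge0//.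
apply: circle_integral_bound; first exact: ltW.
  by apply: ok_onM => //; apply: ok_onM; exact: denV_ok.
move=> s; rewrite !normcM; apply: ler_pM.
- by rewrite mulr_ge0 ?normc_ge0.
- exact: normc_ge0.
- by apply: ler_pM; rewrite ?normc_ge0 ?denV_bound.
- exact: bg.
Qed.

Lemma hinB g g' c z : ok_on r2 g -> ok_on r2 g' -> normc z = r1 ->
  hin (fun w => g w - c * g' w) z = hin g z - c * hin g' z.
Proof.
move=> cg cg' nz; have dV := denV_ok nz.
rewrite /hin -circle_integralZ; last exact: ok_onM.
rewrite -circle_integralB; last 2 first.
- exact: ok_onM.
- by apply: ok_onM; [exact: ok_on_cst|exact: ok_onM].
by apply: eq_circle_integral => t; rewrite mulrBr mulrCA.
Qed.

Definition dint f g := circle_integral r1 (fun z =>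
  circle_integral r2 (fun w => (w - z)^-1 * (f z * g w))).

Lemma dintE f g : ok_on r2 g -> dint f g = circle_integral r1 (fun z => f z * hin g z).
Proof.
move=> cg; apply: eq_circle_integral => t; rewrite /hin -circle_integralZ; last first.
  by apply: ok_onM => //; apply: denV_ok; rewrite normc_circle_pt// ltW.
by apply: eq_circle_integral => s; rewrite mulrCA.
Qed.

Lemma eq_dint f f' g g' : (forall t, f (circle_pt r1 t) = f' (circle_pt r1 t)) ->
  (forall t, g (circle_pt r2 t) = g' (circle_pt r2 t)) -> dint f g = dint f' g'.
Proof.
move=> ef eg; apply: eq_circle_integral => t; apply: eq_circle_integral => s.
by rewrite ef eg.
Qed.

Lemma dintBl f f' g c (C : R) : ok_on r1 f -> ok_on r1 f' -> ok_on r2 g -> bnd_on r2 g C ->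
  dint (fun z => f z - c * f' z) g = dint f g - c * dint f' g.
Proof.
move=> cf cf' cg bg; rewrite !dintE//; have ch := hin_ok cg bg.
rewrite -circle_integralZ; last exact: ok_onM.
rewrite -circle_integralB; last 2 first.
- exact: ok_onM.
- by apply: ok_onM; [exact: ok_on_cst|exact: ok_onM].
by apply: eq_circle_integral => t; rewrite mulrBl mulrA.
Qed.

Lemma dintBr f g g' c (C C' : R) : ok_on r1 f -> ok_on r2 g -> ok_on r2 g' ->
  bnd_on r2 g C -> bnd_on r2 g' C' ->
  dint f (fun w => g w - c * g' w) = dint f g - c * dint f g'.
Proof.
move=> cf cg cg' bg bg'; rewrite !dintE//; last first.
  by apply: ok_onB => //; apply: ok_onM => //; exact: ok_on_cst.
have ch := hin_ok cg bg; have ch' := hin_ok cg' bg'.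
rewrite -circle_integralZ; last exact: ok_onM.
rewrite -circle_integralB; last 2 first.
- exact: ok_onM.
- by apply: ok_onM; [exact: ok_on_cst|exact: ok_onM].
apply: eq_circle_integral => t; rewrite hinB ?normc_circle_pt ?ltW//.
by rewrite mulrBr mulrCA.
Qed.

Lemma dint_bound f g (C C' : R) : ok_on r1 f -> ok_on r2 g -> 0 <= C ->
  bnd_on r1 f C -> bnd_on r2 g C' ->
  normc (dint f g) <= 4 * pi * (C * (4 * pi * (`|r2 - r1|^-1 * C' * r2)) * r1).
Proof.
move=> cf cg C0 bf bg; rewrite dintE//; apply: circle_integral_bound; first exact: ltW.
  by apply: ok_onM => //; exact: hin_ok bg.
move=> t; rewrite normcM; apply: ler_pM; do ?exact: normc_ge0.
- exact: bf.
- by apply: hin_bound => //; rewrite normc_circle_pt// ltW.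
Qed.

Let exprz_ok m : ok_on r2 (fun w => w ^ m).
Proof. exact: ok_on_exprz. Qed.

Let exprz_bnd m : bnd_on r2 (fun w => w ^ m) (r2 ^ m).
Proof. by move=> t; rewrite normc_exprz normc_circle_pt// ltW. Qed.

(** Since [w ^ (m + 1) - z w ^ m = w ^ m (w - z)], the denominator cancels. *)
Lemma hin_exprz_rec z m : normc z = r1 ->
  hin (fun w => w ^ (m + 1)) z - z * hin (fun w => w ^ m) z =
  if m == -1 then 'i%C * (2 * pi)%:C else 0.
Proof.
move=> nz; rewrite -(circle_integral_exprz m r2_gt0) -hinB//.
apply: eq_circle_integral => t; have d := den_neq0 t nz.
rewrite exprzDr ?unitfE ?circle_pt_neq0// expr1z.
set w := circle_pt r2 t in d *; set W := w ^ m.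
by rewrite [W * w]mulrC -mulrBl mulKf.
Qed.

Lemma geom_bound_eq0 (q C x : R) : 0 <= q < 1 -> (forall n : nat, x <= C * q ^+ n) -> x <= 0.
Proof.
move=> /andP[q0 q1] h.
have cv : geometric C q @ \oo --> 0 by apply: cvg_geometric; rewrite ger0_norm.
by apply: (cvgr_to_ge cv); apply: nearW => n; exact: h.
Qed.

(** The recurrence in [m] leaves one free value, that at [m = 0]. It gives
    [hin (w ^ n) = z ^ n * hin 1] for [n >= 0], and the left side is
    [O(r2 ^ n)] with [r2 < normc z], so [hin 1 = 0]. *)
Lemma hin_exprz_inner z (m : int) : normc z = r1 -> r2 < r1 ->
  hin (fun w => w ^ m) z = if m < 0 then - ('i%C * (2 * pi)%:C * z ^ m) else 0.
Proof.
move=> nz lt; have z0 : z != 0.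
  by apply/eqP => e; move: nz r1_gt0; rewrite e normc0 => <-; rewrite ltxx.
have pos (n : nat) : hin (fun w => w ^ n%:Z) z = z ^+ n * hin (fun w => w ^ 0) z.
  elim: n => [|n IH]; first by rewrite expr0 mul1r.
  have := hin_exprz_rec n%:Z nz; rewrite IH (_ : n%:Z + 1 = n.+1%:Z); last by lia.
  have -> : (n%:Z == -1) = false by lia.
  by move=> /eqP; rewrite subr_eq0 exprS -mulrA => /eqP.
have h0 : hin (fun w => w ^ 0) z = 0.
  apply: eq0_normc; apply/eqP; rewrite eq_le normc_ge0 andbT.
  apply: (@geom_bound_eq0 (r2 / r1) (4 * pi * (`|r2 - r1|^-1 * r2))).
    by rewrite divr_ge0 ?ltW//= ltr_pdivrMr// mul1r.
  move=> n; have := hin_bound (exprz_ok n%:Z) (exprz_bnd n%:Z) nz.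
  have -> : hin (fun w => w ^ n%:Z) z = z ^ n%:Z * hin (fun w => w ^ 0) z by exact: pos.
  rewrite normcM normc_exprz nz -!exprnP => h.
  rewrite expr_div_n mulrA ler_pdivlMr ?exprn_gt0// mulrC (le_trans h)//.
  by rewrite le_eqVlt; apply/orP; left; apply/eqP; ring.
have neg (n : nat) : hin (fun w => w ^ (- n.+1%:Z)) z = - ('i%C * (2 * pi)%:C * z ^ (- n.+1%:Z)).
  elim: n => [|n IH].
    have := hin_exprz_rec (-1) nz; rewrite eqxx addNr h0 sub0r => <-.
    by rewrite -mulNr opprK mulrAC exprN1 mulfV// mul1r.
  have := hin_exprz_rec (- n.+2%:Z) nz.
  have -> : - n.+2%:Z + 1 = - n.+1%:Z by lia.
  rewrite IH; have -> : (- n.+2%:Z == -1) = false by lia.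
  move/eqP; rewrite subr_eq0 => /eqP e.
  apply: (mulfI z0); rewrite -e.
  have -> : z ^ (- n.+1%:Z) = z * z ^ (- n.+2%:Z).
    by rewrite -{2}(expr1z z) -exprzDr ?unitfE//; congr (_ ^ _); lia.
  by ring.
by case: m => n; [rewrite /= pos h0 mulr0|rewrite NegzE neg].
Qed.

(** Dually, the free value is that at [m = -1], and the growth of
    [hin (w ^ m)] as [m] tends to minus infinity shows that it is 0. *)
Lemma hin_exprz_outer z (m : int) : normc z = r1 -> r1 < r2 ->
  hin (fun w => w ^ m) z = if m < 0 then 0 else 'i%C * (2 * pi)%:C * z ^ m.
Proof.
move=> nz lt; have z0 : z != 0.
  by apply/eqP => e; move: nz r1_gt0; rewrite e normc0 => <-; rewrite ltxx.
have neg (n : nat) : z ^+ n * hin (fun w => w ^ (- n.+1%:Z)) z = hin (fun w => w ^ (- 1)) z.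
  elim: n => [|n IH]; first by rewrite expr0 mul1r.
  have := hin_exprz_rec (- n.+2%:Z) nz.
  have -> : - n.+2%:Z + 1 = - n.+1%:Z by lia.
  have -> : (- n.+2%:Z == -1) = false by lia.
  by move/eqP; rewrite subr_eq0 => /eqP e; rewrite exprSr -mulrA -e.
have h0 : hin (fun w => w ^ (-1)) z = 0.
  apply: eq0_normc; apply/eqP; rewrite eq_le normc_ge0 andbT.
  apply: (@geom_bound_eq0 (r1 / r2) (4 * pi * (`|r2 - r1|^-1))).
    by rewrite divr_ge0 ?ltW//= ltr_pdivrMr// mul1r.
  move=> n; have := hin_bound (exprz_ok (- n.+1%:Z)) (exprz_bnd (- n.+1%:Z)) nz.
  rewrite -(neg n) normcM (_ : normc (z ^+ n) = r1 ^+ n); last by rewrite [z ^+ n]exprnP normc_exprz nz.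
  move=> h; rewrite expr_div_n [X in _ <= X]mulrCA ler_wpM2l ?exprn_ge0 ?(ltW r1_gt0)// (le_trans h)//.
  rewrite -exprnN le_eqVlt; apply/orP; left; apply/eqP; rewrite exprS.
  by field; rewrite expf_neq0 ?gt_eqF ?dist_gt0.
have pos (n : nat) : hin (fun w => w ^ n%:Z) z = 'i%C * (2 * pi)%:C * z ^+ n.
  elim: n => [|n IH].
    by have := hin_exprz_rec (-1) nz; rewrite eqxx addNr h0 mulr0 subr0 expr0 mulr1 => <-.
  have := hin_exprz_rec n%:Z nz; rewrite IH (_ : n%:Z + 1 = n.+1%:Z); last by lia.
  have -> : (n%:Z == -1) = false by lia.
  by move=> /eqP; rewrite subr_eq0 => /eqP ->; rewrite exprS mulrCA.
case: m => n; [by rewrite pos|rewrite NegzE /=].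
by apply: (mulfI (expf_neq0 n z0)); rewrite neg h0 mulr0.
Qed.

Lemma dint_exprz (i j : int) :
  dint (fun z => z ^ (- j - 1)) (fun w => w ^ i) =
  (4 * pi ^+ 2)%:C * (if r2 < r1 then ((i == j) && (i < 0))%:R else - ((i == j) && (0 <= i))%:R).
Proof.
have np t := normc_circle_pt t (ltW r1_gt0).
have p0 t := circle_pt_neq0 t r1_gt0.
have sq : ('i%C * (2 * pi)%:C) * ('i%C * (2 * pi)%:C) = - (4 * pi ^+ 2)%:C :> R[i].
  by rewrite mulrACA -expr2 sqr_i mulN1r -rmorphM; congr (- _%:C); ring.
have mono : circle_integral r1 (fun z => z ^ (- j - 1) * z ^ i) =
    (i == j)%:R * ('i%C * (2 * pi)%:C).
  transitivity (circle_integral r1 (fun z => z ^ (i - j - 1))).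
    by apply: eq_circle_integral => t; rewrite -exprzDr ?unitfE//; congr (_ ^ _); lia.
  rewrite circle_integral_exprz//; have -> : (i - j - 1 == -1) = (i == j) by lia.
  by case: eqP; rewrite ?mul1r ?mul0r.
have mok : ok_on r1 (fun z => z ^ (- j - 1) * z ^ i).
  by apply: ok_onM; exact: ok_on_exprz.
have rhs : (4 * pi ^+ 2)%:C * (i == j)%:R =
    - ('i%C * (2 * pi)%:C) * circle_integral r1 (fun z => z ^ (- j - 1) * z ^ i).
  rewrite mono; move: ('i%C * (2 * pi)%:C) sq => c0 sq.
  by rewrite [RHS]mulNr [in RHS]mulrCA sq mulrN opprK mulrC.
rewrite dintE//; case: ltP => [lt|ge].
  case i0 : (i < 0); last first.
    rewrite andbF mulr0 -[RHS](mul0r (circle_integral r1 (fun z => z ^ (- j - 1) * z ^ i))).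
    rewrite -circle_integralZ//; apply: eq_circle_integral => t.
    by rewrite hin_exprz_inner// i0 mulr0 mul0r.
  rewrite andbT rhs -circle_integralZ//; apply: eq_circle_integral => t.
  by rewrite hin_exprz_inner// i0; ring.
have lt : r1 < r2 by rewrite lt_neqAle r12.
rewrite leNgt; case i0 : (i < 0) => /=.
  rewrite andbF oppr0 mulr0 -[RHS](mul0r (circle_integral r1 (fun z => z ^ (- j - 1) * z ^ i))).
  rewrite -circle_integralZ//; apply: eq_circle_integral => t.
  by rewrite hin_exprz_outer// i0 mulr0 mul0r.
rewrite andbT mulrN rhs mulNr opprK -circle_integralZ//; apply: eq_circle_integral => t.
by rewrite hin_exprz_outer// i0; ring.
Qed.

End Kernel.
End DoubleIntegral.

(** * Recurrences in the variables *)

Section Families.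
Variable R : realType.
Implicit Types (x y : R) (xs ys : seq R) (i j : int) (r : R) (z w : R[i]).

Definition decay x (V : nat -> R[i]) : Prop :=
  (fun n => x ^+ n * normc (V n)) @ \oo --> 0.

Lemma decayB x V W : 0 <= x -> decay x V -> decay x W -> decay x (fun n => V n - W n).
Proof.
move=> x0 dV dW; apply: (@squeeze_cvgr _ _ _ _ (cst 0)
    (fun n => x ^+ n * normc (V n) + x ^+ n * normc (W n))).
- apply: nearW => n; rewrite mulr_ge0 ?exprn_ge0 ?normc_ge0//= -mulrDr.
  rewrite ler_wpM2l ?exprn_ge0// (le_trans (normc_triangle _ _))// lerD2l.
  by rewrite -[X in normc X]sub0r normc_subC subr0.
- exact: cvg_cst.
- by rewrite -[0 in X in _ --> X]addr0; apply: cvgD.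
Qed.

Lemma decay_fixed0 x (V : nat -> R[i]) : decay x V ->
  (forall n, V n = x%:C * V n.+1) -> 0 <= x -> V 0%N = 0.
Proof.
move=> dV VE x0; apply: eq0_normc; apply/eqP; rewrite eq_le normc_ge0 andbT.
apply: (cvgr_to_ge dV); apply: nearW => n; rewrite le_eqVlt; apply/orP; left; apply/eqP.
elim: n => [|n IH]; first by rewrite expr0 mul1r.
by rewrite IH VE normcM exprSr /= expr0n/= addr0 sqrtr_sqr ger0_norm// mulrA.
Qed.

Lemma decay_geom x (V : nat -> R[i]) (C q : R) : 0 <= x -> 0 <= q -> x * q < 1 ->
  (forall n, normc (V n) <= C * q ^+ n) -> decay x V.
Proof.
move=> x0 q0 xq bV; apply: (@squeeze_cvgr _ _ _ _ (cst 0) (geometric C (x * q))).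
- apply: nearW => n; rewrite mulr_ge0 ?exprn_ge0 ?normc_ge0//=.
  by rewrite exprMn mulrCA ler_wpM2l ?exprn_ge0.
- exact: cvg_cst.
- by apply: cvg_geometric; rewrite ger0_norm// mulr_ge0.
Qed.

(** Arguments: the variables of the [z]-factor (first those that stand with
    [z], then those with [z^-1]), likewise those of the [w]-factor, and the
    indices of the powers of [z] and of [w]. *)
Definition kernels := seq R -> seq R -> seq R -> seq R -> int -> int -> R[i].
Implicit Type P : kernels.

Definition elems_in (D : R -> Prop) xs := forall x, x \in xs -> D x.

(** The relations express that the generating function is multiplied or divided
    by one binomial factor. Two of them determine the coefficients with one more
    variable only up to a geometric sequence, which the decay excludes. *)
Definition family (D : R -> Prop) P := forall xs ys xs' ys',
  elems_in D xs -> elems_in D ys -> elems_in D xs' -> elems_in D ys' ->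
  [/\ forall x j i, D x -> P (x :: xs) ys xs' ys' j i -
        x%:C * P (x :: xs) ys xs' ys' (j - 1) i = P xs ys xs' ys' j i,
      forall y j i, D y -> P xs (y :: ys) xs' ys' j i =
        P xs ys xs' ys' j i - y%:C * P xs ys xs' ys' (j + 1) i,
      forall x j i, D x -> P xs ys (x :: xs') ys' j i =
        P xs ys xs' ys' j i - x%:C * P xs ys xs' ys' j (i + 1),
      forall y j i, D y -> P xs ys xs' (y :: ys') j i -
        y%:C * P xs ys xs' (y :: ys') j (i - 1) = P xs ys xs' ys' j i
    & forall x j i, D x ->
        [/\ decay x (fun n => P xs ys xs' ys' (j - n%:Z) i),
            decay x (fun n => P xs ys xs' ys' j (i - n%:Z)) &
            decay x (fun n => P xs ys xs' ys' j (i + n%:Z))] ].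

Lemma elems_in_nil D : elems_in D [::]. Proof. by []. Qed.

Lemma elems_in_cons (D : R -> Prop) x xs : D x -> elems_in D xs -> elems_in D (x :: xs).
Proof. by move=> Dx Dxs z; rewrite inE => /predU1P[->|/Dxs]. Qed.

Lemma elems_in_tail (D : R -> Prop) x xs : elems_in D (x :: xs) -> D x /\ elems_in D xs.
Proof.
by move=> h; split; [apply: h; rewrite mem_head|move=> z zx; apply: h; rewrite inE zx orbT].
Qed.

Lemma familyB (D : R -> Prop) P Q : (forall x, D x -> 0 <= x) -> family D P -> family D Q ->
  family D (fun xs ys xs' ys' j i => P xs ys xs' ys' j i - Q xs ys xs' ys' j i).
Proof.
move=> D0 fP fQ xs ys xs' ys' Dxs Dys Dxs' Dys'.
have [P1 P2 P3 P4 P5] := fP _ _ _ _ Dxs Dys Dxs' Dys'.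
have [Q1 Q2 Q3 Q4 Q5] := fQ _ _ _ _ Dxs Dys Dxs' Dys'.
split => [x j i Dx|y j i Dy|x j i Dx|y j i Dy|x j i Dx].
- by rewrite -(P1 x j i Dx) -(Q1 x j i Dx); ring.
- by rewrite P2// Q2//; ring.
- by rewrite P3// Q3//; ring.
- by rewrite -(P4 y j i Dy) -(Q4 y j i Dy); ring.
- have [p1 p2 p3] := P5 x j i Dx; have [q1 q2 q3] := Q5 x j i Dx.
  by split; apply: decayB => //; exact: D0.
Qed.

Lemma familyJ (D : R -> Prop) P : family D P ->
  family D (fun xs ys xs' ys' j i => conjc (P xs ys xs' ys' j i)).
Proof.
move=> fP xs ys xs' ys' Dxs Dys Dxs' Dys'.
have [P1 P2 P3 P4 P5] := fP _ _ _ _ Dxs Dys Dxs' Dys'.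
have nJ z : normc (conjc z) = normc z by case: z => a b /=; rewrite sqrrN.
split => [x j i Dx|y j i Dy|x j i Dx|y j i Dy|x j i Dx].
- by rewrite -(P1 x j i Dx) rmorphB rmorphM /= oppr0.
- by rewrite P2// rmorphB rmorphM /= oppr0.
- by rewrite P3// rmorphB rmorphM /= oppr0.
- by rewrite -(P4 y j i Dy) rmorphB rmorphM /= oppr0.
- have [p1 p2 p3] := P5 x j i Dx.
  by split; rewrite /decay; under eq_fun do rewrite nJ.
Qed.

(** A family is determined by its values without variables, since variables can
    be adjoined one at a time. The set [Z] of indices has to be stable under the
    shifts that the [w]-variables produce, and there is no such condition when
    there are no variables of that kind. *)
Lemma family_eq0 (D : R -> Prop) P (Z : int -> Prop) : (forall x, D x -> 0 <= x) ->
  family D P -> (forall j i, Z i -> P [::] [::] [::] [::] j i = 0) ->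
  forall xs ys xs' ys',
  elems_in D xs -> elems_in D ys -> elems_in D xs' -> elems_in D ys' ->
  (xs' = [::] \/ forall i, Z i -> Z (i + 1)) ->
  (ys' = [::] \/ forall i, Z i -> Z (i - 1)) ->
  forall j i, Z i -> P xs ys xs' ys' j i = 0.
Proof.
move=> D0 fP base xs ys xs' ys' Dxs Dys Dxs' Dys' Zp Zm.
have E1 : forall j i, Z i -> P [::] [::] [::] ys' j i = 0.
  elim: ys' Dys' Zm => [|y ys' IH] Dys' Zm; first exact: base.
  have [Dy Ds] := elems_in_tail Dys'; case: Zm => // Zm j i Zi.
  have := fP [::] [::] [::] ys' (@elems_in_nil _) (@elems_in_nil _) (@elems_in_nil _) Ds.
  move=> [_ _ _ P4 _].
  have [_ _ _ _ P5] := fP [::] [::] [::] (y :: ys') (@elems_in_nil _) (@elems_in_nil _) (@elems_in_nil _) Dys'.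
  have [_ d _] := P5 y j i Dy.
  have := decay_fixed0 d; rewrite subr0; apply; last exact: D0.
  move=> n; have Zn : Z (i - n%:Z).
    elim: n => [|n IHn]; first by rewrite subr0.
    have -> : i - n.+1%:Z = i - n%:Z - 1 by lia.
    exact: Zm.
  apply/eqP; rewrite -subr_eq0.
  have -> : i - n.+1%:Z = i - n%:Z - 1 by lia.
  by rewrite P4// IH//; right.
have E2 : forall j i, Z i -> P [::] [::] xs' ys' j i = 0.
  elim: xs' Dxs' Zp => [|x xs' IH] Dxs' Zp; first exact: E1.
  have [Dx Ds] := elems_in_tail Dxs'; case: Zp => // Zp j i Zi.
  have [_ _ P3 _ _] := fP [::] [::] xs' ys' (@elems_in_nil _) (@elems_in_nil _) Ds Dys'.
  by rewrite P3// !IH ?mulr0 ?subrr//; [right|exact: Zp|right].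
have E3 : forall j i, Z i -> P [::] ys xs' ys' j i = 0.
  elim: ys Dys => [|y ys IH] Dys; first exact: E2.
  have [Dy Ds] := elems_in_tail Dys => j i Zi.
  have [_ P2 _ _ _] := fP [::] ys xs' ys' (@elems_in_nil _) Ds Dxs' Dys'.
  by rewrite P2// !IH ?mulr0 ?subrr.
elim: xs Dxs => [|x xs IH] Dxs; first exact: E3.
have [Dx Ds] := elems_in_tail Dxs => j i Zi.
have [P1 _ _ _ _] := fP xs ys xs' ys' Ds Dys Dxs' Dys'.
have [_ _ _ _ P5] := fP (x :: xs) ys xs' ys' Dxs Dys Dxs' Dys'.
have [d _ _] := P5 x j i Dx.
have := decay_fixed0 d; rewrite subr0; apply; last exact: D0.
move=> n; apply/eqP; rewrite -subr_eq0.
have -> : j - n.+1%:Z = j - n%:Z - 1 by lia.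
by rewrite P1// IH.
Qed.

(** * The kernel integrals *)

Definition zfactor xs ys z : R[i] :=
  (\prod_(y <- ys) (1 - y%:C * z^-1)) * (\prod_(x <- xs) (1 - x%:C * z))^-1.

Definition wfactor xs ys w : R[i] :=
  (\prod_(x <- xs) (1 - x%:C * w)) * (\prod_(y <- ys) (1 - y%:C * w^-1))^-1.

Definition ker r1 r2 : kernels := fun xs ys xs' ys' j i =>
  ((4 * pi ^+ 2)^-1)%:C * dint r1 r2 (fun z => zfactor xs ys z * z ^ (- j - 1))
    (fun w => wfactor xs' ys' w * w ^ i).

Definition good_on r (f : R[i] -> R[i]) := ok_on r f /\ exists2 C, 0 <= C & bnd_on r f C.

Lemma good_onM r f g : good_on r f -> good_on r g -> good_on r (fun z => f z * g z).
Proof.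
move=> [cf [C C0 bf]] [cg [C' C'0 bg]]; split; first exact: ok_onM.
exists (C * C'); first by rewrite mulr_ge0.
by move=> t; rewrite normcM; apply: ler_pM; (exact: normc_ge0 || exact: bf || exact: bg).
Qed.

Lemma good_on_prod r xs (F : R -> R[i] -> R[i]) : (forall x, x \in xs -> good_on r (F x)) ->
  good_on r (fun z => \prod_(x <- xs) F x z).
Proof.
elim: xs => [|x xs IH] h.
  under [X in good_on r X]eq_fun do rewrite big_nil.
  split; first exact: ok_on_cst.
  by exists 1 => // t; rewrite /= expr0n/= addr0 expr1n sqrtr1.
under [X in good_on r X]eq_fun do rewrite big_cons.
apply: good_onM; first by apply: h; rewrite mem_head.
by apply: IH => z zx; apply: h; rewrite inE zx orbT.
Qed.

Lemma good_on_exprz r (m : int) : 0 < r -> good_on r (fun z => z ^ m).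
Proof.
move=> r0; split; first exact: ok_on_exprz.
by exists (r ^ m); [rewrite exprz_ge0// ltW|move=> t; rewrite normc_exprz normc_circle_pt// ltW].
Qed.

Lemma normc_real x : 0 <= x -> normc x%:C = x.
Proof. by move=> x0; rewrite /= expr0n/= addr0 sqrtr_sqr ger0_norm. Qed.

Lemma normcr1 : normc (1 : R[i]) = 1.
Proof. by rewrite /= expr0n/= addr0 expr1n sqrtr1. Qed.

(** On the circle [1 - f z] stays at distance at least [1 - q] from 0. *)
Lemma good_on_factor r (q : R) (f : R[i] -> R[i]) : 0 < r -> ok_on r f -> q < 1 ->
  (forall t, normc (f (circle_pt r t)) = q) ->
  good_on r (fun z => 1 - f z) /\ good_on r (fun z => (1 - f z)^-1).
Proof.
move=> r0 cf q1 nf; have q0 : 0 <= q by rewrite -(nf 0) normc_ge0.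
have lb t : 1 - q <= normc (1 - f (circle_pt r t)).
  have := normc_triangle (1 - f (circle_pt r t)) (f (circle_pt r t)).
  by rewrite subrK normcr1 nf lerBlDr.
have nz t : 1 - f (circle_pt r t) != 0.
  by apply/eqP => e; have := lb t; rewrite e normc0 leNgt subr_gt0 q1.
have c1 : ok_on r (fun z => 1 - f z) by apply: ok_onB => //; exact: ok_on_cst.
split; split => //.
- exists (1 + q); first by rewrite addr_ge0.
  move=> t; rewrite (le_trans (normc_triangle _ _))// normcr1 lerD2l.
  by rewrite -[X in normc X]sub0r normc_subC subr0 nf.
- exact: ok_onV.
- exists (1 - q)^-1; first by rewrite invr_ge0 subr_ge0 ltW.
  move=> t; rewrite normcV lef_pV2 ?posrE ?subr_gt0//.
  by rewrite (lt_le_trans _ (lb t))// subr_gt0.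
Qed.

(** The conditions that keep the binomials [1 - x z] and [1 - x / z] away from 0
    on both circles. *)
Definition okvar r1 r2 x := [/\ 0 <= x < 1, x < r1, x < r2, x * r1 < 1 & x * r2 < 1].

Section Radii.
Variables r1 r2 : R.
Hypotheses (r1_gt0 : 0 < r1) (r2_gt0 : 0 < r2) (r12 : r1 != r2).
Variable D : R -> Prop.
Hypothesis Dok : forall x, D x -> okvar r1 r2 x.

Lemma good_up r x : 0 < r -> 0 <= x -> x * r < 1 ->
  good_on r (fun z => 1 - x%:C * z) /\ good_on r (fun z => (1 - x%:C * z)^-1).
Proof.
move=> r0 x0 xr; apply: (@good_on_factor r (x * r)) => //.
  by apply: ok_onM; [exact: ok_on_cst|exact: ok_on_id].
by move=> t; rewrite normcM normc_real// normc_circle_pt// ltW.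
Qed.

Lemma good_down r y : 0 < r -> 0 <= y -> y < r ->
  good_on r (fun z => 1 - y%:C * z^-1) /\ good_on r (fun z => (1 - y%:C * z^-1)^-1).
Proof.
move=> r0 y0 yr; apply: (@good_on_factor r (y / r)) => //.
- apply: ok_onM; first exact: ok_on_cst.
  apply: (@ok_onV _ r id); last exact: ok_on_id.
  by move=> t; exact: circle_pt_neq0.
- by rewrite ltr_pdivrMr// mul1r.
- by move=> t; rewrite normcM normc_real// normcV normc_circle_pt// ltW.
Qed.

Lemma good_zfactor xs ys : elems_in D xs -> elems_in D ys -> good_on r1 (zfactor xs ys).
Proof.
move=> Dxs Dys; apply: good_onM.
  apply: good_on_prod => y /Dys Dy; have [/andP[y0 _] yr _ _ _] := Dok Dy.
  by have [] := good_down r1_gt0 y0 yr.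
under [X in good_on _ X]eq_fun do rewrite -prodfV.
apply: good_on_prod => x /Dxs Dx; have [/andP[x0 _] _ _ xr _] := Dok Dx.
by have [] := good_up r1_gt0 x0 xr.
Qed.

Lemma good_wfactor xs ys : elems_in D xs -> elems_in D ys -> good_on r2 (wfactor xs ys).
Proof.
move=> Dxs Dys; apply: good_onM.
  apply: good_on_prod => x /Dxs Dx; have [/andP[x0 _] _ _ _ xr] := Dok Dx.
  by have [] := good_up r2_gt0 x0 xr.
under [X in good_on _ X]eq_fun do rewrite -prodfV.
apply: good_on_prod => y /Dys Dy; have [/andP[y0 _] _ yr _ _] := Dok Dy.
by have [] := good_down r2_gt0 y0 yr.
Qed.

(** The radii enter through the monomials, and the other factors are bounded on
    the circles. *)
Lemma ker_growth xs ys xs' ys' :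
  elems_in D xs -> elems_in D ys -> elems_in D xs' -> elems_in D ys' ->
  exists2 C, 0 <= C & forall j i, normc (ker r1 r2 xs ys xs' ys' j i) <= C * r1 ^ (- j) * r2 ^ i.
Proof.
move=> Dxs Dys Dxs' Dys'.
have [cf [A A0 bf]] := good_zfactor Dxs Dys.
have [cg [B B0 bg]] := good_wfactor Dxs' Dys'.
pose K := (4 * pi ^+ 2)^-1 * (4 * pi * (A * (4 * pi * (`|r2 - r1|^-1 * B * r2)))) : R.
have K0 : 0 <= K.
  by rewrite /K !mulr_ge0 ?invr_ge0 ?mulr_ge0 ?exprn_ge0 ?pi_ge0 ?normr_ge0// ltW.
exists K => // j i.
have c0 : 0 <= (4 * pi ^+ 2)^-1 :> R by rewrite invr_ge0 mulr_ge0// exprn_ge0// pi_ge0.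
rewrite /ker normcM normc_real//.
have gz : good_on r1 (fun z => zfactor xs ys z * z ^ (- j - 1)).
  by apply: good_onM; [exact: good_zfactor|exact: good_on_exprz].
have gw : good_on r2 (fun w => wfactor xs' ys' w * w ^ i).
  by apply: good_onM; [exact: good_wfactor|exact: good_on_exprz].
have bf' : bnd_on r1 (fun z => zfactor xs ys z * z ^ (- j - 1)) (A * r1 ^ (- j - 1)).
  move=> t; rewrite normcM normc_exprz normc_circle_pt ?(ltW r1_gt0)//.
  by rewrite ler_wpM2r ?exprz_ge0 ?(ltW r1_gt0)//; exact: bf.
have bg' : bnd_on r2 (fun w => wfactor xs' ys' w * w ^ i) (B * r2 ^ i).
  move=> t; rewrite normcM normc_exprz normc_circle_pt ?(ltW r2_gt0)//.
  by rewrite ler_wpM2r ?exprz_ge0 ?(ltW r2_gt0)//; exact: bg.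
have a0 : 0 <= A * r1 ^ (- j - 1) by rewrite mulr_ge0// exprz_ge0// ltW.
have h := @dint_bound R r1 r2 r1_gt0 r2_gt0 r12 _ _ _ _ gz.1 gw.1 a0 bf' bg'.
rewrite (le_trans (ler_wpM2l c0 h))//.
have -> : r1 ^ (- j - 1) = r1 ^ (- j) * r1^-1.
  by rewrite exprzDr ?unitfE ?gt_eqF// exprN1.
have n1 : r1 != 0 by rewrite gt_eqF.
have n2 : pi != 0 :> R by rewrite gt_eqF// pi_gt0.
have n3 : `|r2 - r1| != 0 by rewrite gt_eqF// dist_gt0.
rewrite le_eqVlt; apply/orP; left; apply/eqP; rewrite /K.
by move: (@pi R) n2 => p n2; field; rewrite n1 n2 n3.
Qed.

Let pull_factor (c u v z : R[i]) : c * u - z * (c * v) = c * (u - z * v).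
Proof. by ring. Qed.

Lemma ker_family : family D (ker r1 r2).
Proof.
move=> xs ys xs' ys' Dxs Dys Dxs' Dys'.
have gz us vs j : elems_in D us -> elems_in D vs ->
    good_on r1 (fun z => zfactor us vs z * z ^ (- j - 1)).
  by move=> h1 h2; apply: good_onM; [exact: good_zfactor|exact: good_on_exprz].
have gw us vs i : elems_in D us -> elems_in D vs ->
    good_on r2 (fun w => wfactor us vs w * w ^ i).
  by move=> h1 h2; apply: good_onM; [exact: good_wfactor|exact: good_on_exprz].
have p1 t := circle_pt_neq0 t r1_gt0; have p2 t := circle_pt_neq0 t r2_gt0.
split => [x j i Dx|y j i Dy|x j i Dx|y j i Dy|x j i Dx].
- have Dx' := elems_in_cons Dx Dxs; have [/andP[x0 _] _ _ xr _] := Dok Dx.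
  have [cw [C _ bw]] := gw _ _ i Dxs' Dys'.
  have [c1 _] := gz _ _ j Dx' Dys; have [c2 _] := gz _ _ (j - 1) Dx' Dys.
  rewrite /ker pull_factor; congr (_ * _).
  have <- := @dintBl R r1 r2 r1_gt0 r2_gt0 r12 _ _ _ x%:C C c1 c2 cw bw.
  apply: eq_dint => // t.
  have -> : - (j - 1) - 1 = - j - 1 + 1 by lia.
  rewrite [_ ^ (_ + 1)]exprzDr ?unitfE// expr1z /zfactor big_cons invfM.
  set z := circle_pt r1 t; have nz : 1 - x%:C * z != 0.
    apply/eqP => /eqP; rewrite subr_eq0 => /eqP e.
    have := congr1 (@normc R) e; rewrite normcr1 normcM normc_real// normc_circle_pt; last exact: ltW.
    by move=> e1; move: xr; rewrite -e1 ltxx.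
  set Z := z ^ _; set A := \prod_(_ <- _) _; set B := (\prod_(_ <- _) _)^-1.
  transitivity ((1 - x%:C * z) * (1 - x%:C * z)^-1 * (A * B * Z)); first by ring.
  by rewrite mulfV// mul1r.
- have Dy' := elems_in_cons Dy Dys.
  have [cw [C _ bw]] := gw _ _ i Dxs' Dys'.
  have [c1 _] := gz _ _ j Dxs Dys; have [c2 _] := gz _ _ (j + 1) Dxs Dys.
  rewrite /ker pull_factor; congr (_ * _).
  have <- := @dintBl R r1 r2 r1_gt0 r2_gt0 r12 _ _ _ y%:C C c1 c2 cw bw.
  apply: eq_dint => // t.
  have -> : - j - 1 = - (j + 1) - 1 + 1 by lia.
  rewrite [_ ^ (_ + 1)]exprzDr ?unitfE// expr1z /zfactor big_cons.
  set z := circle_pt r1 t; have z0 : z != 0 by exact: p1.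
  set Z := z ^ _; set A := \prod_(_ <- _) _; set B := (\prod_(_ <- _) _)^-1.
  transitivity (A * B * (Z * z) - y%:C * (z^-1 * z) * (A * B * Z)); first by ring.
  by rewrite mulVf// mulr1.
- have [cf [A _ bf]] := gz _ _ j Dxs Dys.
  have [c1 [C1 _ b1]] := gw _ _ i Dxs' Dys'; have [c2 [C2 _ b2]] := gw _ _ (i + 1) Dxs' Dys'.
  rewrite /ker pull_factor; congr (_ * _).
  have <- := @dintBr R r1 r2 r1_gt0 r2_gt0 r12 _ _ _ x%:C C1 C2 cf c1 c2 b1 b2.
  apply: eq_dint => // t.
  rewrite exprzDr ?unitfE// expr1z /wfactor big_cons; ring.
- have Dy' := elems_in_cons Dy Dys'; have [/andP[y0 _] _ yr _ _] := Dok Dy.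
  have [cf [A _ bf]] := gz _ _ j Dxs Dys.
  have [c1 [C1 _ b1]] := gw _ _ i Dxs' Dy'; have [c2 [C2 _ b2]] := gw _ _ (i - 1) Dxs' Dy'.
  rewrite /ker pull_factor; congr (_ * _).
  have <- := @dintBr R r1 r2 r1_gt0 r2_gt0 r12 _ _ _ y%:C C1 C2 cf c1 c2 b1 b2.
  apply: eq_dint => // t.
  rewrite [_ ^ (_ - 1)]exprzDr ?unitfE// exprN1 /wfactor big_cons invfM.
  set z := circle_pt r2 t; have nz : 1 - y%:C * z^-1 != 0.
    apply/eqP => /eqP; rewrite subr_eq0 => /eqP e.
    have := congr1 (@normc R) e; rewrite normcr1 normcM normc_real// normcV normc_circle_pt; last exact: ltW.
    move=> e1; have : y / r2 < 1 by rewrite ltr_pdivrMr// mul1r.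
    by rewrite -e1 ltxx.
  set Z := z ^ _; set U := \prod_(_ <- _) _; set B := (\prod_(_ <- _) _)^-1.
  transitivity ((1 - y%:C * z^-1) * (1 - y%:C * z^-1)^-1 * (U * B * Z)); first by ring.
  by rewrite mulfV// mul1r.
- have [C C0 gr] := ker_growth Dxs Dys Dxs' Dys'.
  have [/andP[x0 _] _ xr2 xr1 xr2'] := Dok Dx.
  have u1 : r1 \is a GRing.unit by rewrite unitfE gt_eqF.
  have u2 : r2 \is a GRing.unit by rewrite unitfE gt_eqF.
  split.
  + apply: (@decay_geom x _ (C * r1 ^ (- j) * r2 ^ i) r1) => // [|n]; first exact: ltW.
    rewrite (le_trans (gr _ _))//.
    have -> : - (j - n%:Z) = - j + n%:Z by lia.
    by rewrite exprzDr// -exprnP; rewrite le_eqVlt; apply/orP; left; apply/eqP; ring.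
  + apply: (@decay_geom x _ (C * r1 ^ (- j) * r2 ^ i) r2^-1) => // [||n].
    * by rewrite invr_ge0 ltW.
    * by rewrite ltr_pdivrMr// mul1r.
    rewrite (le_trans (gr _ _))// exprzDr// -exprnN exprVn.
    by rewrite le_eqVlt; apply/orP; left; apply/eqP; ring.
  + apply: (@decay_geom x _ (C * r1 ^ (- j) * r2 ^ i) r2) => // [|n]; first exact: ltW.
    rewrite (le_trans (gr _ _))// exprzDr// -exprnP.
    by rewrite le_eqVlt; apply/orP; left; apply/eqP; ring.
Qed.

Lemma ker_base j i : ker r1 r2 [::] [::] [::] [::] j i =
  if r2 < r1 then ((i == j) && (i < 0))%:R else - ((i == j) && (0 <= i))%:R.
Proof.
rewrite /ker (@eq_dint _ _ _ _ (fun z => z ^ (- j - 1)) _ (fun w => w ^ i)).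
- rewrite dint_exprz// mulrA -rmorphM mulVf ?mul1r//.
  by rewrite mulf_neq0// expf_neq0// gt_eqF// pi_gt0.
- by move=> t; rewrite /zfactor !big_nil invr1 !mul1r.
- by move=> t; rewrite /wfactor !big_nil invr1 !mul1r.
Qed.

End Radii.
End Families.

(** * Reality, boundary values and jump of the kernel *)

Section KernelFacts.
Variable R : realType.
Implicit Types (x y r : R) (xs ys : seq R) (i j : int).

Record radii_for (D : R -> Prop) (r1 r2 : R) : Prop := RadiiFor {
  radii1_gt0 : 0 < r1;
  radii2_gt0 : 0 < r2;
  radii_neq : r1 != r2;
  radii_ok : forall x, D x -> okvar r1 r2 x }.

Section OneDomain.
Variable D : R -> Prop.

Let D0 r1 r2 : radii_for D r1 r2 -> forall x, D x -> 0 <= x.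
Proof. by move=> [_ _ _ h] x /h[/andP[]]. Qed.

Lemma ker_family' r1 r2 : radii_for D r1 r2 -> family D (ker r1 r2).
Proof. by move=> [h1 h2 h3 h4]; exact: ker_family. Qed.

(** The values without variables depend only on which circle is inside. *)
Lemma ker_indep r1 r2 r1' r2' xs ys xs' ys' j i :
  radii_for D r1 r2 -> radii_for D r1' r2' -> (r2 < r1) = (r2' < r1') ->
  elems_in D xs -> elems_in D ys -> elems_in D xs' -> elems_in D ys' ->
  ker r1 r2 xs ys xs' ys' j i = ker r1' r2' xs ys xs' ys' j i.
Proof.
move=> rr rr' e Dxs Dys Dxs' Dys'; apply/eqP; rewrite -subr_eq0; apply/eqP.
have fam := familyB (D0 rr) (ker_family' rr) (ker_family' rr').
apply: (family_eq0 (Z := fun=> True) (D0 rr) fam) => //; [|by right|by right].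
move=> j' i' _; case: rr => h1 h2 h3 _; case: rr' => h1' h2' h3' _.
by rewrite !ker_base// e subrr.
Qed.

(** The recurrences have real coefficients, so conjugation preserves them. *)
Lemma ker_real r1 r2 xs ys xs' ys' j i : radii_for D r1 r2 ->
  elems_in D xs -> elems_in D ys -> elems_in D xs' -> elems_in D ys' ->
  (complex.Re (ker r1 r2 xs ys xs' ys' j i))%:C = ker r1 r2 xs ys xs' ys' j i.
Proof.
move=> rr Dxs Dys Dxs' Dys'.
have fam := familyB (D0 rr) (ker_family' rr) (familyJ (ker_family' rr)).
have : ker r1 r2 xs ys xs' ys' j i - conjc (ker r1 r2 xs ys xs' ys' j i) = 0.
  apply: (family_eq0 (Z := fun=> True) (D0 rr) fam) => //; [|by right|by right].
  move=> j' i' _; case: rr => h1 h2 h3 _; rewrite ker_base//.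
  by case: ifP => _; rewrite ?rmorphN rmorph_nat subrr.
case: (ker _ _ _ _ _ _ _ _) => a b /= /eqP; rewrite eq_complex/= => /andP[_ /eqP].
by move=> h; congr (_ +i* _); lra.
Qed.

(** Without [Up] letters on the [w]-side, the recurrences in [i] only use
    smaller values of [i], and the values without variables vanish there. *)
Lemma ker_start r1 r2 xs ys ys' j i : radii_for D r1 r2 -> r1 < r2 ->
  elems_in D xs -> elems_in D ys -> elems_in D ys' -> i < 0 ->
  ker r1 r2 xs ys [::] ys' j i = 0.
Proof.
move=> rr lt Dxs Dys Dys' i0.
apply: (family_eq0 (Z := fun i => i < 0) (D0 rr) (ker_family' rr)) => //.
- case: rr => h1 h2 h3 _ j' i' i0'; rewrite ker_base//.
  by rewrite [r2 < r1]ltNge (ltW lt) leNgt i0' andbF oppr0.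
- by left.
- by right => i' h; lia.
Qed.

(** The mirror image of [ker_start]: without [Down] letters on the [w]-side, the
    recurrences in [i] only use larger values. *)
Lemma ker_end r1 r2 xs ys xs' j i : radii_for D r1 r2 -> r2 < r1 ->
  elems_in D xs -> elems_in D ys -> elems_in D xs' -> 0 <= i ->
  ker r1 r2 xs ys xs' [::] j i = 0.
Proof.
move=> rr lt Dxs Dys Dxs' i0.
apply: (family_eq0 (Z := fun i => 0 <= i) (D0 rr) (ker_family' rr)) => //.
- case: rr => h1 h2 h3 _ j' i' i0'; rewrite ker_base// lt.
  by rewrite ltNge i0' andbF.
- by right => i' h; lia.
- by left.
Qed.

Lemma decay_delta x j i : 0 <= x < 1 -> decay x (fun n => ((i == j - n%:Z)%R)%:R : R[i]).
Proof.
move=> /andP[x0 x1]; apply: (@decay_geom _ x _ 1 1) => // [|n].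
  by rewrite mulr1.
rewrite expr1n mulr1; case: eqP => _; rewrite ?normcr1//.
by rewrite normc0.
Qed.

Lemma decay_delta' x j i : 0 <= x < 1 -> decay x (fun n => ((i - n%:Z == j)%R)%:R : R[i]).
Proof.
move=> /andP[x0 x1]; apply: (@decay_geom _ x _ 1 1) => // [|n].
  by rewrite mulr1.
rewrite expr1n mulr1; case: eqP => _; rewrite ?normcr1//.
by rewrite normc0.
Qed.

(** Moving the [w]-circle across the [z]-circle picks up the residue at [w = z],
    where the two factors cancel if their variables are the same. The proof
    adjoins each variable on both sides at once, which keeps the Kronecker
    delta. *)
Lemma ker_jump r1 r2 r1' r2' xs ys j i :
  radii_for D r1 r2 -> radii_for D r1' r2' -> r2 < r1 -> r1' < r2' ->
  elems_in D xs -> elems_in D ys ->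
  ker r1 r2 xs ys xs ys j i - ker r1' r2' xs ys xs ys j i = (i == j)%:R.
Proof.
move=> rr rr' lt lt' Dxs Dys.
have fam := familyB (D0 rr) (ker_family' rr) (ker_family' rr').
set P := (X in family D X) in fam; rewrite -[LHS]/(P xs ys xs ys j i).
have dx x : D x -> 0 <= x < 1 by case: rr => _ _ _ h /h[].
have base j' i' : P [::] [::] [::] [::] j' i' = (i' == j')%:R.
  case: rr => h1 h2 h3 _; case: rr' => h1' h2' h3' _.
  have nlt : (r2' < r1') = false by rewrite ltNge (ltW lt').
  rewrite /P !ker_base// lt nlt opprK leNgt.
  by case: (i' == j'); case: (i' < 0); rewrite ?addr0 ?add0r.
clearbody P; clear rr rr' lt lt'.
have E1 : forall j i, P xs [::] xs [::] j i = (i == j)%:R.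
  elim: xs Dxs => [|x xs IH] Dxs j' i'; first exact: base.
  have [Dx Ds] := elems_in_tail Dxs.
  have [P1 _ _ _ _] := fam _ _ _ _ Ds (@elems_in_nil _ D) Dxs (@elems_in_nil _ D).
  have [_ _ P3 _ _] := fam _ _ _ _ Ds (@elems_in_nil _ D) Ds (@elems_in_nil _ D).
  have [_ _ _ _ P5] := fam _ _ _ _ Dxs (@elems_in_nil _ D) Dxs (@elems_in_nil _ D).
  have [d _ _] := P5 x j' i' Dx.
  apply/eqP; rewrite -subr_eq0; apply/eqP.
  have := @decay_fixed0 R x (fun n => P (x :: xs) [::] (x :: xs) [::] (j' - n%:Z) i' - (i' == j' - n%:Z)%:R).
  rewrite subr0; apply; last by case/andP: (dx _ Dx).
    by apply: decayB => //; [case/andP: (dx _ Dx)|apply: decay_delta; exact: dx].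
  move=> n; have := P1 x (j' - n%:Z) i' Dx; rewrite P3// !IH//.
  have -> : j' - n%:Z - 1 = j' - n.+1%:Z by lia.
  have -> : (i' + 1 == j' - n%:Z) = (i' == j' - n.+1%:Z) by lia.
  by move=> /(canRL (subrK _)) ->; ring.
elim: ys Dys j i => [|y ys IH] Dys j i; first exact: E1.
have [Dy Ds] := elems_in_tail Dys.
have [_ _ _ P4 _] := fam _ _ _ _ Dxs Dys Dxs Ds.
have [_ P2 _ _ _] := fam _ _ _ _ Dxs Ds Dxs Ds.
have [_ _ _ _ P5] := fam _ _ _ _ Dxs Dys Dxs Dys.
have [_ d _] := P5 y j i Dy.
apply/eqP; rewrite -subr_eq0; apply/eqP.
have := @decay_fixed0 R y (fun n => P xs (y :: ys) xs (y :: ys) j (i - n%:Z) - (i - n%:Z == j)%:R).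
rewrite subr0; apply; last by case/andP: (dx _ Dy).
  by apply: decayB => //; [case/andP: (dx _ Dy)|apply: decay_delta'; exact: dx].
move=> n; have := P4 y j (i - n%:Z) Dy; rewrite P2// !IH//.
have -> : i - n%:Z - 1 = i - n.+1%:Z by lia.
have -> : (i - n%:Z == j + 1) = (i - n.+1%:Z == j) by lia.
by move=> /(canRL (subrK _)) ->; ring.
Qed.

End OneDomain.
End KernelFacts.

(** * The kernel along a word *)

Section WordKernel.
Variable R : realType.
Implicit Types (x y r : R) (w pre suf : seq (letter R)) (i j : int) (s : nat).

Definition labels w : seq nat := pmap (fun l => if l is Obs s then Some s else None) w.

Fixpoint before s w : seq (letter R) :=
  if w is l :: w' then if is_obs s l then [::] else l :: before s w' else [::].

Lemma has_obs s w : has (@is_obs R s) w = (s \in labels w).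
Proof.
elim: w => [|[x|y|s'] w IH] //=; rewrite ?IH//.
by rewrite inE eq_sym.
Qed.

Lemma labels_cat w1 w2 : labels (w1 ++ w2) = labels w1 ++ labels w2.
Proof. exact: pmap_cat. Qed.
Lemma ups_cat w1 w2 : ups (w1 ++ w2) = ups w1 ++ ups w2. Proof. exact: pmap_cat. Qed.
Lemma downs_cat w1 w2 : downs (w1 ++ w2) = downs w1 ++ downs w2. Proof. exact: pmap_cat. Qed.

Lemma split_obs s w : s \in labels w -> w = before s w ++ Obs s :: after s w.
Proof.
elim: w => [|l w IH] //; case: l => [x|y|s'] /=; try by move=> /IH {1}->.
by rewrite inE; case: eqVneq => [->|ne] //= /IH {1}->.
Qed.

Lemma split_obs_uniq s w pre suf : uniq (labels w) -> w = pre ++ Obs s :: suf ->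
  before s w = pre /\ after s w = suf.
Proof.
move=> + wE; rewrite wE labels_cat cat_uniq => /and3P[_ /hasPn/(_ s) ns _].
have {ns} : s \notin labels pre by apply: ns; rewrite inE eqxx.
elim: pre {wE} => [|l pre IH] /=; first by rewrite eqxx.
case: l => [x|y|s'] /=; try by move=> /IH[-> ->].
by rewrite inE negb_or eq_sym => /andP[/negPf -> /IH[-> ->]].
Qed.

Lemma ltn_labels w s s' : sorted ltn (labels w) -> s \in labels w -> s' \in labels w ->
  (s' \in labels (after s w)) = (s < s')%N.
Proof.
move=> so sw sw'.
have lE : labels w = labels (before s w) ++ s :: labels (after s w).
  by rewrite {1}(split_obs sw) labels_cat.
move: so; rewrite lE (sorted_pairwise ltn_trans) pairwise_cat => /and3P[/allrelP h _].
rewrite pairwise_cons => /andP[/allP h2 _].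
apply/idP/idP => [|lt]; first exact: h2.
move: sw'; rewrite lE mem_cat inE => /or3P[h'|/eqP e|//].
  by have := h s' s h' (mem_head _ _); rewrite ltnNge (ltnW lt).
by move: lt; rewrite e ltnn.
Qed.

Lemma ker_perm r1 r2 xs xs' ys ys' us us' vs vs' j i :
  perm_eq xs xs' -> perm_eq ys ys' -> perm_eq us us' -> perm_eq vs vs' ->
  ker r1 r2 xs ys us vs j i = ker r1 r2 xs' ys' us' vs' j i :> R[i].
Proof.
move=> h1 h2 h3 h4; rewrite /ker; apply: (congr1 ( *%R _)); apply: eq_dint => t.
  by rewrite /zfactor (perm_big _ h1) (perm_big _ h2).
by rewrite /wfactor (perm_big _ h3) (perm_big _ h4).
Qed.

Definition letter_in (D : R -> Prop) w := elems_in D (ups w) /\ elems_in D (downs w).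

Lemma elems_in_cat (D : R -> Prop) xs ys : elems_in D (xs ++ ys) <-> elems_in D xs /\ elems_in D ys.
Proof.
split=> [h|[h1 h2] x]; last by rewrite mem_cat => /orP[/h1|/h2].
by split=> x xx; apply: h; rewrite mem_cat xx ?orbT.
Qed.

Lemma letter_in_cat (D : R -> Prop) w1 w2 : letter_in D (w1 ++ w2) -> letter_in D w1 /\ letter_in D w2.
Proof.
by rewrite /letter_in ups_cat downs_cat !elems_in_cat => -[[? ?] [? ?]].
Qed.

Variables (w : seq (letter R)) (D : R -> Prop) (rin rout : R).
Hypothesis sorted_w : sorted ltn (labels w).
Hypothesis wD : letter_in D w.
Hypothesis plus_ok : radii_for D rout rin.
Hypothesis minus_ok : radii_for D rin rout.
Hypothesis rio : rin < rout.

Let uniq_w : uniq (labels w).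
Proof. by apply: sorted_uniq sorted_w; [exact: ltn_trans|exact: ltnn]. Qed.

(** The kernel between the time of the observation [s'] and the time between
    [pre] and [suf]; [late] tells that [s'] lies in [suf], which decides the
    order of the two circles. *)
Definition wker (late : bool) (s' : nat) pre suf j i : R[i] :=
  (if late then ker rin rout else ker rout rin)
    (ups (before s' w)) (downs (after s' w)) (ups pre) (downs suf) j i.

Let inD pre suf : w = pre ++ suf -> letter_in D pre /\ letter_in D suf.
Proof. by move=> wE; apply: letter_in_cat; rewrite -wE. Qed.

Let sD s' : elems_in D (ups (before s' w)) /\ elems_in D (downs (after s' w)).
Proof.
have [sw|nsw] := boolP (s' \in labels w).
  have [[h1 _] h2] := inD (split_obs sw); split=> //.
  by have [_] := @letter_in_cat D [:: Obs s'] (after s' w) h2; case.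
split; last by have [pre /inD[_ []]] := after_suffix s' w.
suff -> : before s' w = w by case: wD.
move: nsw; elim: (w) => [|[x|y|s] w' IH] //= ; try by move=> /IH ->.
by rewrite inE negb_or eq_sym => /andP[/negPf -> /IH ->].
Qed.

Lemma wker_family late s' pre suf : w = pre ++ suf ->
  let P := fun us vs j i => (if late then ker rin rout else ker rout rin)
    (ups (before s' w)) (downs (after s' w)) us vs j i in
  [/\ forall x j i, D x -> P (x :: ups pre) (downs suf) j i =
        wker late s' pre suf j i - x%:C * wker late s' pre suf j (i + 1),
      forall y j i, D y -> P (ups pre) (y :: downs suf) j i -
        y%:C * P (ups pre) (y :: downs suf) j (i - 1) = wker late s' pre suf j i
    & forall x j i, D x -> decay x (fun n => wker late s' pre suf j (i + n%:Z))].
Proof.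
move=> wE P; have [[h1 h2] [h3 h4]] := inD wE; have [g1 g2] := sD s'.
have fam : family D (if late then ker rin rout else ker rout rin).
  by case: late P => _; apply: ker_family'.
have [_ _ p1 p2 p3] := fam _ _ _ _ g1 g2 h1 h4.
by split => // x j i Dx; have [_ _] := p3 x j i Dx.
Qed.

Lemma wker_Up late s' pre suf x j i : w = pre ++ Up x :: suf ->
  wker late s' (rcons pre (Up x)) suf j i =
  wker late s' pre (Up x :: suf) j i - x%:C * wker late s' pre (Up x :: suf) j (i + 1).
Proof.
move=> wE; have [p1 _ _] := wker_family late s' wE.
have Dx : D x.
  by case: wD => + _; rewrite wE ups_cat /= elems_in_cat => -[_]; apply; rewrite mem_head.
rewrite -p1// /wker -cats1 ups_cat /= cats1.
by case: late {p1}; apply: ker_perm; rewrite ?perm_rcons.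
Qed.

Lemma wker_Down late s' pre suf y j i : w = pre ++ Down y :: suf ->
  wker late s' (rcons pre (Down y)) suf j i =
  wker late s' pre (Down y :: suf) j i - y%:C * wker late s' pre (Down y :: suf) j (i - 1).
Proof.
move=> wE; have wE' : w = rcons pre (Down y) ++ suf by rewrite cat_rcons.
have [_ p2 _] := wker_family late s' wE'.
have Dy : D y.
  by case: wD => _; rewrite wE downs_cat /= elems_in_cat => -[_]; apply; rewrite mem_head.
rewrite -(p2 y)// /wker -cats1 ups_cat /= cats0.
by case: late {p2}.
Qed.

Lemma wker_jump s pre suf j i : w = pre ++ Obs s :: suf ->
  wker false s (rcons pre (Obs s)) suf j i - wker true s pre (Obs s :: suf) j i = (i == j)%:R.
Proof.
move=> wE; rewrite /wker -cats1 ups_cat /= cats0; have [h1 h2] := split_obs_uniq uniq_w wE.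
by rewrite h1 h2; apply: (ker_jump j i plus_ok minus_ok) => //; have := sD s; rewrite h1 h2 => -[].
Qed.

(** Induction along the word from [ker_start]: each [Up] lowers the bound on [i]
    by one, and the jumps sit at [j], which lies above the bound. *)
Lemma wker_vanish s' (M : nat) pre suf j i : s' \in labels w -> w = pre ++ suf ->
  - M%:Z <= j -> i < - M%:Z - (size (ups pre))%:Z ->
  wker (s' \in labels suf) s' pre suf j i = 0.
Proof.
move=> sw; elim/last_ind: pre suf i => [|pre l IH] suf i wE Mj.
  rewrite /= => ilt; rewrite -[suf]cat0s -wE sw /wker; have [g1 g2] := sD s'.
  apply: (ker_start j minus_ok) => //; last by lia.
  by case: wD.
have wE' : w = pre ++ l :: suf by rewrite wE cat_rcons.
rewrite -cats1 ups_cat size_cat; have := IH _ _ wE' Mj.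
case: l wE' {IH wE} => [x|y|s] wE' IH /= ilt.
- by rewrite cats1 wker_Up// !IH ?mulr0 ?subrr//; lia.
- by rewrite cats1 wker_Down// !IH ?mulr0 ?subrr//; lia.
- have hv : wker (s' \in labels (Obs s :: suf)) s' pre (Obs s :: suf) j i = 0.
    by apply: IH; move: ilt; rewrite addn0.
  case: (eqVneq s' s) => [e|ne]; last first.
    have e1 : (s' \in labels (Obs s :: suf)) = (s' \in labels suf).
      by rewrite [labels (_ :: _)]/= inE (negPf ne).
    rewrite -hv e1 /wker ups_cat cats0; by case: (s' \in labels suf).
  subst s; have t : s' \in labels (Obs s' :: suf) by rewrite [labels (_ :: _)]/= inE eqxx.
  have nl : s' \notin labels suf.
    by move: uniq_w; rewrite wE' labels_cat cat_uniq /= => /and3P[_ _ /andP[]].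
  rewrite t in hv; rewrite (negPf nl) cats1; have := wker_jump j i wE'.
  rewrite hv subr0 => ->; have -> : (i == j) = false by lia.
  by [].
Qed.

End WordKernel.

(** * Correlations along a word *)

Section Occupation.
Variable R : realType.
Implicit Types (la : intpart).

Definition occupied (z : int) la : bool :=
  `[< exists2 j : nat, (1 <= j)%N & z = (part la j.-1)%:Z - j%:Z >].

(** The rows after the first [N] are empty and occupy integers below [- N],
    which are not sites. *)
Lemma occupied_site N z la (k : nat) : (size la <= N)%N -> k%:Z = z + N%:Z ->
  occupied z la = [exists i : 'I_N, site N la i == k].
Proof.
move=> sz kz; apply/asboolP/existsP => [[j j1 zE]|[i /eqP iE]].
  have jN : (j.-1 < N)%N.
    rewrite ltnNge; apply/negP => Nj; have p0 : part la j.-1 = 0%N by rewrite part_default// (leq_trans sz).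
    by move: zE; rewrite p0; lia.
  by exists (Ordinal jN); apply/eqP; rewrite /site /=; lia.
by exists i.+1 => //=; move: iE (ltn_ord i); rewrite /site; lia.
Qed.

Lemma site_inj N la (i j : 'I_N) : site N la i = site N la j -> i = j.
Proof.
have main (k l : 'I_N) : (k <= l)%N -> site N la k = site N la l -> k = l.
  move=> kl e; apply: val_inj => /=; move: (kl) e (part_noninc la kl) (ltn_ord k) (ltn_ord l).
  rewrite /site; lia.
by move=> e; case/orP: (leq_total i j) => h; [exact: main|exact/esym/main].
Qed.

Variables (d : nat) (a : 'I_d -> nat) (bz : 'I_d -> int) (u : 'I_d -> R).
Hypothesis ab_inj : injective (fun r => (a r, bz r)).

Definition obs_factor (s : nat) la : R :=
  \prod_(r | a r == s) (if occupied (bz r) la then 1 + u r else 1).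

(** Distinct points observed at one time have distinct sites, so at most one
    [u r] contributes to each factor, and sites of a partition are distinct. *)
Lemma obs_factor_sites N (b : 'I_d -> nat) s la : (size la <= N)%N ->
  (forall r, (b r)%:Z = bz r + N%:Z) ->
  obs_factor s la = \prod_(i < N) obs_weight a b u s (site N la i).
Proof.
move=> sz bE.
have wE k : obs_weight a b u s k = \prod_(r | a r == s) (if b r == k then 1 + u r else 1).
  rewrite /obs_weight; have [r0 /andP[ar br]|none] := pickP (fun r => (a r == s) && (b r == k)).
    rewrite (bigD1 r0)/= ?ar ?br// big1 ?addr0; last first.
      move=> r /andP[/andP[/eqP ar' /eqP br'] /eqP[]]; apply: ab_inj; congr pair.
        by rewrite ar' (eqP ar).
      by have := bE r; have := bE r0; rewrite br' (eqP br); lia.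
    rewrite (bigD1 r0)//= br big1 ?mulr1// => r /andP[/eqP ar' ne]; case: eqP => // br'.
    case/eqP: ne; apply: ab_inj; congr pair; first by rewrite ar' (eqP ar).
    by have := bE r; have := bE r0; rewrite br' (eqP br); lia.
  rewrite big1 ?addr0; last by move=> r h; have := none r; rewrite /= h.
  by rewrite big1// => r ar; have := none r; rewrite /= ar/= => ->.
under eq_bigr do rewrite wE.
rewrite exchange_big/=; apply: eq_bigr => r _.
rewrite (occupied_site sz (bE r)); case: existsP => [[i0 i0E]|none].
  rewrite (bigD1 i0)//= eq_sym i0E big1 ?mulr1// => i ne.
  case: eqP => // e; case/eqP: ne; apply: (@site_inj N la); rewrite -e.
  exact/esym/eqP.
rewrite big1// => i _; case: eqP => // e; case: none; exists i.
by rewrite e.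
Qed.

End Occupation.

Section WordCorrelation.
Variables (R : realType) (w : seq (letter R)) (D : R -> Prop) (rin rout : R).
Hypothesis sorted_w : sorted ltn (labels w).
Hypothesis wD : letter_in D w.
Hypothesis wgood : all (@good R) w.
Hypothesis plus_ok : radii_for D rout rin.
Hypothesis minus_ok : radii_for D rin rout.
Hypothesis rio : rin < rout.
Variables (d : nat) (a : 'I_d -> nat) (bz : 'I_d -> int) (u : 'I_d -> R).
Hypothesis ab_inj : injective (fun r => (a r, bz r)).
Hypothesis aw : forall r, a r \in labels w.
Hypothesis u0 : forall r, 0 <= u r.

(** By [ker_real], taking the real part loses nothing. *)
Definition word_kernel (s : nat) (i : int) (t : nat) (j : int) : R :=
  complex.Re ((if (t < s)%N then ker rin rout else ker rout rin)
    (ups (before s w)) (downs (after s w)) (ups (before t w)) (downs (after t w)) i j).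

Let uniq_w : uniq (labels w).
Proof. by apply: sorted_uniq sorted_w; [exact: ltn_trans|exact: ltnn]. Qed.

(* [N] exceeds the depth [M] of the prescribed points by the number of [Up]
   letters: the kernel then vanishes at all sites below 0 along the word. *)
Let M : nat := \max_(r < d) `|bz r|%N.
Let N : nat := (M + size (ups w))%N.
Let b (r : 'I_d) : nat := `|(bz r + N%:Z)%R|%N.

Let Mb r : - M%:Z <= bz r.
Proof.
have : (`|bz r| <= M)%N by exact: (bigop.bigmax_sup r).
lia.
Qed.

Let bE r : (b r)%:Z = bz r + N%:Z.
Proof. by rewrite /b; have := Mb r; rewrite /N; lia. Qed.

Let kap suf (k : nat) : 'rV[R]_d := \row_c complex.Re
  (wker w rin rout (a c \in labels suf) (a c) (take (size w - size suf) w) suf (bz c) (k%:Z - N%:Z)).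

Let takeE pre suf : w = pre ++ suf -> take (size w - size suf) w = pre.
Proof. by move=> wE; rewrite {2}wE take_size_cat// {1}wE size_cat addnK. Qed.

Let Re_real (x : R) (z : R[i]) : complex.Re (x%:C * z) = x * complex.Re z.
Proof. by rewrite cReM /= mul0r subr0. Qed.

Let kap_step pre l suf : w = pre ++ l :: suf ->
  kernel_step a b l (kap (l :: suf)) (kap suf).
Proof.
move=> wE; have wE' : w = rcons pre l ++ suf by rewrite cat_rcons.
have ReB (z z' : R[i]) : complex.Re (z - z') = complex.Re z - complex.Re z'.
  by rewrite -mulN1r cReD cReM/= oppr0 mul0r subr0 mulN1r.
rewrite /kernel_step /kap (takeE wE) (takeE wE').
case: l wE wE' => [x|y|s] wE wE'.
- have Dx : D x.
    by case: wD => + _; rewrite wE ups_cat /= elems_in_cat => -[_]; apply; rewrite mem_head.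
  have /andP[x0 x1] : 0 <= x < 1.
    by move: wgood; rewrite wE all_cat /= => /and3P[].
  split => [k c|k].
    have [_ _ dec] := wker_family wD plus_ok minus_ok (a c \in labels (Up x :: suf)) (a c) wE.
    have := dec x (bz c) (k%:Z - N%:Z) Dx; rewrite /decay => dec'; apply: norm_cvg0.
    apply: (@squeeze_cvgr _ _ _ _ (cst 0) _ _ _ _ _ dec'); last exact: cvg_cst.
    apply: nearW => L; rewrite normr_ge0/= normrM normrX (ger0_norm x0) mxE.
    rewrite ler_wpM2l ?exprn_ge0// (_ : (k + L)%:Z - N%:Z = k%:Z - N%:Z + L%:Z); last by lia.
    exact: Re_le_normc.
  apply/rowP => c; rewrite !mxE (_ : k.+1%:Z - N%:Z = k%:Z - N%:Z + 1); last by lia.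
  rewrite [labels (_ :: _)]/= (wker_Up wD plus_ok minus_ok _ _ _ _ wE) ReB Re_real; ring.
- split.
    apply/rowP => c; rewrite !mxE [labels (_ :: _)]/=.
    rewrite (wker_Down wD plus_ok minus_ok _ _ _ _ wE) ReB Re_real.
    rewrite [X in _ - y * complex.Re X](@wker_vanish _ _ _ _ _ sorted_w wD plus_ok minus_ok rio _ M)//=.
    + by rewrite mulr0 subr0.
    + rewrite /N wE ups_cat size_cat; lia.
  move=> k; apply/rowP => c; rewrite !mxE [labels (_ :: _)]/=.
  rewrite (wker_Down wD plus_ok minus_ok _ _ _ _ wE) ReB Re_real.
  by rewrite (_ : k.+1%:Z - N%:Z - 1 = k%:Z - N%:Z); [ring|lia].
- move=> k; apply/rowP => c; rewrite !mxE summxE.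
  have [ns1 ns2] : s \notin labels suf /\ s \notin labels pre.
    move: uniq_w; rewrite wE labels_cat cat_uniq /= => /and3P[_ /norP[h _] /andP[h' _]].
    by split.
  have sumE : \sum_(i < d | (a i == s) && (b i == k)) (delta_mx 0 i : 'rV[R]_d) 0 c =
      ((a c == s) && (b c == k))%:R.
    case h : ((a c == s) && (b c == k)).
      rewrite (bigD1 c)//= big1 ?addr0 ?mxE ?eqxx// => i /andP[_ ne].
      by rewrite mxE eq_sym (negPf ne) andbF.
    rewrite big1// => i hi; rewrite mxE /=; case: eqP => // e.
    by move: h; rewrite e hi.
  rewrite sumE [labels (_ :: _)]/= inE; case: (eqVneq (a c) s) => [e|ne] /=.
    rewrite e (negPf ns1); have := wker_jump sorted_w wD plus_ok minus_ok rio (bz c) (k%:Z - N%:Z) wE.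
    move=> /(canRL (subrK _)) ->; rewrite cReD.
    have -> : (k%:Z - N%:Z == bz c) = (b c == k) by have := bE c; lia.
    by case: (b c == k) => /=; ring.
  rewrite subr0 /wker -cats1 ups_cat /= cats0.
  by case: (a c \in labels suf).
Qed.

Let before_after_in s : s \in labels w ->
  [/\ elems_in D (ups (before s w)) & elems_in D (downs (after s w))].
Proof.
move=> sw; have := split_obs sw => wE; case: wD.
rewrite {1 2}wE ups_cat downs_cat /= !elems_in_cat => -[h1 _] [_ h2].
by split.
Qed.

Let kap_end k : (N <= k)%N -> kap [::] k = 0.
Proof.
move=> Nk; apply/rowP => c; rewrite !mxE in_nil /wker subn0 take_size.
have [h1 h2] := before_after_in (aw c); rewrite (ker_end _ plus_ok)//; last by lia.
by case: wD.
Qed.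

Let kap_start k : (k < N)%N -> kap w k = 0.
Proof.
move=> kN; apply/rowP => c; rewrite !mxE aw /wker subnn take0.
have [h1 h2] := before_after_in (aw c); rewrite (ker_start _ minus_ok)//; last by lia.
by case: wD.
Qed.

Let after_obs pre s suf : w = pre ++ Obs s :: suf -> after s w = suf.
Proof. by move=> wE; have [] := split_obs_uniq uniq_w wE. Qed.

Let obs_order r c : has (is_obs (a c)) (after (a r) w) -> (a r < a c)%N.
Proof. by rewrite has_obs ltn_labels. Qed.

Let kernelE r c : kap (after (a r) w) (b r) 0 c = word_kernel (a c) (bz c) (a r) (bz r).
Proof.
have wE := split_obs (aw r).
have wE' : w = rcons (before (a r) w) (Obs (a r)) ++ after (a r) w by rewrite cat_rcons.
rewrite mxE (takeE wE') ltn_labels// bE addrK /word_kernel /wker -cats1 ups_cat /= cats0.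
by case: ltnP.
Qed.

(** [det_cols_obs] with the contour integrals as kernel; the minor without
    observation weights is the partition function. *)
Theorem word_correlation :
  path_sum (obs_factor a bz u) w empty_part =
  (Zword [::] w * \det (1%:M + \matrix_(r, c) (u r * word_kernel (a c) (bz c) (a r) (bz r))))%:E.
Proof.
have o0 s la : 0 <= obs_factor a bz u s la.
  by apply: prodr_ge0 => r _; case: ifP => // _; rewrite addr_ge0.
have bv s : exists C : R, forall k, `|obs_weight a b u s k| <= C.
  exists (1 + \sum_r u r) => k; rewrite /obs_weight ger0_norm; last by rewrite addr_ge0// sumr_ge0.
  rewrite lerD2l [X in _ <= X](bigID (fun r => (a r == s) && (b r == k)))/= lerDl.
  by apply: sumr_ge0.
have sz : (size empty_part + size (ups w) <= N)%N by rewrite add0n leq_addl.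
rewrite (path_sum_minor (N := N) o0 bv) //; last first.
  by move=> s la sla; apply: obs_factor_sites.
congr EFin; rewrite (det_cols_obs u wgood after_obs obs_order kap_step kap_end kap_start).
congr (_ * _); last first.
  by congr (\det (_ + _)); apply/matrixP => r c; rewrite [LHS]mxE [RHS]mxE kernelE.
apply: (@EFin_inj R); rewrite -(path_sum_Zword (xs := [::]))//=.
apply/esym; apply: (@path_sum_minor R N (fun _ _ => 1) (fun _ _ => 1)) => //.
- by move=> s; exists 1 => k; rewrite normr1.
- by move=> s la _; rewrite big1.
Qed.

End WordCorrelation.

(** * The Schur process as a walk *)

Section ProcessWord.
Variable R : realType.
Implicit Types (la mu nu : intpart) (x y : R) (xs ys : seq R) (w : seq (letter R)).

(** The constant may be infinite, so that this applies to path sums before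
    these are known to be finite. *)
Lemma esumZr (T : choiceType) (A : set T) (c : T -> R) (y : \bar R) :
  (forall i, A i -> 0 <= c i) -> (0 <= y)%E ->
  (\esum_(i in A) ((c i)%:E * y) = (\esum_(i in A) (c i)%:E) * y)%E.
Proof.
move=> c0; case: y => [r| |] // r0.
  under eq_esum do rewrite muleC.
  by rewrite esumZl 1?muleC// => i Ai; rewrite lee_fin c0.
have [[i [Ai ci]]|nz] := pselect (exists i, A i /\ 0 < c i).
  have pos : (0 < \esum_(i in A) (c i)%:E)%E.
    apply: (@lt_le_trans _ _ (c i)%:E); first by rewrite lte_fin.
    apply: esum_ge; exists [set i]; last by rewrite fsbig_set1.
    by split; [exact: finite_set1|move=> j ->].
  rewrite gt0_muley//; apply/eqP; rewrite eq_le leey/=.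
  apply: esum_ge; exists [set i]; last by rewrite fsbig_set1 gt0_muley.
  by split; [exact: finite_set1|move=> j ->].
have z i : A i -> c i = 0.
  move=> Ai; apply/eqP; rewrite eq_le c0// andbT leNgt; apply/negP => ci.
  by apply: nz; exists i.
rewrite [X in (X * _)%E]esum1 ?mul0e; last by move=> i /z ->.
by rewrite esum1// => i /z ->; rewrite mul0e.
Qed.

Variable o : nat -> intpart -> R.
Hypothesis o0 : forall s la, 0 <= o s la.

Definition nonneg xs := forall x, x \in xs -> 0 <= x.

Lemma nonneg_cons x xs : nonneg (x :: xs) -> 0 <= x /\ nonneg xs.
Proof.
move=> h; split; first by apply: h; rewrite mem_head.
by move=> z zx; apply: h; rewrite inE zx orbT.
Qed.

Lemma path_sum_Up x w mu : path_sum o (Up x :: w) mu =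
  (\esum_(la in [set la | hstrip mu la]) (x ^+ (sumn la - sumn mu))%:E * path_sum o w la)%E.
Proof. by []. Qed.

Lemma path_sum_Down y w la : path_sum o (Down y :: w) la =
  (\esum_(mu in [set mu | hstrip mu la]) (y ^+ (sumn la - sumn mu))%:E * path_sum o w mu)%E.
Proof. by []. Qed.

Lemma path_sum_Ups_cat xs w mu : nonneg xs -> (forall la, 0 <= path_sum o w la)%E ->
  path_sum o (map (@Up R) xs ++ w) mu =
  (\esum_(la in [set: intpart]) (skew_schur la mu xs)%:E * path_sum o w la)%E.
Proof.
move=> + w0; elim: xs mu => [|x xs IH] mu xs0.
  rewrite (@esum_single _ _ _ mu)//= ?skew_schur_nil ?eqxx ?mul1e//.
  by move=> la _ /eqP/negPf ne; rewrite skew_schur_nil ne mul0e.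
have [x0 xs0'] := nonneg_cons xs0.
rewrite map_cons cat_cons path_sum_Up.
under eq_esum => nu hs.
  rewrite IH// -esumZl ?exprn_ge0//; last first.
    by move=> la _; rewrite mule_ge0// lee_fin skew_schur_ge0.
  over.
rewrite esum_exchange; last first.
  by move=> nu la _ _; rewrite !mule_ge0 ?lee_fin ?exprn_ge0 ?skew_schur_ge0.
apply: eq_esum => la _; rewrite schur_branching//.
rewrite -esumZr//; last by move=> nu _; rewrite mulr_ge0 ?exprn_ge0 ?skew_schur_ge0.
by apply: eq_esum => nu _; rewrite EFinM muleA.
Qed.

(** The variables are read in reverse, since the branching rule splits off the
    strip next to the smaller partition, which [Down] letters remove last. *)
Lemma path_sum_Downs_cat ys w la : nonneg ys -> (forall mu, 0 <= path_sum o w mu)%E ->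
  path_sum o (map (@Down R) (rev ys) ++ w) la =
  (\esum_(mu in [set: intpart]) (skew_schur la mu ys)%:E * path_sum o w mu)%E.
Proof.
elim: ys w la => [|y ys IH] w la ys0 w0.
  rewrite (@esum_single _ _ _ la)//= ?skew_schur_nil ?eqxx ?mul1e//.
  by move=> mu _ /eqP; rewrite eq_sym skew_schur_nil => /negPf ->; rewrite mul0e.
have [y0 ys0'] := nonneg_cons ys0.
rewrite rev_cons map_rcons cat_rcons IH//; last first.
  move=> mu /=; apply: esum_ge0 => nu _; rewrite mule_ge0// lee_fin exprn_ge0//.
under eq_esum => nu _.
  rewrite path_sum_Down -esumZl ?skew_schur_ge0//; last first.
    by move=> mu _; rewrite mule_ge0// lee_fin exprn_ge0.
  rewrite esum_mkcond; over.
rewrite esum_exchange; last first.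
  move=> nu mu _ _; case: ifP => // _.
  by rewrite !mule_ge0 ?lee_fin ?exprn_ge0 ?skew_schur_ge0.
apply: eq_esum => mu _; rewrite schur_branching//.
rewrite -esumZr//; last by move=> nu _; rewrite mulr_ge0 ?exprn_ge0 ?skew_schur_ge0.
rewrite [RHS]esum_mkcond; apply: eq_esum => nu _.
have -> : (mu \in [set mu0 | hstrip mu0 nu]) = (nu \in [set nu0 | hstrip mu nu0]).
  by apply/idP/idP => /set_mem h; apply: mem_set.
by case: ifP => // _; rewrite EFinM muleCA muleA.
Qed.

Lemma all_flatten (T : Type) (a : pred T) (ss : seq (seq T)) :
  all a (flatten ss) = all (all a) ss.
Proof. by elim: ss => //= s ss IH; rewrite all_cat IH. Qed.

Definition block xs s ys : seq (letter R) :=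
  map (@Up R) xs ++ Obs s :: map (@Down R) (rev ys).

Definition fcons (T : Type) n (p : T) (f : {ffun 'I_n -> T}) : {ffun 'I_n.+1 -> T} :=
  [ffun i => if unlift ord0 i is Some j then f j else p].

Lemma fcons0 (T : Type) n (p : T) (f : {ffun 'I_n -> T}) : fcons p f ord0 = p.
Proof. by rewrite ffunE unlift_none. Qed.

Lemma fconsS (T : Type) n (p : T) (f : {ffun 'I_n -> T}) i : fcons p f (lift ord0 i) = f i.
Proof. by rewrite ffunE liftK. Qed.

Lemma esum_fcons (T : choiceType) n (G : {ffun 'I_n.+1 -> T} -> \bar R) :
  (forall f, 0 <= G f)%E ->
  (\esum_(f in [set: {ffun 'I_n.+1 -> T}]) G f =
   \esum_(p in [set: T]) \esum_(f in [set: {ffun 'I_n -> T}]) G (fcons p f))%E.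
Proof.
move=> G0; rewrite esum_esum//; apply: reindex_esum; split => //=.
- move=> [p f] [p' f'] _ _ /= e.
  have ep : p = p' by have := congr1 (fun g : {ffun _} => g ord0) e; rewrite !fcons0.
  have ef : f = f'.
    by apply/ffunP => i; have := congr1 (fun g : {ffun _} => g (lift ord0 i)) e; rewrite !fconsS.
  by rewrite ep ef.
- move=> g _; exists (g ord0, [ffun i => g (lift ord0 i)]) => //=.
  apply/ffunP => i; rewrite ffunE; case: unliftP => [j ->|->] //.
  by rewrite ffunE.
Qed.

Lemma esum_ffun0 (T : choiceType) (G : {ffun 'I_0 -> T} -> \bar R) (f0 : {ffun 'I_0 -> T}) :
  (0 <= G f0)%E -> (\esum_(f in [set: {ffun 'I_0 -> T}]) G f = G f0)%E.
Proof.
move=> G0; rewrite (@esum_single _ _ _ f0)// => f _; case.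
by apply/ffunP => -[].
Qed.

(** The Schur weight with an arbitrary starting partition in place of the empty
    one, which is the form that allows induction on the number of levels. *)
Definition chain_weight n (X Y : 'I_n.+1 -> seq R) (start : intpart)
    (la : {ffun 'I_n.+1 -> intpart}) (mu : {ffun 'I_n -> intpart}) : R :=
  skew_schur (la ord0) start (X ord0)
  * (\prod_(i < n)
       (skew_schur (la (lift ord0 i)) (mu i) (X (lift ord0 i))
        * skew_schur (la (widen_ord (leqnSn n) i)) (mu i)
            (Y (widen_ord (leqnSn n) i))))
  * schur (la ord_max) (Y ord_max).

Lemma chain_weight_ge0 n (X Y : 'I_n.+1 -> seq R) start
    (la : {ffun 'I_n.+1 -> intpart}) (mu : {ffun 'I_n -> intpart}) :
  (forall k, nonneg (X k)) -> (forall k, nonneg (Y k)) -> 0 <= chain_weight X Y start la mu.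
Proof.
move=> X0 Y0; rewrite !mulr_ge0 ?skew_schur_ge0//; do ?exact: X0; do ?exact: Y0.
by apply: prodr_ge0 => i _; rewrite mulr_ge0 ?skew_schur_ge0//; [exact: X0|exact: Y0].
Qed.

Lemma chain_weightS n (X Y : 'I_n.+2 -> seq R) start p (la : {ffun 'I_n.+1 -> intpart})
    m (mu : {ffun 'I_n -> intpart}) :
  chain_weight X Y start (fcons p la) (fcons m mu) =
  skew_schur p start (X ord0) * skew_schur p m (Y ord0) *
  chain_weight (X \o lift ord0) (Y \o lift ord0) m la mu.
Proof.
rewrite /chain_weight fcons0 big_ord_recl.
have w0 : widen_ord (leqnSn n.+1) ord0 = ord0 by apply: val_inj.
have -> : ord_max = lift ord0 ord_max :> 'I_n.+2 by apply: val_inj.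
have wl (i : 'I_n) : widen_ord (leqnSn n.+1) (lift ord0 i) = lift ord0 (widen_ord (leqnSn n) i).
  exact: val_inj.
rewrite w0 !fcons0 !fconsS /=.
under eq_bigr do rewrite wl !fconsS.
ring.
Qed.

Lemma chain_sum n (X Y : 'I_n.+1 -> seq R) (lab : 'I_n.+1 -> nat) start :
  (forall k, {in X k, forall x, 0 <= x < 1}) -> (forall k, {in Y k, forall x, 0 <= x < 1}) ->
  (\esum_(la in [set: {ffun 'I_n.+1 -> intpart}])
     \esum_(mu in [set: {ffun 'I_n -> intpart}])
       (chain_weight X Y start la mu * \prod_k o (lab k) (la k))%:E)%E =
  path_sum o (flatten [seq block (X k) (lab k) (Y k) | k <- enum 'I_n.+1]) start.
Proof.
have gU xs : {in xs, forall x, 0 <= x < 1} -> all (@good R) (map (@Up R) xs).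
  by move=> h; rewrite all_map; apply/allP => x /h.
have gD xs : {in xs, forall x, 0 <= x < 1} -> all (@good R) (map (@Down R) (rev xs)).
  by move=> h; rewrite all_map; apply/allP => x; rewrite mem_rev => /h.
have nn xs : {in xs, forall x, 0 <= x < 1} -> nonneg xs by move=> h x /h/andP[].
elim: n X Y lab start => [|n IH] X Y lab start hX hY.
  rewrite enum_ordSl enum_ord0 /= cats0 path_sum_Ups_cat; last 2 first.
  - exact/nn/hX.
  - by move=> la; apply: path_sum_ge0 => //=; exact: gD.
  have X0 k := nn _ (hX k); have Y0 k := nn _ (hY k).
  have o0' (la : {ffun 'I_1 -> intpart}) : 0 <= \prod_(k < 1) o (lab k) (la k) by apply: prodr_ge0.
  rewrite esum_fcons; last first.
    by move=> f; apply: esum_ge0 => mu _; rewrite lee_fin mulr_ge0 ?chain_weight_ge0//.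
  apply: eq_esum => la _.
  pose f0 : {ffun 'I_0 -> intpart} := [ffun=> empty_part].
  rewrite (@esum_ffun0 _ _ f0); last first.
    by apply: esum_ge0 => mu _; rewrite lee_fin mulr_ge0 ?chain_weight_ge0//.
  rewrite (@esum_ffun0 _ _ f0); last first.
    by rewrite lee_fin mulr_ge0 ?chain_weight_ge0//.
  rewrite big_ord1 /chain_weight big_ord0 mulr1.
  have -> : ord_max = ord0 :> 'I_1 by apply: val_inj.
  rewrite fcons0 /= -(cats0 (map (@Down R) _)) path_sum_Downs_cat; last 2 first.
  - exact: Y0.
  - by move=> mu; rewrite /= lee_fin ler0n.
  rewrite (@esum_single _ _ _ empty_part)//=.
  + by rewrite ?eqxx mule1 -!EFinM /schur mulrAC mulrA.
  + by rewrite ?eqxx mule1 lee_fin skew_schur_ge0//; exact: Y0.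
  + by move=> mu _ /eqP/negPf ->; rewrite mule0.
have X0 k := nn _ (hX k); have Y0 k := nn _ (hY k).
set w' := flatten [seq block ((X \o lift ord0) k) ((lab \o lift ord0) k) ((Y \o lift ord0) k) | k <- enum 'I_n.+1].
have gw' : all (@good R) w'.
  rewrite /w' all_flatten all_map; apply/allP => k _ /=.
  by rewrite /block all_cat /= gU ?gD//; (exact: hX || exact: hY).
have -> : flatten [seq block (X k) (lab k) (Y k) | k <- enum 'I_n.+2] =
    map (@Up R) (X ord0) ++ Obs (lab ord0) :: (map (@Down R) (rev (Y ord0)) ++ w').
  rewrite enum_ordSl /= {1}/block -catA /=; congr (_ ++ _ :: (_ ++ _)).
  by rewrite /w' -map_comp.
have gYw : all (@good R) (map (@Down R) (rev (Y ord0)) ++ w') by rewrite all_cat gw' gD.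
rewrite path_sum_Ups_cat//; last by move=> la; exact: path_sum_ge0.
have o0' m (la : {ffun 'I_m -> intpart}) (l : 'I_m -> nat) : 0 <= \prod_(k < m) o (l k) (la k).
  exact: prodr_ge0.
have cX k : nonneg ((X \o lift ord0) k) by exact: X0.
have cY k : nonneg ((Y \o lift ord0) k) by exact: Y0.
rewrite esum_fcons; last first.
  by move=> f; apply: esum_ge0 => mu _; rewrite lee_fin mulr_ge0 ?chain_weight_ge0//.
apply: eq_esum => p _ /=.
rewrite path_sum_Downs_cat//; last by move=> mu; exact: path_sum_ge0.
rewrite muleA -EFinM -esumZl; last 2 first.
- by rewrite mulr_ge0// skew_schur_ge0//; exact: X0.
- move=> m _; rewrite mule_ge0 ?path_sum_ge0// lee_fin skew_schur_ge0//; exact: Y0.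
transitivity (\esum_(la in [set: {ffun 'I_n.+1 -> intpart}])
    \esum_(m in [set: intpart]) \esum_(mu in [set: {ffun 'I_n -> intpart}])
    (chain_weight X Y start (fcons p la) (fcons m mu) *
     \prod_k o (lab k) (fcons p la k))%:E)%E.
  apply: eq_esum => la _. apply: (@esum_fcons intpart n
    (fun mu : {ffun 'I_n.+1 -> intpart} => (chain_weight X Y start (fcons p la) mu * \prod_k o (lab k) (fcons p la k))%:E)).
  by move=> f; rewrite lee_fin mulr_ge0 ?chain_weight_ge0//.
rewrite esum_exchange; last first.
  by move=> la m _ _; apply: esum_ge0 => mu _; rewrite lee_fin mulr_ge0 ?chain_weight_ge0//.
apply: eq_esum => m _.
rewrite -IH; last 2 first.
- by move=> k; exact: hX.
- by move=> k; exact: hY.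
rewrite muleA -EFinM -esumZl; last 2 first.
- by rewrite !mulr_ge0// skew_schur_ge0//; [exact: X0|exact: Y0].
- by move=> la _; apply: esum_ge0 => mu _; rewrite lee_fin mulr_ge0 ?chain_weight_ge0//.
apply: eq_esum => la _; rewrite -esumZl; last 2 first.
- by rewrite !mulr_ge0// skew_schur_ge0//; [exact: X0|exact: Y0].
- by move=> mu _; rewrite lee_fin mulr_ge0 ?chain_weight_ge0//.
apply: eq_esum => mu _; rewrite -EFinM; congr EFin.
rewrite chain_weightS big_ord_recl fcons0.
have -> : \prod_(i < n.+1) o (lab (lift ord0 i)) (fcons p la (lift ord0 i)) =
    \prod_(i < n.+1) o (lab (lift ord0 i)) (la i).
  by apply: eq_bigr => i _; rewrite fconsS.
by rewrite /=; ring.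
Qed.

End ProcessWord.

(** * The word of the Schur process *)

Section SchurWord.
Variable (R : realType).

Definition schur_word n (X Y : 'I_n -> seq R) (lab : 'I_n -> nat) : seq (letter R) :=
  flatten [seq block (X k) (lab k) (Y k) | k <- enum 'I_n].

Definition seg_word (I : Type) (X Y : I -> seq R) (lab : I -> nat) (ks : seq I) : seq (letter R) :=
  flatten [seq block (X k) (lab k) (Y k) | k <- ks].

Lemma ups_map_Up (xs : seq R) : ups (map (@Up R) xs) = xs.
Proof. by elim: xs => //= x xs ->. Qed.
Lemma ups_map_Down (xs : seq R) : ups (map (@Down R) xs) = [::].
Proof. by elim: xs. Qed.
Lemma downs_map_Up (xs : seq R) : downs (map (@Up R) xs) = [::].
Proof. by elim: xs. Qed.
Lemma downs_map_Down (xs : seq R) : downs (map (@Down R) xs) = xs.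
Proof. by elim: xs => //= x xs ->. Qed.
Lemma labels_map_Up (xs : seq R) : labels (map (@Up R) xs) = [::].
Proof. by elim: xs. Qed.
Lemma labels_map_Down (xs : seq R) : labels (map (@Down R) xs) = [::].
Proof. by elim: xs. Qed.

Section Segments.
Variables (I : Type) (X Y : I -> seq R) (lab : I -> nat).
Implicit Type ks : seq I.
Local Notation seg := (seg_word X Y lab).

Lemma ups_seg ks : ups (seg ks) = flatten [seq X k | k <- ks].
Proof.
elim: ks => //= k ks IH; rewrite /seg_word /= ups_cat [ups (block _ _ _)]ups_cat /=.
by rewrite ups_map_Up ups_map_Down cats0 IH.
Qed.

Lemma downs_seg ks : downs (seg ks) = flatten [seq rev (Y k) | k <- ks].
Proof.
elim: ks => //= k ks IH; rewrite /seg_word /= downs_cat [downs (block _ _ _)]downs_cat /=.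
by rewrite downs_map_Up downs_map_Down IH.
Qed.

Lemma labels_seg ks : labels (seg ks) = map lab ks.
Proof.
elim: ks => //= k ks IH; rewrite /seg_word /= labels_cat [labels (block _ _ _)]labels_cat /=.
by rewrite labels_map_Up labels_map_Down IH.
Qed.

Lemma seg_split k1 s k2 : seg (k1 ++ s :: k2) =
  (seg k1 ++ map (@Up R) (X s)) ++ Obs (lab s) :: (map (@Down R) (rev (Y s)) ++ seg k2).
Proof.
rewrite /seg_word map_cat flatten_cat /= /block -!catA; congr (_ ++ (_ ++ _)).
Qed.

Lemma good_seg ks : (forall k, {in X k, forall x, 0 <= x < 1}) ->
  (forall k, {in Y k, forall x, 0 <= x < 1}) -> all (@good R) (seg ks).
Proof.
move=> hX hY; rewrite all_flatten all_map; elim: ks => //= k ks ->; rewrite andbT.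
rewrite /block all_cat /= !all_map; apply/andP; split; apply/allP => x /=.
  exact: hX.
by rewrite mem_rev; exact: hY.
Qed.
End Segments.

Section Word.
Variables (n : nat) (X Y : 'I_n -> seq R).
Let w := schur_word X Y (fun k => k : nat).

Lemma labels_schur_word : labels w = iota 0 n.
Proof. by rewrite /w /schur_word labels_seg val_enum_ord. Qed.

Lemma sorted_schur_word : sorted ltn (labels w).
Proof. by rewrite labels_schur_word iota_ltn_sorted. Qed.

Lemma label_schur_word (s : 'I_n) : (s : nat) \in labels w.
Proof. by rewrite labels_schur_word mem_iota add0n ltn_ord. Qed.

Lemma enum_split (s : 'I_n) : exists k1 k2, enum 'I_n = k1 ++ s :: k2 /\
  (forall k, k \in k1 -> (k < s)%N) /\ (forall k, k \in k2 -> (s < k)%N).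
Proof.
have se : s \in enum 'I_n by rewrite mem_enum.
have so : pairwise ltn (map val (enum 'I_n)).
  by rewrite val_enum_ord -sorted_pairwise ?iota_ltn_sorted//; exact: ltn_trans.
case/splitPr: se so => k1 k2; rewrite map_cat pairwise_cat /= => /and4P[/allrelP h _ /allP h2 _].
exists k1, k2; split=> //; split=> k kk.
  by apply: h; [exact: map_f|rewrite inE eqxx].
by apply: h2; exact: map_f.
Qed.

Lemma perm_index_enum : perm_eq (index_enum 'I_n) (enum 'I_n).
Proof.
apply: uniq_perm; rewrite ?index_enum_uniq ?enum_uniq// => k.
by rewrite mem_index_enum mem_enum.
Qed.

Lemma prod_ups_before (F : comNzRingType) (G : R -> F) (s : 'I_n) :
  \prod_(x <- ups (before s w)) G x = \prod_(k < n | (k <= s)%N) \prod_(x <- X k) G x.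
Proof.
have [k1 [k2 [e [h1 h2]]]] := enum_split s.
have wE := seg_split X Y (fun k : 'I_n => k : nat) k1 s k2; rewrite -e in wE.
have un : uniq (labels w) by rewrite labels_schur_word iota_uniq.
have [-> _] := split_obs_uniq un wE.
rewrite ups_cat ups_map_Up ups_seg big_cat big_flatten big_map /=.
rewrite [RHS](perm_big (enum 'I_n)) ?perm_index_enum// e big_cat big_cons leqnn /=.
rewrite [X in _ = _ * (_ * X)]big_seq_cond [X in _ = _ * (_ * X)]big_pred0 ?mulr1; last first.
  by move=> k; apply/negbTE/andP => -[/h2]; rewrite ltnNge => /negP.
congr (_ * _); rewrite big_seq [RHS]big_seq_cond; apply: eq_bigl => k.
by case: (boolP (k \in k1)) => //= /h1/ltnW ->.
Qed.

Lemma prod_downs_after (F : comNzRingType) (G : R -> F) (s : 'I_n) :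
  \prod_(x <- downs (after s w)) G x = \prod_(k < n | (s <= k)%N) \prod_(x <- Y k) G x.
Proof.
have [k1 [k2 [e [h1 h2]]]] := enum_split s.
have wE := seg_split X Y (fun k : 'I_n => k : nat) k1 s k2; rewrite -e in wE.
have un : uniq (labels w) by rewrite labels_schur_word iota_uniq.
have [_ ->] := split_obs_uniq un wE.
rewrite downs_cat downs_map_Down downs_seg big_cat big_flatten big_map /=.
rewrite [RHS](perm_big (enum 'I_n)) ?perm_index_enum// e big_cat big_cons leqnn /=.
rewrite [X in _ = X * _]big_seq_cond [X in _ = X * _]big_pred0 ?mul1r; last first.
  by move=> k; apply/negbTE/andP => -[/h1]; rewrite ltnNge => /negP.
congr (_ * _); first by apply: perm_big; rewrite perm_rev.
rewrite big_seq [RHS]big_seq_cond; apply: eq_big => k.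
  by case: (boolP (k \in k2)) => //= /h2/ltnW ->.
by move=> _; apply: perm_big; rewrite perm_rev.
Qed.

End Word.

Lemma Fprod_cat (K : fieldType) (A B C : seq K) :
  Fprod (A ++ B) C = Fprod A C * Fprod B C.
Proof. by rewrite /Fprod big_cat. Qed.

Lemma Zword_Ups (xs us : seq R) w : Zword xs (map (@Up R) us ++ w) = Zword (xs ++ us) w.
Proof. by elim: us xs => [|x us IH] xs /=; rewrite ?cats0// IH cat_rcons. Qed.

Lemma Zword_Downs (xs vs : seq R) w :
  Zword xs (map (@Down R) vs ++ w) = Fprod xs vs * Zword xs w.
Proof.
elim: vs => [|y vs IH] /=; first by rewrite /Fprod big1 ?mul1r// => x _; rewrite big_nil.
rewrite IH mulrA; congr (_ * _); rewrite /Fprod -big_split /=.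
by apply: eq_bigr => x _; rewrite big_cons.
Qed.

Lemma Zword_schur_word n (X Y : 'I_n -> seq R) lab (xs : seq R) :
  Zword xs (schur_word X Y lab) = (\prod_j Fprod xs (Y j)) *
    \prod_(i < n) \prod_(j < n | (i <= j)%N) Fprod (X i) (Y j).
Proof.
elim: n X Y lab xs => [|n IH] X Y lab xs.
  by rewrite /schur_word !big_ord0 mulr1 (size0nil (size_enum_ord 0)).
have -> : schur_word X Y lab = map (@Up R) (X ord0) ++ Obs (lab ord0) ::
    (map (@Down R) (rev (Y ord0)) ++
     schur_word (X \o lift ord0) (Y \o lift ord0) (lab \o lift ord0)).
  rewrite /schur_word enum_ordSl /= {1}/block -catA /=; congr (_ ++ _ :: (_ ++ _)).
  by rewrite -map_comp.
rewrite Zword_Ups /= Zword_Downs IH.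
have rv : Fprod (xs ++ X ord0) (rev (Y ord0)) = Fprod (xs ++ X ord0) (Y ord0).
  by rewrite /Fprod; apply: eq_bigr => x _; apply: perm_big; rewrite perm_rev.
rewrite rv Fprod_cat.
have sp : \prod_(j < n) Fprod (xs ++ X ord0) ((Y \o lift ord0) j) =
    \prod_(j < n) Fprod xs (Y (lift ord0 j)) * \prod_(j < n) Fprod (X ord0) (Y (lift ord0 j)).
  by rewrite -big_split; apply: eq_bigr => j _; rewrite Fprod_cat.
rewrite sp [X in _ = X * _]big_ord_recl [X in _ = _ * X]big_ord_recl.
have -> : \prod_(j < n.+1 | (@ord0 n <= j)%N) Fprod (X ord0) (Y j) =
    Fprod (X ord0) (Y ord0) * \prod_(j < n) Fprod (X ord0) (Y (lift ord0 j)).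
  by rewrite big_mkcond big_ord_recl.
have -> : \prod_(i < n) \prod_(j < n.+1 | (lift ord0 i <= j)%N) Fprod (X (lift ord0 i)) (Y j) =
    \prod_(i < n) \prod_(j < n | (i <= j)%N) Fprod ((X \o lift ord0) i) ((Y \o lift ord0) j).
  apply: eq_bigr => i _; rewrite big_mkcond big_ord_recl /= mul1r [RHS]big_mkcond.
  by apply: eq_bigr => j _.
by rewrite /=; ring.
Qed.

End SchurWord.

(** * From the generating function to correlations *)

Section MultiAffine.
Variables (R : realType) (d : nat).
Implicit Types (K : 'M[R]_d) (J : {set 'I_d}) (u : 'I_d -> R).

(** The coefficient of the product of [u r] over [r \in J] in [det (1 + u K)],
    still depending on the other [u r]. *)
Definition mixed_det K J u : R :=
  \det (\matrix_(r < d) (if r \in J then row r K else delta_mx 0 r + u r *: row r K)).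

Definition set_at u (r0 : 'I_d) (x : R) : 'I_d -> R := fun r => if r == r0 then x else u r.

Lemma mixed_det_diff K J u r0 : r0 \in J ->
  mixed_det K J u = mixed_det K (J :\ r0) (set_at u r0 1) - mixed_det K (J :\ r0) (set_at u r0 0).
Proof.
move=> r0J; rewrite /mixed_det.
set A := \matrix_(r < d) _; set B := \matrix_(r < d) _; set C := \matrix_(r < d) _.
suff -> : \det B = 1 * \det C + 1 * \det A by ring.
have other (r : 'I_d) : r != r0 -> (r \in J :\ r0) = (r \in J) /\ set_at u r0 1 r = u r /\ set_at u r0 0 r = u r.
  by move=> ne; rewrite !inE ne /set_at (negPf ne).
apply: (@determinant_multilinear _ _ B C A r0).
- by rewrite !rowK !inE eqxx /= r0J /set_at eqxx scale0r addr0 !scale1r.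
- apply/row_matrixP => i; rewrite !row_rowsub !rowK.
  have ne : lift r0 i != r0 by rewrite eq_sym neq_lift.
  by have [e1 [e2 e3]] := other _ ne; rewrite ?e1 ?e2 ?e3.
- apply/row_matrixP => i; rewrite !row_rowsub !rowK.
  have ne : lift r0 i != r0 by rewrite eq_sym neq_lift.
  by have [e1 [e2 e3]] := other _ ne; rewrite ?e1 ?e2 ?e3.
Qed.

(** An indicator is the difference of the factor [1 + u r] at [u r = 1] and at
    [u r = 0], so induction on the set [J] of extracted points applies
    [mixed_det_diff] once for each point. *)
Lemma extract_indicators (T1 T2 : choiceType) (W : T1 -> T2 -> R) (ind : 'I_d -> T1 -> bool)
    K (z : R) :
  (forall la mu, 0 <= W la mu) ->
  (forall u, (forall r, 0 <= u r) ->
    (\esum_(la in [set: T1]) \esum_(mu in [set: T2])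
      (W la mu * \prod_r (if ind r la then 1 + u r else 1))%:E)%E =
    (z * \det (1%:M + \matrix_(r, c) (u r * K r c)))%:E) ->
  (\esum_(la in [set: T1]) \esum_(mu in [set: T2])
      (W la mu * \prod_r (ind r la)%:R)%:E)%E = (z * \det K)%:E.
Proof.
move=> W0 gen.
pose fac J u r la : R := if r \in J then (ind r la)%:R else if ind r la then 1 + u r else 1.
have fac0 J u r la : (forall r, 0 <= u r) -> 0 <= fac J u r la.
  by move=> u0; rewrite /fac; case: ifP => _; rewrite ?ler0n//; case: ifP => _; rewrite ?addr_ge0.
suff main J u : (forall r, 0 <= u r) ->
    (\esum_(la in [set: T1]) \esum_(mu in [set: T2]) (W la mu * \prod_r fac J u r la)%:E)%E =
    (z * mixed_det K J u)%:E.
  have := main [set: 'I_d]%SET (fun=> 0) (fun=> lexx 0).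
  rewrite /mixed_det (_ : \matrix_(r < d) _ = K); last first.
    by apply/row_matrixP => r; rewrite rowK inE.
  move=> <-; apply: eq_esum => la _; apply: eq_esum => mu _; congr ((_ * _)%:E).
  by apply: eq_bigr => r _; rewrite /fac inE.
elim: {J}_.+1 {-2}J (ltnSn #|J|) u => // m IH J Jm u u0.
have [->|[r0 r0J]] := set_0Vmem J.
  transitivity (\esum_(la in [set: T1]) \esum_(mu in [set: T2])
      (W la mu * \prod_r (if ind r la then 1 + u r else 1))%:E)%E.
    apply: eq_esum => la _; apply: eq_esum => mu _; congr ((_ * _)%:E).
    by apply: eq_bigr => r _; rewrite /fac inE.
  rewrite gen//; congr (_ * _)%:E; congr (\det _); apply/row_matrixP => r.
  rewrite rowK inE linearD/= row1; congr (_ + _); apply/rowP => c.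
  by rewrite !mxE.
have u1 x : 0 <= x -> forall r, 0 <= set_at u r0 x r.
  by move=> x0 r; rewrite /set_at; case: eqP.
have card : (#|J :\ r0| < m)%N by move: Jm; rewrite (cardsD1 r0) r0J add1n ltnS.
have e1 := IH _ card _ (u1 1 ler01); have e0 := IH _ card _ (u1 0 (lexx 0)).
have split_fac la : \prod_r fac (J :\ r0) (set_at u r0 1) r la =
    \prod_r fac (J :\ r0) (set_at u r0 0) r la + \prod_r fac J u r la.
  rewrite (bigD1 r0)//= [X in _ = X + _](bigD1 r0)//= [X in _ = _ + X](bigD1 r0)//=.
  have same x r : r != r0 -> fac (J :\ r0) (set_at u r0 x) r la = fac J u r la.
    by move=> ne; rewrite /fac !inE ne /set_at (negPf ne).
  rewrite (eq_bigr (fun r => fac J u r la)); last by move=> r; exact: same.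
  rewrite [X in _ = _ * X + _](eq_bigr (fun r => fac J u r la)); last by move=> r; exact: same.
  rewrite -mulrDl; congr (_ * _).
  by rewrite /fac !inE eqxx r0J /= /set_at eqxx; case: (ind r0 la); rewrite ?addr0// addrC.
have nn J' u' la mu : (forall r, 0 <= u' r) -> (0 <= (W la mu * \prod_r fac J' u' r la)%:E)%E.
  by move=> u'0; rewrite lee_fin mulr_ge0// prodr_ge0// => r _; exact: fac0.
have := e1; under eq_esum => la _.
  under eq_esum => mu _ do rewrite split_fac mulrDr EFinD.
  rewrite esumD; [|by move=> mu _; apply: nn; exact: u1|by move=> mu _; exact: nn].
  over.
rewrite esumD; last 2 first.
- by move=> la _; apply: esum_ge0 => mu _; apply: nn; exact: u1.
- by move=> la _; apply: esum_ge0 => mu _; exact: nn.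
rewrite e0 (mixed_det_diff K u r0J) mulrBr EFinB => <-.
by rewrite addeAC subee ?add0e.
Qed.

End MultiAffine.

Section Final.
Variables (R : realType) (n : nat) (X Y : 'I_n.+1 -> {fset R}).
Hypothesis hX : forall (k : 'I_n.+1) (x : R), x \in X k -> 0 <= x < 1.
Hypothesis hY : forall (k : 'I_n.+1) (y : R), y \in Y k -> 0 <= y < 1.

Definition variable (x : R) : Prop := exists k, (x \in X k) || (x \in Y k).

Lemma nested_radii_for rin rout : nested_radii X Y rin rout ->
  radii_for variable rout rin /\ radii_for variable rin rout.
Proof.
move=> [r0 rr h]; have R0 : 0 < rout by exact: lt_trans rr.
have ok x : variable x -> [/\ 0 <= x < 1, x < rin, x < rout, x * rin < 1 & x * rout < 1].
  move=> [k xk]; have [x1 x2] := h k x xk.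
  have x01 : 0 <= x < 1 by case/orP: xk => [/hX|/hY].
  have xo : x * rout < 1.
    have [->|ne] := eqVneq x 0; first by rewrite mul0r.
    have xp : 0 < x by rewrite lt_neqAle eq_sym ne; case/andP: x01.
    by rewrite mulrC -ltr_pdivlMr// mul1r x2.
  split=> //; first exact: lt_trans x1 rr.
  by apply: le_lt_trans xo; rewrite ler_wpM2l ?(ltW rr)//; case/andP: x01.
split; apply: RadiiFor => //; try (by rewrite gt_eqF); try (by rewrite lt_eqF);
  by move=> x /ok[].
Qed.

Let Xs k : seq R := X k.
Let Ys k : seq R := Y k.
Let w := schur_word Xs Ys (fun k => k : nat).

Let wgood : all (@good R) w.
Proof. exact: good_seg. Qed.

Let w_letters : letter_in variable w.
Proof.
rewrite /letter_in /w [ups _]ups_seg [downs _]downs_seg; split=> x /flattenP[_ /mapP[k _ ->]].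
  by move=> xk; exists k; rewrite xk.
by rewrite mem_rev => xk; exists k; rewrite xk orbT.
Qed.

Lemma zfactorE (s : 'I_n.+1) z : zfactor (ups (before s w)) (downs (after s w)) z =
  (\prod_(k < n.+1 | (k <= s)%N) F1 (X k) z) / (\prod_(k < n.+1 | (s <= k)%N) F1 (Y k) z^-1).
Proof.
have F1E (A : {fset R}) v : F1 A v = (\prod_(x <- A) (1 - x%:C * v))^-1.
  rewrite /F1 /Fprod big_map -prodfV; apply: eq_bigr => x _.
  by rewrite big_seq1.
rewrite /zfactor prod_ups_before prod_downs_after mulrC -!prodfV.
by congr (_ * _); apply: eq_bigr => k _; rewrite F1E ?invrK.
Qed.

Lemma wfactorE (s : 'I_n.+1) v : wfactor (ups (before s w)) (downs (after s w)) v =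
  (\prod_(k < n.+1 | (s <= k)%N) F1 (Y k) v^-1) / (\prod_(k < n.+1 | (k <= s)%N) F1 (X k) v).
Proof.
have -> : wfactor (ups (before s w)) (downs (after s w)) v =
    (zfactor (ups (before s w)) (downs (after s w)) v)^-1.
  by rewrite /wfactor /zfactor invfM invrK mulrC.
by rewrite zfactorE invfM invrK mulrC.
Qed.

Lemma schur_kernelE r1 r2 (s : 'I_n.+1) i (t : 'I_n.+1) j :
  schur_kernel X Y r1 r2 s i t j =
  ker r1 r2 (ups (before s w)) (downs (after s w)) (ups (before t w)) (downs (after t w)) i j.
Proof.
rewrite /schur_kernel /ker /dint; apply: (congr1 ( *%R _)); congr (circle_integral _ _).
apply/funext => z; congr (circle_integral _ _); apply/funext => v.
rewrite /kernel_integrand zfactorE wfactorE -!mulrA; congr (_ * _).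
by rewrite invfM; ring.
Qed.

Variables (d : nat) (a : 'I_d -> 'I_n.+1) (b : 'I_d -> int).
Hypothesis hab : injective (fun r : 'I_d => (a r, b r)).
Variables (rin rout : R).
Hypothesis rad : nested_radii X Y rin rout.

Let rio : rin < rout. Proof. by case: rad. Qed.

Let Kmat : 'M[R]_d :=
  \matrix_(r, c) word_kernel w rin rout (a c : nat) (b c) (a r : nat) (b r).

Lemma schur_kernel_real r1 r2 (s : 'I_n.+1) i (t : 'I_n.+1) j :
  admissible_radii X Y s t r1 r2 ->
  schur_kernel X Y r1 r2 s i t j = (word_kernel w rin rout s i t j)%:C.
Proof.
have [plus minus] := nested_radii_for rad.
have wsD (p : 'I_n.+1) : elems_in variable (ups (before p w)) /\ elems_in variable (downs (after p w)).
  have lw : (p : nat) \in labels w by exact: label_schur_word.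
  case: w_letters; rewrite {1 2}(split_obs lw) ups_cat downs_cat /= !elems_in_cat.
  by move=> [h1 _] [_ h2].
have [s1 s2] := wsD s; have [t1 t2] := wsD t.
rewrite schur_kernelE /word_kernel /admissible_radii; case: ifP => _ adm.
  have [_ minus'] := nested_radii_for adm.
  rewrite (ker_real _ _ minus)//; apply: (ker_indep _ _ minus' minus) => //.
  by rewrite !ltNge !ltW//; case: adm.
have [plus' _] := nested_radii_for adm.
rewrite (ker_real _ _ plus)//; apply: (ker_indep _ _ plus' plus) => //.
by rewrite rio; case: adm => _ ->.
Qed.

Lemma Zword_schur_Z : Zword [::] w = schur_Z X Y.
Proof.
rewrite Zword_schur_word big1 ?mul1r// => j _.
by rewrite /Fprod big_nil.
Qed.

Lemma schur_generating (u : 'I_d -> R) : (forall r, 0 <= u r) ->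
  (\esum_(la in [set: {ffun 'I_n.+1 -> intpart}])
     \esum_(mu in [set: {ffun 'I_n -> intpart}])
      (schur_weight X Y la mu *
       \prod_r (if occupied (b r) (la (a r)) then 1 + u r else 1))%:E)%E =
  (schur_Z X Y * \det (1%:M + \matrix_(r, c) (u r * Kmat r c)))%:E.
Proof.
move=> u0.
have [plus minus] := nested_radii_for rad.
pose a' r : nat := a r.
have ab' : injective (fun r => (a' r, b r)).
  move=> r r' [e1 e2]; apply: hab; congr pair => //.
  exact: val_inj.
have aw r : a' r \in labels w by exact: label_schur_word.
have := word_correlation (sorted_schur_word Xs Ys) w_letters wgood plus minus rio ab' aw u0.
rewrite Zword_schur_Z.
have -> : \matrix_(r, c) (u r * word_kernel w rin rout (a' c) (b c) (a' r) (b r)) =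
    \matrix_(r, c) (u r * Kmat r c).
  by apply/matrixP => r c; rewrite !mxE.
move=> <-.
have o0 s la : 0 <= obs_factor a' b u s la.
  by apply: prodr_ge0 => r _; case: ifP => // _; rewrite addr_ge0.
rewrite -(chain_sum (X := Xs) (Y := Ys) o0 (fun k : 'I_n.+1 => nat_of_ord k) empty_part)//.
apply: eq_esum => la _; apply: eq_esum => mu _; congr ((_ * _)%:E).
rewrite /obs_factor (exchange_big_dep predT)//=; apply: eq_bigr => r _.
by rewrite (big_pred1 (a r))// => k; rewrite /= eq_sym.
Qed.

Lemma subset_config (la : {ffun 'I_n.+1 -> intpart}) :
  (\prod_r (occupied (b r) (la (a r)))%:R : R) =
  (if la \in [set la | [set (a r, b r) | r in [set: 'I_d]] `<=` point_config la] then 1 else 0).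
Proof.
case: ifPn => [/set_mem h|nh].
  rewrite big1// => r _; suff -> : occupied (b r) (la (a r)) by [].
  by apply/asboolP; have := h (a r, b r); apply; exists r.
have [r hr|all_occ] := pickP (fun r => ~~ occupied (b r) (la (a r))).
  by rewrite (bigD1 r)//= (negPf hr) mul0r.
case/negP: nh; apply: mem_set => _ [r _ <-].
by have /negbFE/asboolP := all_occ r.
Qed.

Lemma schur_Z_gt0 : 0 < schur_Z X Y.
Proof. by rewrite -Zword_schur_Z Zword_gt0. Qed.

Lemma correlation_det :
  correlation X Y [set (a r, b r) | r in [set: 'I_d]] = (\det Kmat)%:E.
Proof.
have Z0 := schur_Z_gt0.
have w0 la mu : 0 <= schur_weight X Y la mu.
  by apply: (@chain_weight_ge0 R n Xs Ys empty_part) => k x xk; [case/andP: (hX xk)|case/andP: (hY xk)].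
have e := @extract_indicators R d _ _ (schur_weight X Y) (fun r la => occupied (b r) (la (a r)))
  Kmat (schur_Z X Y) w0 schur_generating.
have Zi : 0 <= (schur_Z X Y)^-1 by rewrite invr_ge0 ltW.
transitivity ((schur_Z X Y)^-1%:E * (schur_Z X Y * \det Kmat)%:E)%E; last first.
  by rewrite -EFinM mulKf// gt_eqF.
have p0 la : 0 <= \prod_r (occupied (b r) (la (a r)))%:R :> R.
  by apply: prodr_ge0 => r _; rewrite ler0n.
rewrite -e -esumZl//; last first.
  by move=> la _; apply: esum_ge0 => mu _; rewrite lee_fin mulr_ge0.
rewrite /correlation esum_mkcond; apply: eq_esum => la _.
rewrite -esumZl//; last by move=> mu _; rewrite lee_fin mulr_ge0.
rewrite subset_config; case: ifP => _.
  by apply: eq_esum => mu _; rewrite -EFinM mulr1 mulrC.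
by rewrite esum1// => mu _; rewrite mulr0 mule0.
Qed.

End Final.

Theorem theorem1p1p2 (R : realType) (n : nat) (X Y : 'I_n.+1 -> {fset R})
  (hX : forall (k : 'I_n.+1) (x : R), x \in X k -> 0 <= x < 1)
  (hY : forall (k : 'I_n.+1) (y : R), y \in Y k -> 0 <= y < 1)
  (r1 r2 : 'I_n.+1 -> int -> 'I_n.+1 -> int -> R)
  (hr : forall (s : 'I_n.+1) (i : int) (t : 'I_n.+1) (j : int),
      admissible_radii X Y s t (r1 s i t j) (r2 s i t j))
  (d : nat) (a : 'I_d -> 'I_n.+1) (b : 'I_d -> int)
  (hab : injective (fun r : 'I_d => (a r, b r))) :
  let T : set ('I_n.+1 * int) := [set (a r, b r) | r in [set: 'I_d]] in
  let K (s : 'I_n.+1) (i : int) (t : 'I_n.+1) (j : int) : R[i] :=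
    schur_kernel X Y (r1 s i t j) (r2 s i t j) s i t j in
  let KT : 'M[R[i]]_d := \matrix_(r < d, c < d) K (a r) (b r) (a c) (b c) in
  correlation X Y T \is a fin_num /\ (fine (correlation X Y T))%:C = \det KT.
Proof.
move=> T K KT.
have rad : nested_radii X Y (r2 ord0 0 ord0 0) (r1 ord0 0 ord0 0).
  by have := hr ord0 0 ord0 0; rewrite /admissible_radii ltnn.
rewrite /T (correlation_det hX hY hab rad); split => //=.
(* The generating function has the transposed matrix. *)
rewrite -det_map_mx -det_tr; congr (\det _); apply/matrixP => r c.
by rewrite !mxE /K (schur_kernel_real hX hY rad).
Qed.
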